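(* Let $g:\mathbb{R}\to\mathbb{R}$ be Lipschitz continuous, $\mathbb{Z}$-periodic and such that $g(y)>0$ for every $y$, let $u_0:\mathbb{R}^n\to\mathbb{R}$ be Lipschitz continuous with Lipschitz constant $L$, and let $0<\alpha<1$. For $\varepsilon>0$ let $u^\varepsilon_\alpha$ be the solution to $$u^\varepsilon_t-\varepsilon^\alpha\Delta u^\varepsilon-g\left(\frac{u^\varepsilon}{\varepsilon}\right)=0\ \text{ in }\mathbb{R}^n\times(0,+\infty),\qquad u^\varepsilon(x,0)=u_0(x)\ \text{ in }\mathbb{R}^n.$$ Then every locally uniform limit $u$ of $u^\varepsilon_\alpha$ is a Lipschitz continuous function which satisfies $$|u(x,t)-u(y,s)|\le L|x-y|+\|g\|_\infty|t-s|\qquad\forall x,y\in\mathbb{R}^n,\ t,s\ge0,$$ and solves in the viscosity sense the problem $$u_t-\bar c_-(|\nabla u|)=0\ \text{ in }\mathbb{R}^n\times(0,+\infty),\qquad u(x,0)=u_0(x)\ \text{ in }\mathbb{R}^n,$$ where $$\bar c_-(|p|)=\begin{cases}\int_0^1 g(s)\,ds & p\ne0,\\ \left(\int_0^1\frac1{g(s)}\,ds\right)^{-1}& p=0.\end{cases}$$ Moreover: i) $u$ satisfies in the viscosity sense $u_t=\int_0^1 g(s)\,ds$ in every open set $\Omega\subset\mathbb{R}^n\times[0,+\infty)$ such that $\nabla u\ne0$ a.e. in $\Omega$. ii) $u$ is a viscosity subsolution to $u_t=\left(\int_0^1\frac1{g(s)}\,ds\right)^{-1}$ at every point $(x_0,t_0)$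 such that $(0,X,\lambda)\in D^+u(x_0,t_0)$ with $X<0$ in the sense of matrices; that is, for every such $(0,X,\lambda)$ one has $\lambda\le\left(\int_0^1\frac1{g(s)}\,ds\right)^{-1}$. iii) $u$ is a viscosity supersolution to $u_t=\int_0^1 g(s)\,ds$ at every point $(x_0,t_0)$ such that $(0,X,\lambda)\in D^-u(x_0,t_0)$ and there exist $\eta\in\mathbb{R}^n\setminus\{0\}$, $\delta>0$ such that $\eta^tX\eta\ge\delta|\eta|^2$; that is, for every such $(0,X,\lambda)$ one has $\lambda\ge\int_0^1 g(s)\,ds$.
   Context: $\nabla,\nabla^2,\Delta$ are the gradient, Hessian and Laplacian in $x$. The solution $u^\varepsilon_\alpha$ is the unique (classical) solution, of class $C^{2+\gamma,1+\gamma/2}$ for all $\gamma\in(0,1)$. A locally uniform limit of $u^\varepsilon_\alpha$ is a function $u$ such that $u^{\varepsilon_k}_\alpha\to u$ locally uniformly in $\mathbb{R}^n\times[0,+\infty)$ for some sequence $\varepsilon_k\to0^+$. Super- and subjets: for a continuous function $u$ and $(x_0,t_0)\in\mathbb{R}^n\times(0,+\infty)$, $$D^+u(x_0,t_0)=\{(\nabla\phi(x_0,t_0),\nabla^2\phi(x_0,t_0),\phi_t(x_0,t_0)):\ \phi\in C^2,\ \phi\ge u,\ \phi(x_0,t_0)=u(x_0,t_0)\},$$ $$D^-u(x_0,t_0)=\{(\nabla\phi(x_0,t_0),\nabla^2\phi(x_0,t_0),\phi_t(x_0,t_0)):\ \phi\in C^2,\ \phi\le u,\ \phi(x_0,t_0)=u(x_0,t_0)\}.$$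 Viscosity solutions for a possibly discontinuous operator $F(p,X)$: a continuous $u:\mathbb{R}^n\times[0,+\infty)\to\mathbb{R}$ is a subsolution of $u_t-F(\nabla u,\nabla^2u)=0$, $u(x,0)=u_0(x)$, if $u(x,0)\le u_0(x)$ and $\lambda-F^\star(p,X)\le0$ for all $(x_0,t_0)\in\mathbb{R}^n\times(0,+\infty)$ and $(p,X,\lambda)\in D^+u(x_0,t_0)$; it is a supersolution if $u(x,0)\ge u_0(x)$ and $\lambda-F_\star(p,X)\ge0$ for all $(x_0,t_0)\in\mathbb{R}^n\times(0,+\infty)$ and $(p,X,\lambda)\in D^-u(x_0,t_0)$; a solution is both. Here $F^\star$, $F_\star$ are the upper and lower semicontinuous envelopes of $F$. In the present case $F(p,X)=\bar c_-(|p|)$, with $F_\star=\bar c_-$ and $F^\star\equiv\int_0^1 g(s)\,ds$. *)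

(* Defs.v *)
From HB Require Import structures.
From mathcomp Require Import all_boot all_order all_algebra.
From mathcomp Require Import all_classical all_reals all_analysis.

Set Implicit Arguments.
Unset Strict Implicit.
Unset Printing Implicit Defensive.

Import Order.TTheory GRing.Theory Num.Theory.
Import numFieldNormedType.Exports.

Local Open Scope classical_set_scope.
Local Open Scope ring_scope.

(* A point (x, t) of R^n x R has type 'rV[R]_n * R. A function on
   R^n x [0, +oo) is a total function on this type, of which only the values
   at t >= 0 are ever used. *)

Section SpaceTime.
Context {R : realType} {n : nat}.
Implicit Types (x y p q : 'rV[R]_n) (X Y : 'M[R]_n) (t s : R).
Implicit Types (z w : 'rV[R]_n * R) (f u phi : 'rV[R]_n * R -> R).

(* The library norm on row vectors is the sup norm. *)
Definition enorm x : R := Num.sqrt (\sum_i x 0 i ^+ 2).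

Definition closed_half : set ('rV[R]_n * R) := [set z | 0 <= z.2].
Definition open_half : set ('rV[R]_n * R) := [set z | 0 < z.2].

Definition xdir (i : 'I_n) : 'rV[R]_n * R := (delta_mx 0 i, 0).
Definition tdir : 'rV[R]_n * R := (0, 1).

Definition grad f z : 'rV[R]_n := \row_i 'D_(xdir i) f z.
Definition hess f z : 'M[R]_n := \matrix_(i, j) 'D_(xdir i) ('D_(xdir j) f) z.
Definition laplacian f z : R := \tr (hess f z).
Definition dt f z : R := 'D_tdir f z.

(* All directional derivatives are used, in place of the partial ones, so that
   C^1 and C^2 (jointly in (x, t)) do not depend on a choice of coordinates. *)
Definition C1_on (U : set ('rV[R]_n * R)) f :=
  {within U, continuous f} /\
  forall v, (forall z, U z -> derivable f z v) /\
            {within U, continuous ('D_v f)}.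

Definition C2_on (U : set ('rV[R]_n * R)) f :=
  C1_on U f /\ forall v, C1_on U ('D_v f).

Definition C21_on (U : set ('rV[R]_n * R)) f :=
  [/\ forall z, U z -> derivable f z tdir /\
        forall i, derivable f z (xdir i) /\
          forall j, derivable ('D_(xdir i) f) z (xdir j),
      {within U, continuous f},
      {within U, continuous (dt f)},
      {within U, continuous (grad f)} &
      {within U, continuous (hess f)}].

Definition loc_parabolic_holder (V : normedModType R) (U : set ('rV[R]_n * R))
    (gamma : R) (h : 'rV[R]_n * R -> V) :=
  forall K, compact K -> K `<=` U ->
    exists C : R, forall z w, K z -> K w ->
      `|h z - h w| <= C * (enorm (z.1 - w.1) `^ gamma
                           + `|z.2 - w.2| `^ (gamma / 2)).

Definition C2gamma_on (U : set ('rV[R]_n * R)) (gamma : R) f :=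
  [/\ C21_on U f, loc_parabolic_holder U gamma (dt f) &
      loc_parabolic_holder U gamma (hess f)].

(* The linear growth, locally uniform in time, selects the solution: without
   a growth condition the Cauchy problem is not uniquely solvable. *)
Definition heat_solution (eps alpha : R) (g : R -> R) (u0 : 'rV[R]_n -> R) u :=
  [/\ {within closed_half, continuous u},
      forall x, u (x, 0) = u0 x,
      forall gamma, 0 < gamma < 1 -> C2gamma_on open_half gamma u,
      forall z, open_half z ->
        dt u z - eps `^ alpha * laplacian u z - g (u z / eps) = 0 &
      forall T : R, exists C : R, forall x t, 0 <= t <= T ->
        `|u (x, t)| <= C * (1 + enorm x)].

Definition locally_uniform_limit
    (U : R -> 'rV[R]_n * R -> R) u :=
  exists eps : nat -> R,
    [/\ forall k, 0 < eps k,
        eps @ \oo --> (0 : R) &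
        forall K, compact K -> K `<=` closed_half ->
          {uniform K, (fun k => U (eps k)) @ \oo --> u}].

Definition superjet u z : set ('rV[R]_n * 'M[R]_n * R) :=
  [set j | exists phi : 'rV[R]_n * R -> R,
    [/\ C2_on open_half phi,
        forall w, open_half w -> u w <= phi w,
        phi z = u z &
        j = (grad phi z, hess phi z, dt phi z)]].

Definition subjet u z : set ('rV[R]_n * 'M[R]_n * R) :=
  [set j | exists phi : 'rV[R]_n * R -> R,
    [/\ C2_on open_half phi,
        forall w, open_half w -> phi w <= u w,
        phi z = u z &
        j = (grad phi z, hess phi z, dt phi z)]].

(* Operators F(p, X) have as domain the symmetric matrices X. *)
Definition sym_ball p X (r : R) : set ('rV[R]_n * 'M[R]_n) :=
  ball (p, X) r `&` [set qY | qY.2^T = qY.2].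

Definition usc_envelope (F : 'rV[R]_n -> 'M[R]_n -> R) p X : \bar R :=
  ereal_inf [set ereal_sup [set (F qY.1 qY.2)%:E | qY in sym_ball p X r]
            | r in [set r : R | 0 < r]].

Definition lsc_envelope (F : 'rV[R]_n -> 'M[R]_n -> R) p X : \bar R :=
  ereal_sup [set ereal_inf [set (F qY.1 qY.2)%:E | qY in sym_ball p X r]
            | r in [set r : R | 0 < r]].

(* u_t - F(grad u, hess u) = 0 at the points of Omega with t > 0 *)
Definition viscosity_subsolution_in (Omega : set ('rV[R]_n * R))
    (F : 'rV[R]_n -> 'M[R]_n -> R) u :=
  {within Omega, continuous u} /\
  forall z, Omega z -> open_half z ->
    forall p X (lambda : R), superjet u z (p, X, lambda) ->
      (lambda%:E <= usc_envelope F p X)%E.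

Definition viscosity_supersolution_in (Omega : set ('rV[R]_n * R))
    (F : 'rV[R]_n -> 'M[R]_n -> R) u :=
  {within Omega, continuous u} /\
  forall z, Omega z -> open_half z ->
    forall p X (lambda : R), subjet u z (p, X, lambda) ->
      (lsc_envelope F p X <= lambda%:E)%E.

Definition viscosity_solution_in (Omega : set ('rV[R]_n * R))
    (F : 'rV[R]_n -> 'M[R]_n -> R) u :=
  viscosity_subsolution_in Omega F u /\ viscosity_supersolution_in Omega F u.

Definition cauchy_viscosity_subsolution
    (F : 'rV[R]_n -> 'M[R]_n -> R) (u0 : 'rV[R]_n -> R) u :=
  viscosity_subsolution_in closed_half F u /\ forall x, u (x, 0) <= u0 x.

Definition cauchy_viscosity_supersolution
    (F : 'rV[R]_n -> 'M[R]_n -> R) (u0 : 'rV[R]_n -> R) u :=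
  viscosity_supersolution_in closed_half F u /\ forall x, u0 x <= u (x, 0).

Definition cauchy_viscosity_solution
    (F : 'rV[R]_n -> 'M[R]_n -> R) (u0 : 'rV[R]_n -> R) u :=
  cauchy_viscosity_subsolution F u0 u /\ cauchy_viscosity_supersolution F u0 u.

(* Lebesgue-null subsets of R^n x R: for every e > 0, A is covered by countably
   many closed boxes [a k, b k] of total volume at most e. *)
Definition lebesgue_null (A : set ('rV[R]_n * R)) :=
  forall e : R, 0 < e ->
    exists a b : nat -> 'rV[R]_n * R,
      [/\ forall k, (forall i, (a k).1 0 i <= (b k).1 0 i) /\
                    (a k).2 <= (b k).2,
          A `<=` \bigcup_k [set z : 'rV[R]_n * R |
            (forall i, (a k).1 0 i <= z.1 0 i <= (b k).1 0 i) /\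
            (a k).2 <= z.2 <= (b k).2] &
          (\sum_(0 <= k <oo)
             ((\prod_i ((b k).1 0 i - (a k).1 0 i)) * ((b k).2 - (a k).2))%:E
           <= e%:E)%E].

Definition grad_neq0_ae_in (Omega : set ('rV[R]_n * R)) u :=
  lebesgue_null (Omega `\`
    [set z | differentiable (fun y => u (y, z.2)) z.1 /\ grad u z <> 0]).

Definition open_in_closed_half (Omega : set ('rV[R]_n * R)) :=
  exists2 O : set ('rV[R]_n * R), open O & Omega = O `&` closed_half.

Definition negative_definite X :=
  forall xi : 'rV[R]_n, xi != 0 -> (xi *m X *m xi^T) 0 0 < 0.

End SpaceTime.

Section Averages.
Context {R : realType}.

Definition unit_avg (g : R -> R) : R := \int[lebesgue_measure]_(s in `[0, 1]) g s.

Definition harmonic_avg (g : R -> R) : R := (unit_avg (fun s => (g s)^-1))^-1.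

Definition cbar_minus (g : R -> R) (r : R) : R :=
  if r == 0 then harmonic_avg g else unit_avg g.

Definition sup_norm (g : R -> R) : R := sup (range (fun y => `|g y|)).

End Averages.

(* Main.v *)
Require Import Defs.
From HB Require Import structures.
From mathcomp Require Import all_boot all_order all_algebra.
From mathcomp Require Import all_classical all_reals all_analysis.
From mathcomp Require Import measurable_realfun ring lra.

(** Locally u_eps looks like a pulsating front: where the limit u has
    gradient p, u_eps is close to eps W ((p . x + c t) / eps) with W increasing
    and W - id periodic.  Written in terms of the time derivative V = c W' of the
    front as a function of its height, the front equation becomes the
    one-dimensional periodic problem k V V' = V - g with
    k = eps^(alpha - 1) |p|^2 / c^2 and c the harmonic average of V.  Since
    alpha < 1, k tends to infinity when p is not 0, and then V is nearly constant
    and c tends to the arithmetic average of g; for p = 0 one has k = 0, V = g and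
    c is the harmonic average of g.  In all cases c lies between the two averages.
    This explains the jump of the limit operator.

    Given a profile V, the change of unknown v = S u with S' = c / V (u / eps)
    rectifies the front: where eps^(alpha - 1) |grad v|^2 = k c^2, it turns the
    equation into v_t = eps^alpha Delta v + c, and |S y - y| <= eps
    ([transformed_touch], [wave_coordinate_close]).  If a quadratic function
    touches the limit u at a point, one would like to compare it with S u_eps, but
    the profile that is needed depends on the gradient of the test function at the
    contact point, which is not known in advance.  So the minimum is taken
    simultaneously over the point and over a finite family of profiles whose values
    kappa_j of k c^2 form a fine geometric progression, with a penalty of size eps
    that forces kappa_j to match the actual gradient ([wave_minimum],
    [wave_bound_fixed]).  Letting eps tend to 0 gives the two viscosity inequalities
    ([limit_supersolution], [limit_subsolution]).  For a test function whose space
    part is strictly concave, a test function of t alone and one profile with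
    small k suffice; its gradient vanishes, whence statement ii)
    ([limit_subsolution_concave]).

    The Lipschitz estimate holds up to errors that vanish with eps: the equation is
    invariant under translations and under u |-> u + eps, so a comparison principle
    propagates the modulus of continuity of the initial datum, measured with a
    paraboloid barrier ([parabolic_comparison], [heat_modulus]).

    For statement iii), a kink sigma |eta . (x - x0)| is added to the test
    function.  The perturbed contact point has nonzero gradient by convexity in
    the direction eta, so the supersolution inequality with the arithmetic average
    applies there ([subjet_convex_direction]).

    For statement i), suppose that u (x0, .) grows more slowly than the arithmetic
    average on some time interval.  On some nearby vertical segment, above a point y,
    the bad set has small measure, and since u is Lipschitz in time some level h is
    not attained there at a bad time.  The first time at which a steep paraboloid of vertex y and
    level h meets the graph from below gives a contact point: if it lies above a
    point other than y, the gradient is nonzero and the supersolution inequality is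
    violated; if it lies above y, the gradient in space vanishes at a good time,
    which is impossible ([null_slice], [avoid_value], [vertical_growth]). *)

Set Implicit Arguments.
Unset Strict Implicit.
Unset Printing Implicit Defensive.

Import Order.TTheory GRing.Theory Num.Theory.
Import numFieldNormedType.Exports.

Local Open Scope classical_set_scope.
Local Open Scope ring_scope.


(** * One-variable calculus *)

Section OneVariable.
Context {R : realType}.
Implicit Types (f g A B : R -> R).

Lemma is_derive_eps f (x d : R) : is_derive x 1 f d ->
  forall e : R, 0 < e -> exists2 r : R, 0 < r &
    forall h, `|h| < r -> `|f (x + h) - f x - d * h| <= e * `|h|.
Proof.
move=> [dfx dfE] e e0.
have /cvgrPdist_le/(_ e e0) : (fun h => h^-1 *: ((f \o shift x) (h *: 1) - f x)) @ 0^' --> d.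
  by rewrite -dfE.
rewrite near_withinE => /nbhs_ballP[r /= r0 hr]; exists r => // h hr'.
have [->|h0] := eqVneq h 0; first by rewrite addr0 subrr mulr0 subr0 normr0 mulr0.
have := hr h; rewrite /ball/= sub0r normrN => /(_ hr' h0).
rewrite /shift /= [h *: 1]mulr1 /GRing.scale /= (addrC h x) => le_e.
have -> : f (x + h) - f x - d * h = - (h * (d - h^-1 * (f (x + h) - f x))).
  by field.
by rewrite normrN normrM mulrC ler_wpM2r.
Qed.

Lemma is_derive_continuous f (x d : R) :
  is_derive x 1 f d -> {for x, continuous f}.
Proof.
by move=> [H _]; apply: differentiable_continuous; exact/derivable1_diffP.
Qed.

Lemma dercst (c x : R) : is_derive x 1 (fun _ : R => c) 0.
Proof. exact: is_derive_cst. Qed.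

Lemma derid (x : R) : is_derive x 1 (fun y : R => y) 1.
Proof. exact: is_derive_id. Qed.

Lemma derD f g (x a b : R) : is_derive x 1 f a -> is_derive x 1 g b ->
  is_derive x 1 (fun y => f y + g y) (a + b).
Proof. by move=> df dg; exact: is_deriveD. Qed.

Lemma derB f g (x a b : R) : is_derive x 1 f a -> is_derive x 1 g b ->
  is_derive x 1 (fun y => f y - g y) (a - b).
Proof. by move=> df dg; exact: is_deriveB. Qed.

Lemma derM f g (x a b : R) : is_derive x 1 f a -> is_derive x 1 g b ->
  is_derive x 1 (fun y => f y * g y) (f x * b + g x * a).
Proof. by move=> df dg; exact: is_deriveM. Qed.

Lemma derZ (c : R) f (x a : R) : is_derive x 1 f a ->
  is_derive x 1 (fun y => c * f y) (c * a).
Proof. by move=> df; exact: is_deriveZ. Qed.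

Lemma derV f (x a : R) : f x != 0 -> is_derive x 1 f a ->
  is_derive x 1 (fun y => (f y)^-1) (- a / (f x) ^+ 2).
Proof.
move=> fx0 df; have [H E] := df; split; first exact: derivableV.
by rewrite deriveV// E /GRing.scale/= mulrC mulrN mulNr.
Qed.

Lemma dercomp f g (x a b : R) : is_derive (f x) 1 g b -> is_derive x 1 f a ->
  is_derive x 1 (fun y => g (f y)) (b * a).
Proof. by move=> dg df; apply: (is_derive1_comp (f := g) (g := f)). Qed.

Lemma dereq f (x a b : R) : is_derive x 1 f a -> a = b -> is_derive x 1 f b.
Proof. by move=> H <-. Qed.

Lemma mean_value f (df : R -> R) (a b : R) : a <= b ->
  (forall x : R, a <= x <= b -> is_derive x 1 f (df x)) ->
  exists2 c, a <= c <= b & f b - f a = df c * (b - a).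
Proof.
move=> ab H.
have [||c] := @MVT_segment R f df a b ab.
- by move=> x; rewrite in_itv /= => /andP[ax xb]; apply: H; rewrite !ltW.
- apply: derivable_within_continuous => x; rewrite in_itv/= => xab.
  by have [] := H x xab.
by rewrite in_itv/= => cab E; exists c.
Qed.

Lemma increment_le A B f g (a b : R) : a <= b ->
  (forall x : R, is_derive x 1 A (f x)) -> (forall x : R, is_derive x 1 B (g x)) ->
  (forall x, f x <= g x) -> A b - A a <= B b - B a.
Proof.
move=> ab dA dB fg.
have [c _ E] := mean_value (f := fun x => B x - A x) ab (fun x _ => derB (dB x) (dA x)).
have : 0 <= (g c - f c) * (b - a) by rewrite mulr_ge0// subr_ge0.
by rewrite -E; lra.
Qed.

Lemma taylor_order2 f (df d2f : R -> R) :
  (forall x : R, 0 <= x <= 1 -> is_derive x 1 f (df x)) ->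
  (forall x : R, 0 <= x <= 1 -> is_derive x 1 df (d2f x)) ->
  exists2 c, 0 <= c <= 1 & f 1 = f 0 + df 0 + d2f c / 2.
Proof.
move=> d1 d2.
(* the constant K makes the auxiliary function vanish at both ends *)
pose K := f 1 - f 0 - df 0.
pose h x := f x - f 0 - df 0 * x - K * x ^+ 2.
have dh (x : R) : 0 <= x <= 1 -> is_derive x 1 h (df x - df 0 - 2 * K * x).
  move=> x01; have dfx := d1 x x01.
  apply: dereq (derB (derB (derB dfx (dercst _ _)) (derZ _ (derid _)))
    (derZ K (derM (derid x) (derid x)))) _.
  ring.
(* Rolle for the auxiliary function on the open interval *)
have [c c01 Ec] : exists2 c : R, c \in `]0, 1[%R & is_derive c (1 : R) h 0.
  apply: Rolle; [exact: ltr01| | |].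
  - by move=> x; rewrite in_itv/= => /andP[x0 x1]; have [] := dh x _ => //; rewrite !ltW.
  - by apply: derivable_within_continuous => x; rewrite in_itv/= => x01; have [] := dh x x01.
  - by rewrite /h /K; ring.
move: c01; rewrite in_itv/= => /andP[c0 c1].
have E2 : df c - df 0 - 2 * K * c = 0.
  have c01 : 0 <= c <= 1 by rewrite !ltW.
  have [_ <-] := dh c c01.
  by have [_ ->] := Ec.
have d2c (x : R) : 0 <= x <= c -> is_derive x 1 df (d2f x).
  by move=> /andP[x0 xc]; apply: d2; rewrite x0 (le_trans xc)// ltW.
have [e /andP[e0 ec] E3] := mean_value (ltW c0) d2c.
exists e; first by rewrite e0 (le_trans ec)// ltW.
have : d2f e * c = (2 * K) * c by rewrite subr0 in E3; rewrite -E3; move: E2; lra.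
have cn0 : c != 0 by rewrite gt_eqF.
by move=> /(mulIf cn0); rewrite /K => H; lra.
Qed.

End OneVariable.

Section Primitive.
Context {R : realType}.
Implicit Types (f g A B : R -> R).

Lemma eq_of_derive A B f (a b : R) : a <= b ->
  (forall x : R, a <= x <= b -> is_derive x 1 A (f x)) ->
  (forall x : R, a <= x <= b -> is_derive x 1 B (f x)) ->
  B b - B a = A b - A a.
Proof.
move=> ab dA dB.
have [c _ E] := mean_value ab (fun x xab => derB (dB x xab) (dA x xab)).
by move: E; rewrite subrr mul0r; lra.
Qed.

(** The integrals of f from - (N + 1) agree, up to a constant, on their common
    domains of definition; they are glued along N. *)
Lemma primitive_exists f : continuous f ->
  exists A, forall x : R, is_derive x 1 A (f x).
Proof.
move=> cf.
pose F (N : nat) (x : R) : R :=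
  \int[lebesgue_measure]_(t in `[- N.+1%:R, x]) f t
  - \int[lebesgue_measure]_(t in `[- N.+1%:R, 0]) f t.
have dF N (x : R) : - N.+1%:R < x -> is_derive x 1 (F N) (f x).
  move=> Nx; have xu : x < x + 1 by rewrite ltrDl.
  have [|//|d E] := @continuous_FTC1_closed R f (- N.+1%:R) x (x + 1) xu _ Nx.
  - apply: continuous_compact_integrable; first exact: segment_compact.
    exact/continuous_subspaceT.
  - exact: cf.
  apply: dereq (derB (f := fun y => \int[lebesgue_measure]_(t in `[- N.+1%:R, y]) f t) _ (dercst _ x)) _.
    by split; [exact: d | exact: erefl].
  by rewrite subr0 -E derive1E.
have F0 N : F N 0 = 0 by rewrite /F subrr.
have FNM N M x : - N.+1%:R < x -> (N <= M)%N -> F M x = F N x.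
  move=> Nx NM.
  have MN : - M.+1%:R <= - N.+1%:R :> R by rewrite lerN2 ler_nat.
  have N0 : - N.+1%:R < 0 :> R by rewrite oppr_lt0.
  suff : F M x - F M 0 = F N x - F N 0 by rewrite !F0 !subr0.
  have [x0|x0] := leP 0 x.
    apply: (eq_of_derive (f := f) x0) => y /andP[y0 _]; apply: dF.
      exact: lt_le_trans y0.
    exact: le_lt_trans (lt_le_trans N0 y0).
  suff : F M 0 - F M x = F N 0 - F N x by move=> E; rewrite -(opprB (F M 0)) E opprB.
  apply: (eq_of_derive (f := f) (ltW x0)) => y /andP[y0 _]; apply: dF.
    exact: lt_le_trans y0.
  exact: le_lt_trans (lt_le_trans Nx y0).
pose A x := F (Num.truncn `|x|) x.
have An x N : - N.+1%:R < x -> A x = F N x.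
  move=> Nx; have xA : - (Num.truncn `|x|).+1%:R < x.
    rewrite ltrNl; apply: le_lt_trans (truncnS_gt _).
    by rewrite -normrN ler_norm.
  have [le|/ltnW le] := leqP (Num.truncn `|x|) N.
    by rewrite /A -(FNM _ _ _ xA le).
  by rewrite /A (FNM _ _ _ Nx le).
exists A => x; pose N := (Num.truncn (`|x| + 1)).
have Nx : `|x| + 1 < N.+1%:R by exact: truncnS_gt.
have [|d E] := dF N x; first by rewrite ltrNl -normrN in Nx *; apply: le_lt_trans Nx; rewrite (le_trans (ler_norm _))// lerDl.
apply: near_eq_is_derive; last by split; [exact: d|exact: E].
apply/nbhs_ballP; exists 1; first exact: ltr01.
move=> y; rewrite -ball_normE => /= xy.
apply/esym/An; rewrite ltrNl; apply: le_lt_trans Nx.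
rewrite (le_trans (ler_norm _))// normrN.
have -> : y = x - (x - y) by lra.
by rewrite (le_trans (ler_normB _ _))// lerD2l ltW.
Qed.

Lemma unit_avg_primitive f A : continuous f ->
  (forall x : R, is_derive x 1 A (f x)) -> unit_avg f = A 1 - A 0.
Proof.
move=> cf dA; rewrite /unit_avg /Rintegral.
rewrite (@continuous_FTC2 _ f A 0 1) ?ltr01//.
- exact/continuous_subspaceT.
- split.
  + by move=> x _; have [] := dA x.
  + by apply: cvg_at_right_filter; apply: is_derive_continuous (dA 0).
  + by apply: cvg_at_left_filter; apply: is_derive_continuous (dA 1).
- by move=> x _; rewrite derive1E; have [_ ->] := dA x.
Qed.

Lemma periodic_int f : periodic f 1 -> forall (m : int) (x : R), f (x + m%:~R) = f x.
Proof.
move=> fp [m|m] x; first by rewrite -[Posz m]/(m%:Z) /= periodicn.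
by rewrite NegzE mulrNz -(periodicn fp m.+1 (x - _)) subrK.
Qed.

Lemma periodic_floor f : periodic f 1 -> forall x : R,
  exists2 y, 0 <= y < 1 & exists m : int, x = y + m%:~R /\ f x = f y.
Proof.
move=> fp x.
exists (x - (Num.floor x)%:~R).
  by rewrite subr_ge0 floor_le ltrBlDl; have := floorD1_gt x; rewrite intrD.
by exists (Num.floor x); rewrite subrK -(periodic_int fp (Num.floor x) (x - _)) subrK.
Qed.

End Primitive.

(** * Periodic linear differential equations *)

Section PeriodicExtrema.
Context {R : realType}.
Implicit Types (f g h Y Z : R -> R).

Lemma periodic_max f : periodic f 1 -> continuous f ->
  exists s, forall t, f t <= f s.
Proof.
move=> fp cf.
have [s _ smax] := @EVT_max R f 0 1 ler01 (continuous_subspaceT cf).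
exists s => t; have [y /andP[y0 y1] [m [_ ->]]] := periodic_floor fp t.
by apply: smax; rewrite in_itv/= y0 ltW.
Qed.

Lemma derive_at_max f (s d r : R) : 0 < r -> is_derive s 1 f d ->
  (forall t, `|t - s| < r -> f t <= f s) -> d = 0.
Proof.
move=> r0 df fmax.
have abs (e : R) : 0 < e -> `|d : R| <= e.
  move=> e0; have [r' r'0 H] := is_derive_eps df e0.
  pose h := Num.min r r' / 2.
  have h0 : 0 < h by rewrite divr_gt0// lt_min r0 r'0.
  have hr : h < r by rewrite ltr_pdivrMr// gt_min; apply/orP; left; lra.
  have hr' : h < r' by rewrite ltr_pdivrMr// gt_min; apply/orP; right; lra.
  have nh : `|h| = h by rewrite gtr0_norm.
  have := H h; rewrite nh => /(_ hr') H1.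
  have := H (- h); rewrite normrN nh => /(_ hr') H2.
  have F1 : f (s + h) <= f s by apply: fmax; rewrite addrAC subrr add0r nh.
  have F2 : f (s - h) <= f s by apply: fmax; rewrite addrAC subrr add0r normrN nh.
  move: H1 H2; rewrite !ler_norml => /andP[H1 _] /andP[H2 _].
  by apply/andP; split; rewrite -(ler_pM2r h0); move: H1 H2 F1 F2; lra.
apply/eqP; rewrite -normr_le0; apply/ler_addgt0Pr => e e0.
by rewrite add0r abs.
Qed.

Lemma derive_at_min f (s d r : R) : 0 < r -> is_derive s 1 f d ->
  (forall t, `|t - s| < r -> f s <= f t) -> d = 0.
Proof.
move=> r0 df fmin; apply: oppr_inj; rewrite oppr0.
apply: (derive_at_max (f := fun t => - f t) r0 (is_deriveN df)) => t ts.
by rewrite lerN2 fmin.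
Qed.

(** Maximum principle: at a maximum of Y1 - Y2 the derivative vanishes, which
    gives m (Y1 - Y2) = h1 - h2 there. *)
Lemma linear_ode_compare (m c : R) h1 h2 Y1 Y2 : 0 < m ->
  periodic Y1 1 -> periodic Y2 1 ->
  (forall s : R, is_derive s 1 Y1 (m * Y1 s - h1 s)) ->
  (forall s : R, is_derive s 1 Y2 (m * Y2 s - h2 s)) ->
  (forall s, h1 s <= h2 s + c) -> forall s, Y1 s <= Y2 s + c / m.
Proof.
move=> m0 p1 p2 d1 d2 hh.
pose D s := Y1 s - Y2 s.
have dD (s : R) : is_derive s 1 D (m * Y1 s - h1 s - (m * Y2 s - h2 s)).
  exact: derB.
have [s smax] : exists s, forall t, D t <= D s.
  apply: periodic_max; first by move=> t; rewrite /D p1 p2.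
  by move=> t; apply: is_derive_continuous (dD t).
have E := derive_at_max ltr01 (dD s) (fun t _ => smax t).
move=> t; rewrite -lerBlDl; apply: le_trans (smax t) _.
by rewrite ler_pdivlMr// /D; have := hh s; move: E; lra.
Qed.

(** Variation of constants; since expR m is not 1, the free constant can be
    chosen so that the solution is periodic. *)
Lemma linear_ode_periodic (m : R) h : 0 < m -> continuous h -> periodic h 1 ->
  exists2 Y, periodic Y 1 & forall s : R, is_derive s 1 Y (m * Y s - h s).
Proof.
move=> m0 ch ph.
have dexp (c s : R) : is_derive s 1 (fun x => expR (c * x)) (c * expR (c * s)).
  apply: dereq (dercomp (is_derive_expR _) (derZ c (derid s))) _.
  by rewrite mulr1 mulrC.
have ceh : continuous (fun s => expR (- m * s) * h s).
  move=> s; apply: cvgM; last exact: ch.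
  exact: is_derive_continuous (dexp (- m) s).
have [H dH] := primitive_exists ceh.
(* the mean value theorem identifies the shifted primitive *)
have Hshift s : H (s + 1) = expR (- m) * H s + (H 1 - expR (- m) * H 0).
  have dS (x : R) : is_derive x 1 (fun y => H (y + 1)) (expR (- m * (x + 1)) * h (x + 1)).
    apply: dereq (dercomp (dH _) (derD (derid x) (dercst 1 x))) _.
    by rewrite addr0 mulr1.
  have dE (x : R) : is_derive x 1 (fun y => expR (- m) * H y) (expR (- m * (x + 1)) * h (x + 1)).
    apply: dereq (derZ _ (dH x)) _.
    by rewrite ph mulrDr mulr1 expRD; ring.
  suff : H (s + 1) - H (0 + 1) = expR (- m) * H s - expR (- m) * H 0.
    by rewrite add0r; lra.
  have [s0|s0] := leP 0 s; first exact: (eq_of_derive s0 (fun x _ => dE x) (fun x _ => dS x)).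
  have := eq_of_derive (ltW s0) (fun x _ => dE x) (fun x _ => dS x); lra.
pose K := H 1 - expR (- m) * H 0.
have em : 1 < expR m by rewrite expR_gt1.
pose C := expR m * K / (expR m - 1).
have CE : C * (expR m - 1) = expR m * K by rewrite /C divfK// subr_eq0 gt_eqF.
exists (fun s => expR (m * s) * (C - H s)).
  move=> s; rewrite Hshift -/K [m * (s + 1)]mulrDr mulr1 expRD.
  have e1 : expR m * expR (- m) = 1 by rewrite -expRD subrr expR0.
  have -> : expR (m * s) * expR m * (C - (expR (- m) * H s + K)) =
    expR (m * s) * (C * expR m - expR m * expR (- m) * H s - expR m * K) by ring.
  by rewrite -CE e1; ring.
move=> s; apply: dereq (derM (dexp m s) (derB (dercst C s) (dH s))) _.
have e1 : expR (m * s) * expR (- m * s) = 1 by rewrite -expRD mulNr subrr expR0.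
rewrite sub0r.
have -> : expR (m * s) * - (expR (- m * s) * h s) = - ((expR (m * s) * expR (- m * s)) * h s) by ring.
by rewrite e1; ring.
Qed.

End PeriodicExtrema.

(** * Wave profiles *)

Section WaveProfile.
Context {R : realType}.
Implicit Types (f g h Y Z : R -> R).

(** V is the time derivative of a pulsating front as a function of its height.
    The equation reads k V V' = V - g, where k measures the diffusion along the
    gradient; the speed of the front is the harmonic average of V, because
    1 / V integrates to the time in which the front advances by one period. *)
Definition wave_profile g (k : R) (V : R -> R) :=
  [/\ periodic V 1, forall s, 0 < V s &
      forall s : R, is_derive s 1 V ((V s - g s) / (k * V s))].

(** In the unknown Y = V^2 / 2 the equation reads Y' = sqrt (2 Y) / k - g / k,
    that is, Y' = m Y - (phi (Y) + g / k) with phi y = m y - sqrt (2 y) / k.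
    For m = 1 / (k a), phi is nondecreasing on the relevant range, so the map
    sending Y to the periodic solution of the linear equation is monotone.  It
    preserves the bounds and a Lipschitz constant; its greatest fixed point is a
    solution, as in the theorem of Knaster and Tarski. *)
Lemma wave_profile_exists g (a b k : R) : 0 < a -> 0 < k ->
  (forall s, a <= g s <= b) -> continuous g -> periodic g 1 ->
  exists V, wave_profile g k V.
Proof.
move=> a0 k0 gab cg pg.
have ab : a <= b by have /andP[] := gab 0; exact: le_trans.
have b0 : 0 < b by exact: lt_le_trans ab.
pose m := (k * a)^-1; have m0 : 0 < m by rewrite invr_gt0 mulr_gt0.
have km : k * m * a = 1 by rewrite mulrAC /m mulfV// gt_eqF// mulr_gt0.
pose lo := a ^+ 2 / 2; pose hi := b ^+ 2 / 2; pose C := m * (hi - lo).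
have lo0 : 0 < lo by rewrite divr_gt0// exprn_gt0.
have lohi : lo <= hi by rewrite ler_pM2r ?invr_gt0// !expr2 ler_pM// ltW.
(* r is the square root of 2 y *)
pose r (y : R) := Num.sqrt (2 * y).
have rsq y : lo <= y -> r y ^+ 2 = 2 * y.
  by move=> loy; rewrite sqr_sqrtr// mulr_ge0// (le_trans _ loy)// ltW.
have ra y : lo <= y -> a <= r y.
  move=> loy; rewrite -[leLHS](ger0_norm (ltW a0)) -sqrtr_sqr; apply: ler_wsqrtr.
  by move: loy; rewrite /lo; lra.
pose phi y := m * y - r y / k.
have phi_mono y1 y2 : lo <= y1 -> y1 <= y2 -> phi y1 <= phi y2.
  move=> lo1 y12; have lo2 := le_trans lo1 y12.
  have := rsq _ lo1; have := rsq _ lo2; have := ra _ lo1; have := ra _ lo2 => r2 r1 E2 E1.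
  have r12 : r y1 <= r y2 by rewrite ler_wsqrtr// ler_pM2l.
  have H : (r y2 - r y1) * (2 * a) <= 2 * (y2 - y1).
    have -> : 2 * (y2 - y1) = (r y2 - r y1) * (r y2 + r y1).
      by rewrite mulrBr -E1 -E2; ring.
    by apply: ler_wpM2l; lra.
  rewrite -(ler_pM2l k0) /phi !mulrBr ![k * (_ / k)]mulrC !divfK ?gt_eqF// !mulrA.
  suff : (r y2 - r y1) <= k * m * (y2 - y1) by lra.
  rewrite -(ler_pM2r a0) mulrAC km; lra.
have philo : phi lo = m * lo - a / k.
  rewrite /phi; congr (_ - _ / _); rewrite /r /lo mulrC divfK ?pnatr_eq0//.
  by rewrite sqrtr_sqr ger0_norm// ltW.
have phihi : phi hi = m * hi - b / k.
  rewrite /phi; congr (_ - _ / _); rewrite /r /hi mulrC divfK ?pnatr_eq0//.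
  by rewrite sqrtr_sqr ger0_norm// ltW.
pose good Y := [/\ periodic Y 1, forall s, lo <= Y s <= hi &
  forall s t, `|Y s - Y t| <= C * `|s - t|].
pose h Y s := phi (Y s) + g s / k.
pose solves Y Z := periodic Z 1 /\ forall s : R, is_derive s 1 Z (m * Z s - h Y s).
have hb Y : good Y -> forall s, m * lo <= h Y s <= m * hi.
  move=> [_ bY _] s; have /andP[l1 l2] := bY s; have /andP[g1 g2] := gab s.
  have P1 := phi_mono _ _ (lexx lo) l1; have P2 := phi_mono _ _ l1 l2.
  have G1 : a / k <= g s / k by rewrite ler_pM2r// invr_gt0.
  have G2 : g s / k <= b / k by rewrite ler_pM2r// invr_gt0.
  by rewrite /h; move: P1 P2 G1 G2; rewrite philo phihi => P1 P2 G1 G2; apply/andP; split; lra.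
have mono Y1 Y2 Z1 Z2 : good Y1 -> (forall s, Y1 s <= Y2 s) ->
    solves Y1 Z1 -> solves Y2 Z2 -> forall s, Z1 s <= Z2 s.
  move=> [_ b1 _] Y12 [p1 d1] [p2 d2] s.
  have -> : Z2 s = Z2 s + 0 / m by rewrite mul0r addr0.
  apply: (linear_ode_compare m0 p1 p2 d1 d2) => t.
  by rewrite addr0 lerD2r phi_mono//; have /andP[] := b1 t.
have goodZ Y Z : good Y -> solves Y Z -> good Z.
  move=> gY [pZ dZ].
  have dcon (c s : R) : is_derive s 1 (fun=> c) (m * c - m * c).
    by rewrite subrr; exact: dercst.
  have Zb s : lo <= Z s <= hi.
    have bnd c1 c2 t : m * c1 <= h Y t -> h Y t <= m * c2 -> m * c1 <= h Y t + 0 /\ h Y t <= m * c2 + 0.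
      by rewrite !addr0.
    apply/andP; split.
      rewrite -[Z s]addr0 -(mul0r m^-1).
      apply: (linear_ode_compare m0 _ pZ (dcon lo) dZ) => // t.
      by rewrite addr0; have /andP[] := hb Y gY t.
    rewrite -[hi]addr0 -(mul0r m^-1).
    apply: (linear_ode_compare m0 pZ _ dZ (dcon hi)) => // t.
    by rewrite addr0; have /andP[] := hb Y gY t.
  split=> // s t.
  wlog st : s t / s <= t.
    move=> H; have [/H//|/ltW/H] := leP s t.
    by rewrite distrC [X in _ <= _ * X]distrC.
  have [c _ E] := mean_value st (fun x _ => dZ x).
  rewrite distrC E normrM [X in _ <= _ * X]distrC ler_wpM2r//.
  have /andP[z1 z2] := Zb c; have /andP[h1 h2] := hb Y gY c.
  have mz1 : m * lo <= m * Z c by rewrite ler_pM2l.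
  have mz2 : m * Z c <= m * hi by rewrite ler_pM2l.
  by rewrite ler_norml /C mulrBr; apply/andP; split; lra.
have C0 : 0 <= C by rewrite mulr_ge0 ?subr_ge0// ltW.
have cgood Y : good Y -> continuous Y.
  move=> [_ _ lY] s; apply/cvgrPdist_le => e e0.
  apply/nbhs_ballP; exists (e / (C + 1)) => /=; first by rewrite divr_gt0// ltr_wpDl.
  move=> t; rewrite /ball/= => st; apply: le_trans (lY s t) _.
  have := ltW st; rewrite ler_pdivlMr ?ltr_wpDl// mulrC => H.
  by apply: le_trans H; rewrite ler_wpM2r// lerDl.
have solvable Y : good Y -> exists Z, solves Y Z.
  move=> gY; have [||Z pZ dZ] := @linear_ode_periodic R m (h Y) m0; last by exists Z.
  - move=> s; rewrite /h /phi /r; apply: cvgD.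
      apply: cvgB; first by apply: cvgM; [exact: cvg_cst|exact: cgood].
      apply: cvgM; last exact: cvg_cst.
      apply: continuous_comp; last exact: sqrt_continuous.
      by apply: cvgM; [exact: cvg_cst|exact: cgood].
    by apply: cvgM; [exact: cg|exact: cvg_cst].
  - by move=> s; rewrite /h pg; have [-> _ _] := gY.
(* the greatest fixed point: the supremum of the functions lying below their image *)
pose S : set (R -> R) := [set Y | good Y /\ exists2 Z, solves Y Z & forall s, Y s <= Z s].
have Slo : S (cst lo).
  have glo : good (cst lo).
    split=> // s; first by rewrite lexx.
    by move=> t; rewrite subrr normr0 mulr_ge0.
  split=> //; have [Z sZ] := solvable _ glo; exists Z => // s.
  by have [_ /(_ s) /andP[]] := goodZ _ _ glo sZ.
pose Y s := sup [set f s | f in S].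
have supS s : has_sup [set f s | f in S].
  split; first by exists lo; exists (cst lo).
  by exists hi => _ [f [[_ bf _] _] <-]; have /andP[] := bf s.
have leY f s : S f -> f s <= Y s.
  by move=> Sf; apply: sup_upper_bound => //; exists f.
have Yle c s : (forall f, S f -> f s <= c) -> Y s <= c.
  move=> H; apply: ge_sup; first by have [] := supS s.
  by move=> _ [f Sf <-]; exact: H.
have gY : good Y.
  have lip s t : Y s - Y t <= C * `|s - t|.
    rewrite lerBlDr; apply: Yle => f Sf; have [[_ _ lf] _] := Sf.
    have := le_trans (ler_norm _) (lf s t); have := leY f t Sf; lra.
  split.
  - by move=> s; apply/eqP; rewrite eq_le; apply/andP; split; apply: Yle => f Sf;
      have [[pf _ _] _] := Sf; [rewrite pf|rewrite -pf]; exact: leY.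
  - move=> s; rewrite (leY (cst lo))//=; apply: Yle => f [[_ bf _] _].
    by have /andP[] := bf s.
  - by move=> s t; rewrite ler_norml lerNl opprB lip andbT distrC lip.
have [Z sZ] := solvable _ gY; have gZ := goodZ _ _ gY sZ.
have YZ s : Y s <= Z s.
  apply: Yle => f Sf; have [gf [Zf sf lef]] := Sf.
  by apply: le_trans (lef s) _; apply: (mono f Y) => // t; exact: leY.
have SZ : S Z.
  split=> //; have [Z' sZ'] := solvable _ gZ; exists Z' => //.
  exact: (mono Y Z).
have ZY s : Y s = Z s by apply/eqP; rewrite eq_le YZ leY.
have [pZ bZ _] := gZ; have [_ dZ] := sZ.
have rZ s : 0 < r (Z s) by apply: lt_le_trans a0 _; apply: ra; have /andP[] := bZ s.
exists (fun s => r (Z s)); split=> // s; first by rewrite pZ.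
have dr : is_derive (2 * Z s) 1 Num.sqrt (2 * r (Z s))^-1.
  by apply: is_derive1_sqrt; rewrite mulr_gt0//; have /andP[/(lt_le_trans lo0)] := bZ s.
have := dercomp (f := fun y => 2 * Z y) (g := Num.sqrt) dr (derZ 2 (dZ s)).
move=> /dereq; apply.
rewrite /h ZY /phi; field.
by rewrite !gt_eqF.
Qed.

End WaveProfile.

(** * Averages and the speed of a profile *)

Section Averages.
Context {R : realType}.
Implicit Types (f g h V W : R -> R).

Lemma unit_avg_lin f h (a b : R) : continuous f -> continuous h ->
  unit_avg (fun s => a * f s + b * h s) = a * unit_avg f + b * unit_avg h.
Proof.
move=> cf ch; have [A dA] := primitive_exists cf; have [B dB] := primitive_exists ch.
rewrite (unit_avg_primitive cf dA) (unit_avg_primitive ch dB).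
have dL (x : R) : is_derive x 1 (fun s => a * A s + b * B s) (a * f x + b * h x).
  by apply: derD; exact: derZ.
rewrite (unit_avg_primitive _ dL); first by ring.
  by move=> s; apply: cvgD; (apply: cvgM; [exact: cvg_cst|]); [exact: cf|exact: ch].
Qed.

Lemma unit_avg_le f h : continuous f -> continuous h ->
  (forall s, f s <= h s) -> unit_avg f <= unit_avg h.
Proof.
move=> cf ch fh; have [A dA] := primitive_exists cf; have [B dB] := primitive_exists ch.
rewrite (unit_avg_primitive cf dA) (unit_avg_primitive ch dB).
exact: increment_le.
Qed.

Lemma unit_avg_cst (a : R) : unit_avg (fun=> a) = a.
Proof.
have dL (x : R) : is_derive x 1 (fun s => a * s) a.
  by apply: dereq (derZ _ (derid x)) _; rewrite mulr1.
rewrite (unit_avg_primitive _ dL); first by ring.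
by move=> s; exact: cvg_cst.
Qed.

Lemma unit_avg_attained f : continuous f ->
  exists2 s, 0 <= s <= 1 & unit_avg f = f s.
Proof.
move=> cf; have [A dA] := primitive_exists cf.
have [s s01 E] := mean_value ler01 (fun x _ => dA x).
by exists s => //; rewrite (unit_avg_primitive cf dA) E; lra.
Qed.

Lemma continuous_inv V : continuous V -> (forall s, 0 < V s) ->
  continuous (fun s => (V s)^-1).
Proof. by move=> cV V0 s; apply: cvgV; [rewrite gt_eqF|exact: cV]. Qed.

(** The harmonic average is a value of V, hence it inherits every bound on V. *)
Lemma harmonic_avg_attained V : continuous V -> (forall s, 0 < V s) ->
  exists2 s, 0 <= s <= 1 & harmonic_avg V = V s.
Proof.
move=> cV V0; have [s s01 E] := unit_avg_attained (continuous_inv cV V0).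
by exists s => //; rewrite /harmonic_avg E invrK.
Qed.

Lemma harmonic_avg_gt0 V : continuous V -> (forall s, 0 < V s) -> 0 < harmonic_avg V.
Proof. by move=> cV V0; have [s _ ->] := harmonic_avg_attained cV V0. Qed.

Lemma harmonic_avg_mono V W : continuous V -> continuous W ->
  (forall s, 0 < V s) -> (forall s, 0 < W s) ->
  unit_avg (fun s => (W s)^-1) <= unit_avg (fun s => (V s)^-1) ->
  harmonic_avg V <= harmonic_avg W.
Proof.
move=> cV cW V0 W0 H.
have := harmonic_avg_gt0 cV V0; have := harmonic_avg_gt0 cW W0.
by rewrite !invr_gt0 => hW hV; rewrite lef_pV2.
Qed.

Lemma harmonic_avg_close V W (a b e : R) : 0 < a ->
  continuous V -> continuous W ->
  (forall s, a <= V s <= b) -> (forall s, a <= W s <= b) ->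
  (forall s, `|V s - W s| <= e) ->
  `|harmonic_avg V - harmonic_avg W| <= b ^+ 2 / a ^+ 2 * e.
Proof.
move=> a0 cV cW bV bW VW.
have V0 s : 0 < V s by have /andP[/(lt_le_trans a0)] := bV s.
have W0 s : 0 < W s by have /andP[/(lt_le_trans a0)] := bW s.
have e0 : 0 <= e by exact: le_trans (normr_ge0 _) (VW 0).
have ciV := continuous_inv cV V0; have ciW := continuous_inv cW W0.
have [s1 _ E1] := harmonic_avg_attained cV V0.
have [s2 _ E2] := harmonic_avg_attained cW W0.
have [s _ E3] : exists2 s, 0 <= s <= 1 &
    unit_avg (fun s => 1 * (W s)^-1 + (-1) * (V s)^-1) = 1 * (W s)^-1 + (-1) * (V s)^-1.
  apply: unit_avg_attained => s; apply: cvgD; apply: cvgM; by [exact: cvg_cst|exact: ciV|exact: ciW].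
move: E3; rewrite unit_avg_lin// => E3.
have hV : unit_avg (fun s => (V s)^-1) = (V s1)^-1 by rewrite -E1 invrK.
have hW : unit_avg (fun s => (W s)^-1) = (W s2)^-1 by rewrite -E2 invrK.
rewrite E1 E2.
have -> : V s1 - W s2 = V s1 * W s2 * ((V s - W s) / (V s * W s)).
  have -> : (V s - W s) / (V s * W s) = 1 * (W s)^-1 + (-1) * (V s)^-1.
    by field; rewrite !gt_eqF.
  by rewrite -E3 hV hW; field; rewrite !gt_eqF.
have /andP[v1 v2] := bV s1; have /andP[w1 w2] := bW s2.
have /andP[v3 v4] := bV s; have /andP[w3 w4] := bW s.
rewrite !normrM normfV !normrM !(gtr0_norm (V0 _)) !(gtr0_norm (W0 _)).
have H1 : V s1 * W s2 <= b ^+ 2 by rewrite expr2 ler_pM// ltW.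
have H2 : (V s * W s)^-1 <= (a ^+ 2)^-1.
  by rewrite lef_pV2 ?posrE ?exprn_gt0 ?mulr_gt0// expr2 ler_pM// ltW.
have H3 : `|V s - W s| / (V s * W s) <= e / a ^+ 2.
  by rewrite ler_pM// invr_ge0 mulr_ge0// ltW.
have -> : b ^+ 2 / a ^+ 2 * e = b ^+ 2 * (e / a ^+ 2) by ring.
by rewrite ler_pM// ?mulr_ge0// ?invr_ge0 ?mulr_ge0// ltW.
Qed.

End Averages.

Section ProfileBounds.
Context {R : realType}.
Implicit Types (f g h V W : R -> R).

Lemma profile_continuous g k V : wave_profile g k V -> continuous V.
Proof. by move=> [_ _ dV] s; exact: is_derive_continuous (dV s). Qed.

(** At the extrema of V the derivative vanishes, so that V = g there. *)
Lemma profile_bounds g (k a b : R) V : 0 < k -> (forall s, a <= g s <= b) ->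
  wave_profile g k V -> forall s, a <= V s <= b.
Proof.
move=> k0 gab wV; have cV := profile_continuous wV; have [pV V0 dV] := wV.
have crit s : (V s - g s) / (k * V s) = 0 -> V s = g s.
  move/eqP; rewrite mulf_eq0 invr_eq0 mulf_eq0 (gt_eqF k0) (gt_eqF (V0 s)) !orbF.
  by rewrite subr_eq0 => /eqP.
have [s smax] := periodic_max pV cV.
have [s' smin] : exists s, forall t, - V t <= - V s.
  by apply: periodic_max; [move=> t; rewrite pV|move=> t; apply: cvgN; exact: cV].
have E1 := crit _ (derive_at_max ltr01 (dV s) (fun t _ => smax t)).
have E2 : V s' = g s'.
  by apply/crit/(derive_at_min ltr01 (dV s')) => t _; rewrite -lerN2.
move=> t; have := smax t; have := smin t; rewrite lerN2 E1 E2 => h1 h2.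
have /andP[_ g1] := gab s; have /andP[g2 _] := gab s'.
by rewrite (le_trans g2)// (le_trans h2).
Qed.

Lemma derive_lower f (s d c r : R) : 0 < r -> is_derive s 1 f d ->
  (forall t, 0 < t < r -> f (s + t) - f s <= c * t) -> d <= c.
Proof.
move=> r0 df H; apply/ler_addgt0Pr => e e0.
have [r' r'0 H'] := is_derive_eps df e0.
pose t := Num.min r r' / 2.
have t0 : 0 < t by rewrite divr_gt0// lt_min r0 r'0.
have tr : t < r by rewrite ltr_pdivrMr// gt_min; apply/orP; left; lra.
have tr' : t < r' by rewrite ltr_pdivrMr// gt_min; apply/orP; right; lra.
have nt : `|t| = t by rewrite gtr0_norm.
have t0r : 0 < t < r by rewrite t0.
have := H t t0r; have := H' t; rewrite nt => /(_ tr').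
rewrite ler_norml => /andP[h1 h2] h3.
by rewrite -(ler_pM2r t0); lra.
Qed.

(** At a maximum of V - g the slope of V is at most l, and the equation
    turns this into V - g <= k l V. *)
Lemma profile_close g (k a b l : R) V : 0 < k -> 0 < a -> (forall s, a <= g s <= b) ->
  (forall s t, `|g s - g t| <= l * `|s - t|) -> periodic g 1 -> continuous g ->
  wave_profile g k V -> forall s, `|V s - g s| <= k * l * b.
Proof.
move=> k0 a0 gab gl pg cg wV; have cV := profile_continuous wV; have [pV V0 dV] := wV.
have Vb := profile_bounds k0 gab wV.
have l0 : 0 <= l by have := gl 0 1; rewrite sub0r normrN normr1 mulr1; apply: le_trans.
have [s smax] : exists s, forall t, V t - g t <= V s - g s.
  by apply: periodic_max; [move=> t; rewrite pV pg|move=> t; apply: cvgB; [exact: cV|exact: cg]].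
have [s' smin] : exists s, forall t, - (V t - g t) <= - (V s - g s).
  apply: periodic_max; first by move=> t; rewrite pV pg.
  by move=> t; apply: cvgN; apply: cvgB; [exact: cV|exact: cg].
have d1 : (V s - g s) / (k * V s) <= l.
  apply: (derive_lower ltr01 (dV s)) => t /andP[t0 _].
  have := smax (s + t); have := gl (s + t) s.
  rewrite addrAC subrr add0r (gtr0_norm t0) ler_norml => /andP[_ H1] H2; lra.
have d2 : - ((V s' - g s') / (k * V s')) <= l.
  apply: (derive_lower ltr01 (is_deriveN (dV s'))) => t /andP[t0 _] /=.
  have := smin (s' + t); have := gl (s' + t) s'.
  rewrite addrAC subrr add0r (gtr0_norm t0) ler_norml fctE => /andP[H1 _] H2; lra.
have kl (x : R) : k * V x * l <= k * l * b.
  have /andP[_ Vxb] := Vb x.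
  by rewrite mulrAC ler_wpM2l// mulr_ge0// ltW.
move=> t; rewrite ler_norml; apply/andP; split.
  move: d2; rewrite -mulNr ler_pdivrMr ?mulr_gt0// => H.
  have := smin t; have := kl s'; rewrite [l * _]mulrC in H; lra.
move: d1; rewrite ler_pdivrMr ?mulr_gt0// => H.
have := smax t; have := kl s; rewrite [l * _]mulrC in H; lra.
Qed.

(** At an extremum of V - W both slopes agree, and the two equations can be
    solved for V - W.  The bound is used with k1 / k2 close to 1. *)
Lemma profile_compare g (k1 k2 a b : R) V W : 0 < k1 -> 0 < k2 -> 0 < a ->
  (forall s, a <= g s <= b) ->
  wave_profile g k1 V -> wave_profile g k2 W ->
  forall s, `|V s - W s| <= b ^+ 2 / a * `|k1 / k2 - 1|.
Proof.
move=> k10 k20 a0 gab wV wW.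
have cV := profile_continuous wV; have [pV V0 dV] := wV.
have cW := profile_continuous wW; have [pW W0 dW] := wW.
have Vb := profile_bounds k10 gab wV; have Wb := profile_bounds k20 gab wW.
have crit s : (V s - g s) / (k1 * V s) - (W s - g s) / (k2 * W s) = 0 ->
    `|V s - W s| <= b ^+ 2 / a * `|k1 / k2 - 1|.
  move=> E; have /andP[g1 g2] := gab s; have g0 : 0 < g s by exact: lt_le_trans g1.
  have -> : V s - W s = V s * (W s - g s) / g s * (k1 / k2 - 1).
    have -> : V s * (W s - g s) / g s * (k1 / k2 - 1) = V s - W s
      - k1 * V s * W s / g s * ((V s - g s) / (k1 * V s) - (W s - g s) / (k2 * W s)).
      by field; rewrite !gt_eqF.
    by rewrite E; ring.
  rewrite normrM ler_wpM2r// !normrM normfV (gtr0_norm g0) (gtr0_norm (V0 s)).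
  have /andP[v1 v2] := Vb s; have /andP[w1 w2] := Wb s.
  have ab : 0 <= a <= b by rewrite ltW//= (le_trans g1).
  have H1 : `|W s - g s| <= b by rewrite ler_norml; lra.
  have H2 : V s * `|W s - g s| <= b ^+ 2 by rewrite expr2 ler_pM// ltW.
  have H3 : (g s)^-1 <= a^-1 by rewrite lef_pV2.
  by rewrite ler_pM// ?mulr_ge0// ?invr_ge0 ltW.
pose D s := V s - W s.
have dD (s : R) : is_derive s 1 D ((V s - g s) / (k1 * V s) - (W s - g s) / (k2 * W s)).
  exact: derB.
have cD : continuous D by move=> s; exact: is_derive_continuous (dD s).
have pD : periodic D 1 by move=> s; rewrite /D pV pW.
have [s smax] := periodic_max pD cD.
have [s' smin] : exists s, forall t, - D t <= - D s.
  by apply: periodic_max; [move=> t; rewrite pD|move=> t; apply: cvgN; exact: cD].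
have H1 := crit _ (derive_at_max ltr01 (dD s) (fun t _ => smax t)).
have H2 : `|V s' - W s'| <= b ^+ 2 / a * `|k1 / k2 - 1|.
  by apply/crit/(derive_at_min ltr01 (dD s')) => t _; rewrite -lerN2.
move=> t; move: H1 H2; rewrite !ler_norml => /andP[_ H1] /andP[H2 _].
by have := smax t; have := smin t; rewrite /D; lra.
Qed.

(** The difference V - g is the derivative of k V^2 / 2. *)
Lemma unit_avg_profile g k V : 0 < k -> continuous g -> wave_profile g k V ->
  unit_avg V = unit_avg g.
Proof.
move=> k0 cg wV; have cV := profile_continuous wV; have [pV V0 dV] := wV.
have : unit_avg (fun s => 1 * V s + (-1) * g s) = 0.
  have dL (s : R) : is_derive s 1 (fun s => k / 2 * (V s * V s)) (1 * V s + (-1) * g s).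
    apply: dereq (derZ _ (derM (dV s) (dV s))) _.
    by field; rewrite !gt_eqF.
  rewrite (unit_avg_primitive _ dL).
    by have -> : V 1 = V 0 by [rewrite -[X in V X]add0r pV]; rewrite subrr.
  by move=> s; apply: cvgD; apply: cvgM; by [exact: cvg_cst|exact: cV|exact: cg].
by rewrite unit_avg_lin//; lra.
Qed.

(** Averages of V and g agree, and 1 / V lies above the tangent to the
    hyperbola at the average. *)
Lemma profile_speed_le g k V : 0 < k -> continuous g -> (forall s, 0 < g s) ->
  wave_profile g k V -> harmonic_avg V <= unit_avg g.
Proof.
move=> k0 cg g0 wV; have cV := profile_continuous wV; have [pV V0 dV] := wV.
have E := unit_avg_profile k0 cg wV.
have [s0 _ Eg] := unit_avg_attained cg.
set m := unit_avg g in E Eg *; have m0 : 0 < m by rewrite Eg.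
have ciV := continuous_inv cV V0.
have H : m^-1 <= unit_avg (fun s => (V s)^-1).
  have -> : m^-1 = unit_avg (fun s => (2 / m) * 1 + (- m ^- 2) * V s).
    rewrite (@unit_avg_lin _ (fun=> 1)) ?E ?unit_avg_cst//; last by move=> s; exact: cvg_cst.
    by field; rewrite gt_eqF.
  apply: unit_avg_le => //.
    by move=> s; apply: cvgD; apply: cvgM; by [exact: cvg_cst|exact: cV].
  move=> s; rewrite -subr_ge0.
  have -> : (V s)^-1 - (2 / m * 1 + - m ^- 2 * V s) = (V s - m) ^+ 2 / (V s * m ^+ 2).
    by field; rewrite !gt_eqF.
  by rewrite divr_ge0 ?sqr_ge0// ltW// mulr_gt0 ?exprn_gt0.
rewrite -[leRHS]invrK lef_pV2 ?posrE ?invr_gt0//.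
by apply: lt_le_trans H; rewrite invr_gt0.
Qed.

(** Up to the derivative of k ln V, 1 / V is at most 1 / g pointwise: the
    difference is (V - g)^2 / (g V^2). *)
Lemma profile_speed_ge g k V : 0 < k -> continuous g -> (forall s, 0 < g s) ->
  wave_profile g k V -> harmonic_avg g <= harmonic_avg V.
Proof.
move=> k0 cg g0 wV; have cV := profile_continuous wV; have [pV V0 dV] := wV.
have ciV := continuous_inv cV V0; have cig := continuous_inv cg g0.
apply: harmonic_avg_mono => //.
pose w s := (V s - g s) / (V s) ^+ 2.
have cw : continuous w.
  move=> s; apply: cvgM; first by apply: cvgB; [exact: cV|exact: cg].
  by apply: cvgV; [rewrite gt_eqF ?exprn_gt0|apply: cvgM; exact: cV].
have w0 : unit_avg w = 0.
  have dL (s : R) : is_derive s 1 (fun s => k * ln (V s)) (w s).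
    apply: dereq (derZ k (dercomp (is_derive1_ln (V0 s)) (dV s))) _.
    by rewrite /w; field; rewrite !gt_eqF.
  rewrite (unit_avg_primitive cw dL).
  by have -> : V 1 = V 0 by [rewrite -[X in V X]add0r pV]; rewrite subrr.
have -> : unit_avg (fun s => (V s)^-1) = unit_avg (fun s => 1 * (V s)^-1 + 1 * w s).
  by rewrite unit_avg_lin// w0; ring.
apply: unit_avg_le => //.
  by move=> s; apply: cvgD; apply: cvgM; by [exact: cvg_cst|exact: ciV|exact: cw].
move=> s; rewrite -subr_ge0.
have -> : (g s)^-1 - (1 * (V s)^-1 + 1 * w s) = (V s - g s) ^+ 2 / (g s * V s ^+ 2).
  by rewrite /w; field; rewrite !gt_eqF.
by rewrite divr_ge0 ?sqr_ge0// ltW// mulr_gt0 ?exprn_gt0.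
Qed.

(** For large k the profile has slope of order 1 / k, so its mean and its
    harmonic mean, both attained on a unit interval, are close. *)
Lemma profile_speed_large g (k a b : R) V : 0 < k -> 0 < a -> continuous g ->
  (forall s, a <= g s <= b) -> wave_profile g k V ->
  unit_avg g - (b - a) / (a * k) <= harmonic_avg V.
Proof.
move=> k0 a0 cg gab wV; have cV := profile_continuous wV; have [pV V0 dV] := wV.
have Vb := profile_bounds k0 gab wV.
have [s1 s101 E1] := unit_avg_attained cV; rewrite -(unit_avg_profile k0 cg wV) E1.
have [s2 s201 E2] := harmonic_avg_attained cV V0; rewrite E2.
have slope s : `|(V s - g s) / (k * V s)| <= (b - a) / (a * k).
  have /andP[v1 v2] := Vb s; have /andP[g1 g2] := gab s.
  have H1 : `|V s - g s| <= b - a by rewrite ler_norml; lra.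
  have H2 : (k * V s)^-1 <= (a * k)^-1.
    by rewrite lef_pV2 ?posrE ?mulr_gt0// mulrC ler_pM2l.
  rewrite normrM normfV (gtr0_norm (mulr_gt0 k0 (V0 s))) ler_pM//.
  by rewrite invr_ge0 mulr_ge0// ltW.
have lip x y : x <= y -> y - x <= 1 -> `|V y - V x| <= (b - a) / (a * k).
  move=> xy yx1; have [c _ ->] := mean_value xy (fun x _ => dV x).
  rewrite normrM [X in _ * X]ger0_norm ?subr_ge0//.
  by apply: le_trans (slope c); rewrite ler_piMr.
have [s12|/ltW s21] := leP s1 s2.
  have := lip _ _ s12; rewrite ler_norml => H.
  by have /andP[h1 h2] := H ltac:(lra); lra.
have := lip _ _ s21; rewrite ler_norml => H.
by have /andP[h1 h2] := H ltac:(lra); lra.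
Qed.

End ProfileBounds.

(** * Boxes and touching from above *)

Section SpaceTimeTools.
Context {R : realType} {n : nat}.
Implicit Types (x y : 'rV[R]_n) (z : 'rV[R]_n * R) (f : 'rV[R]_n * R -> R).

Definition sqn x : R := \sum_i x 0 i ^+ 2.

Lemma sqn_ge0 x : 0 <= sqn x.
Proof. by apply: sumr_ge0 => i _; rewrite sqr_ge0. Qed.

Lemma enorm_ge0 x : 0 <= enorm x.
Proof. exact: sqrtr_ge0. Qed.

Lemma enorm_sq x : enorm x ^+ 2 = sqn x.
Proof. by rewrite sqr_sqrtr// sqn_ge0. Qed.

Lemma coord_sq_le x i : x 0 i ^+ 2 <= sqn x.
Proof.
rewrite /sqn (bigD1 i)//= lerDl.
by apply: sumr_ge0 => j _; rewrite sqr_ge0.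
Qed.

Lemma coord_le_enorm x i : `|x 0 i| <= enorm x.
Proof. by rewrite -sqrtr_sqr; apply: ler_wsqrtr; exact: coord_sq_le. Qed.

Lemma sqn0 : sqn 0 = 0.
Proof. by rewrite /sqn big1// => i _; rewrite mxE expr0n. Qed.

Lemma sqn_shift x (s : R) i :
  sqn (x + s *: delta_mx 0 i) = sqn x + 2 * x 0 i * s + s ^+ 2.
Proof.
rewrite /sqn (bigD1 i)//= [in RHS](bigD1 i)//= !mxE !eqxx mulr1.
have -> : \sum_(j < n | j != i) (x + s *: delta_mx 0 i) 0 j ^+ 2 =
          \sum_(j < n | j != i) x 0 j ^+ 2.
  by apply: eq_bigr => j ji; rewrite !mxE eqxx (negbTE ji) mulr0 addr0.
ring.
Qed.

Lemma cvg_sum (T : Type) (F : set_system T) (FF : Filter F) (I : Type) (r : seq I)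
    (h : I -> T -> R) (l : I -> R) :
  (forall i, h i t @[t --> F] --> l i) ->
  (\sum_(i <- r) h i t) @[t --> F] --> \sum_(i <- r) l i.
Proof. by move=> H; apply: cvg_big => //; exact: add_continuous. Qed.

Lemma coord_fst_continuous i : continuous (fun z : 'rV[R]_n * R => z.1 0 i).
Proof.
by move=> z; apply: (@cvg_comp _ _ _ fst (fun x : 'rV[R]_n => x 0 i));
  [exact: cvg_fst|exact: coord_continuous].
Qed.

Lemma sqn_continuous x0 : continuous (fun z : 'rV[R]_n * R => sqn (z.1 - x0)).
Proof.
move=> z; apply: cvg_sum => i.
have H : (w.1 - x0) 0 i @[w --> z] --> (z.1 - x0) 0 i.
  have -> : (fun w : 'rV[R]_n * R => (w.1 - x0) 0 i) = (fun w => w.1 0 i - x0 0 i).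
    by apply/funext => w; rewrite !mxE.
  by rewrite !mxE; apply: cvgB; [exact: coord_fst_continuous|exact: cvg_cst].
by apply: cvgM.
Qed.

Definition box x0 (r a b : R) : set ('rV[R]_n * R) :=
  [set z : 'rV[R]_n * R | (forall i, `|z.1 0 i - x0 0 i| <= r) /\ a <= z.2 <= b].

Lemma box_compact x0 (r a b : R) : compact (box x0 r a b).
Proof.
have -> : box x0 r a b =
    [set v : 'rV[R]_n | forall i, [set` `[x0 0 i - r, x0 0 i + r]] (v ord0 i)] `*` [set` `[a, b]].
  apply/seteqP; split => -[x t] /= [H1 H2]; split; rewrite ?in_itv//=.
    by move=> i; have := H1 i; rewrite in_itv/= ler_distl.
  by move=> i; have := H1 i; rewrite /= in_itv/= ler_distl.
apply: compact_setX; last exact: segment_compact.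
by apply: (@rV_compact R n (fun i => [set` `[x0 0 i - r, x0 0 i + r]])) => i; exact: segment_compact.
Qed.

Lemma line_derive (V : normedModType R) (f : V -> R) (z v : V) (s : R) :
  derivable f (z + s *: v) v ->
  is_derive s 1 (fun r : R => f (z + r *: v)) ('D_v f (z + s *: v)).
Proof.
move=> df.
have E : (fun h : R => h^-1 *: (((fun r : R => f (z + r *: v)) \o shift s) (h *: (1 : R)) - f (z + s *: v))) =
         (fun h : R => h^-1 *: ((f \o shift (z + s *: v)) (h *: v) - f (z + s *: v))).
  apply/funext => h; rewrite /shift /=; congr (_ *: (f _ - _)).
  by rewrite [h *: 1]mulr1 scalerDl addrCA.
by split; [rewrite /derivable E|rewrite /derive E].
Qed.

(** First and second order conditions at a contact point along a line.  The second
    derivative is assumed to exist at z only, so the second order condition comes from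
    comparing two increments by means of the mean value theorem. *)
Lemma touch_above (V : normedModType R) (f : V -> R) (z v : V) (a b C r : R) :
  0 < r -> (forall s : R, `|s| < r -> derivable f (z + s *: v) v) ->
  derivable ('D_v f) z v ->
  (forall s : R, `|s| < r -> f (z + s *: v) <= f z + a * s + b * s ^+ 2 + C * `|s| ^+ 3) ->
  'D_v f z = a /\ 'D_v ('D_v f) z <= 2 * b.
Proof.
move=> r0 d1 d2 H.
(* the cubic term is absorbed in a small increase of b *)
suff main (b' : R) : b < b' -> 'D_v f z = a /\ 'D_v ('D_v f) z <= 2 * b'.
  have [|E _] := main (b + 1); first by rewrite ltrDl.
  split => //; apply/ler_addgt0Pr => e e0.
  by have [|_] := main (b + e / 2); [lra|lra].
move=> bb'; pose F s := f (z + s *: v); pose F' s := 'D_v f (z + s *: v).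
have zE : z + 0 *: v = z by rewrite scale0r addr0.
have dF (s : R) : `|s| < r -> is_derive s 1 F (F' s) by move=> sr; exact: line_derive (d1 s sr).
have dF' : is_derive (0 : R) 1 F' ('D_v ('D_v f) z).
  by have := @line_derive V ('D_v f) z v 0; rewrite zE => /(_ d2).
pose r1 := Num.min r ((b' - b) / (`|C| + 1)).
have C1 : 0 < `|C| + 1 by rewrite ltr_wpDl.
have r10 : 0 < r1 by rewrite lt_min r0 divr_gt0// subr_gt0.
have r1r (s : R) : `|s| < r1 -> `|s| < r by rewrite lt_min => /andP[].
have H' (s : R) : `|s| < r1 -> F s <= F 0 + a * s + b' * s ^+ 2.
  move=> sr; have Hs := H s (r1r _ sr); rewrite /F zE; apply: (le_trans Hs).
  rewrite -!addrA !lerD2l -lerBrDl -mulrBl.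
  have -> : `|s| ^+ 3 = `|s| * s ^+ 2 by rewrite exprS real_normK ?num_real.
  rewrite mulrA ler_wpM2r ?sqr_ge0//.
  move: sr; rewrite lt_min => /andP[_]; rewrite ltr_pdivlMr// => sr.
  apply: le_trans (ltW sr); rewrite [leRHS]mulrC ler_wpM2r//.
  by apply: le_trans (ler_norm _) _; rewrite lerDl.
have Fa : F' 0 = a.
  pose G s := F s - (a * s + b' * (s * s)).
  have dG : is_derive (0 : R) 1 G (F' 0 - a).
    have d0 := dF 0; rewrite normr0 in d0.
    apply: dereq (derB (d0 r0) (derD (derZ a (derid 0)) (derZ b' (derM (derid 0) (derid 0))))) _.
    by ring.
  apply/eqP; rewrite -subr_eq0; apply/eqP/(derive_at_max r10 dG) => t; rewrite subr0 => tr.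
  by have := H' t tr; rewrite /G; lra.
split; first by rewrite -Fa /F' zE.
rewrite leNgt; apply/negP => lt2.
pose e := ('D_v ('D_v f) z - 2 * b') / 2; have e0 : 0 < e by rewrite divr_gt0// subr_gt0.
have [r2 r20 H2] := is_derive_eps dF' e0.
pose s0 := Num.min r1 r2 / 2.
have s00 : 0 < s0 by rewrite divr_gt0// lt_min r10.
have s0r1 : s0 < r1 by rewrite ltr_pdivrMr// gt_min; apply/orP; left; lra.
have s0r2 : s0 < r2 by rewrite ltr_pdivrMr// gt_min; apply/orP; right; lra.
pose K s := F s - (a * s + b' * (s * s)).
have dK (s : R) : 0 <= s <= s0 -> is_derive s 1 K (F' s - a - 2 * b' * s).
  move=> /andP[s1 s2]; have sr : `|s| < r by apply: r1r; rewrite ger0_norm// (le_lt_trans s2).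
  apply: dereq (derB (dF s sr) (derD (derZ a (derid s)) (derZ b' (derM (derid s) (derid s))))) _.
  by ring.
have K' (s : R) : 0 <= s <= s0 -> e * s <= F' s - a - 2 * b' * s.
  move=> /andP[s1 s2]; have := H2 s; rewrite ger0_norm// add0r Fa.
  move=> /(_ (le_lt_trans s2 s0r2)); rewrite ler_norml => /andP[h _].
  have E2 : 'D_v ('D_v f) z = 2 * e + 2 * b' by rewrite /e; lra.
  by rewrite E2 in h; lra.
have h2 : 0 <= s0 / 2 by lra.
have h2' : s0 / 2 <= s0 by lra.
have [c1 /andP[c10 c11] E1] := mean_value h2 (df := fun s => F' s - a - 2 * b' * s) (f := K)
  ltac:(by move=> x /andP[x0 x1]; apply: dK; rewrite x0/= (le_trans x1)).
have [c2 /andP[c20 c21] E2] := mean_value h2' (df := fun s => F' s - a - 2 * b' * s) (f := K)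
  ltac:(by move=> x /andP[x0 x1]; apply: dK; rewrite x1 andbT (le_trans _ x0)).
have k1 : 0 <= K (s0 / 2) - K 0.
  rewrite E1 mulr_ge0//; last lra.
  apply: le_trans (K' c1 _); first by rewrite mulr_ge0// ltW.
  by rewrite c10 (le_trans c11).
have k2 : 0 < K s0 - K (s0 / 2).
  rewrite E2 mulr_gt0//; last lra.
  apply: lt_le_trans (K' c2 _); first by rewrite mulr_gt0//; lra.
  by rewrite c21 andbT; lra.
have := H' s0; rewrite gtr0_norm// => /(_ s0r1).
by move: k1 k2; rewrite /K; lra.
Qed.

End SpaceTimeTools.

(** * Comparison principle on the half-space *)

Section Comparison.
Context {R : realType} {n : nat}.
Implicit Types (x y : 'rV[R]_n) (z : 'rV[R]_n * R) (d f : 'rV[R]_n * R -> R).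

Definition twice_derivable f := forall z : 'rV[R]_n * R, open_half z ->
  derivable f z tdir /\
  forall i, derivable f z (xdir i) /\ derivable ('D_(xdir i) f) z (xdir i).

Lemma xdir_shift z (s : R) i : z + s *: xdir i = (z.1 + s *: delta_mx 0 i, z.2).
Proof. by case: z => x t; rewrite /xdir; congr pair; rewrite /= ?scaler0 ?addr0. Qed.

Lemma tdir_shift z (s : R) : z + s *: tdir = (z.1, z.2 + s).
Proof. by case: z => x t; rewrite /tdir; congr pair; rewrite /= ?scaler0 ?addr0 // [s *: 1]mulr1. Qed.

Lemma open_half_xdir z (s : R) i : open_half z -> open_half (z + s *: xdir i).
Proof. by rewrite xdir_shift. Qed.

Lemma box_closed_half x0 (r a b : R) : 0 <= a -> box x0 r a b `<=` closed_half.
Proof. by move=> a0 z [_ /andP[/(le_trans a0)]]. Qed.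

Lemma box_shift x0 z (r a b s : R) i : box x0 r a b z ->
  `|z.1 0 i - x0 0 i| < r -> `|s| < r - `|z.1 0 i - x0 0 i| ->
  box x0 r a b (z + s *: xdir i).
Proof.
move=> [H1 H2] zi sr; rewrite xdir_shift; split => //= j.
rewrite !mxE eqxx /=; have [->|ji] := eqVneq j i; last by rewrite mulr0 addr0.
rewrite mulr1 addrAC; apply: le_trans (ler_normD _ _) _; lra.
Qed.

(** For m > l + 2 n D and eta > 0, the function
    exp (- m t) d - eta (1 + |x|^2) tends to minus infinity at infinity by the
    linear growth; at a positive maximum the differential inequality fails. *)
Lemma parabolic_comparison (D l : R) d : 0 <= D -> 0 <= l ->
  {within closed_half, continuous d} -> (forall x, d (x, 0) <= 0) ->
  twice_derivable d ->
  (forall z, open_half z -> 0 < d z ->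
    dt d z - D * (\sum_i 'D_(xdir i) ('D_(xdir i) d) z) <= l * d z) ->
  (forall T : R, exists C : R, forall x (t : R), 0 <= t <= T -> d (x, t) <= C * (1 + enorm x)) ->
  forall x (t : R), 0 <= t -> d (x, t) <= 0.
Proof.
move=> D0 l0 cd d0 rd pde growth x0 t0 t00; rewrite leNgt; apply/negP => dpos.
pose m := l + 2 * n%:R * D + 1.
have nD : 0 <= 2 * n%:R * D by rewrite !mulr_ge0.
pose e z := expR (- m * z.2) * d z.
have e0pos : 0 < e (x0, t0) by rewrite mulr_gt0 ?expR_gt0.
have s0pos : 0 < 1 + sqn x0 by rewrite ltr_pwDl// sqn_ge0.
pose eta := e (x0, t0) / (2 * (1 + sqn x0)).
have eta0 : 0 < eta by rewrite divr_gt0// mulr_gt0.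
have etaE : eta * (1 + sqn x0) = e (x0, t0) / 2 by rewrite /eta; field; rewrite gt_eqF.
clearbody eta.
pose Q (z : 'rV[R]_n * R) := e z - eta * (1 + sqn (z.1 - 0)).
have [C0 HC0] := growth t0.
pose C := `|C0|; have C_ge0 : 0 <= C by exact: normr_ge0.
have HC x (t : R) : 0 <= t <= t0 -> d (x, t) <= C * (1 + enorm x).
  move=> /(HC0 x) H; apply: le_trans H _; rewrite ler_wpM2r ?ler_norm// addr_ge0 ?enorm_ge0//.
pose rho := 1 + 2 * C / eta + enorm x0.
have Ce : 0 <= 2 * C / eta by apply: divr_ge0; [exact: mulr_ge0|exact: ltW].
have rho1 : 1 <= rho by rewrite /rho; have := enorm_ge0 x0; lra.
have far x (t : R) : 0 <= t <= t0 -> rho <= enorm x -> Q (x, t) <= 0.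
  move=> tt0 xr; have /andP[t_ge0 _] := tt0.
  have x1 : 1 <= enorm x by exact: le_trans xr.
  have xC : 2 * C <= eta * enorm x.
    have : 2 * C / eta <= enorm x.
      by apply: le_trans xr; rewrite /rho; have := enorm_ge0 x0; lra.
    by rewrite ler_pdivrMr// [_ * eta]mulrC.
  rewrite /Q /e /= subr0 subr_le0 -enorm_sq.
  have [dneg|dp] := leP (d (x, t)) 0.
    apply: (@le_trans _ _ 0); first by rewrite mulr_ge0_le0// ltW// expR_gt0.
    by rewrite mulr_ge0 ?addr_ge0 ?sqr_ge0// ltW.
  apply: (@le_trans _ _ (d (x, t))).
    apply: ler_piMl; first exact: ltW.
    rewrite -expR0 ler_expR mulNr oppr_le0; apply: mulr_ge0 => //.
    by rewrite /m !addr_ge0.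
  apply: le_trans (HC x t tt0) _.
  have : C * enorm x <= eta * enorm x * enorm x / 2 by have := ler_wpM2r (enorm_ge0 x) xC; lra.
  have : 2 * C * 1 <= eta * enorm x * enorm x by apply: ler_pM => //; exact: mulr_ge0.
  by rewrite expr2; lra.
have cQ : {within box 0 rho 0 t0, continuous Q}.
  have sub : box 0 rho 0 t0 `<=` closed_half := @box_closed_half 0 rho 0 t0 (lexx 0).
  have cd' := continuous_subspaceW sub cd.
  have ce : {within box 0 rho 0 t0, continuous (fun z : 'rV[R]_n * R => expR (- m * z.2))}.
    apply: continuous_subspaceT => z; apply: continuous_comp; last exact: continuous_expR.
    by apply: cvgM; [exact: cvg_cst|exact: cvg_snd].
  have cs : {within box 0 rho 0 t0, continuous (fun z : 'rV[R]_n * R => eta * (1 + sqn (z.1 - 0)))}.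
    apply: continuous_subspaceT => z; apply: cvgM; first exact: cvg_cst.
    by apply: cvgD; [exact: cvg_cst|exact: sqn_continuous].
  by move=> z; apply: cvgB; [apply: cvgM; [exact: ce|exact: cd']|exact: cs].
have in0 : box 0 rho 0 t0 (x0, t0).
  split => /=; last by rewrite t00 lexx.
  move=> i; rewrite mxE subr0; apply: le_trans (coord_le_enorm _ _) _.
  by rewrite /rho; lra.
have ne : box (0 : 'rV[R]_n) rho 0 t0 !=set0 by exists (x0, t0).
have [[x1 t1] z1K zmax] := compact_EVT_max ne (@box_compact R n 0 rho 0 t0) cQ.
move: z1K; rewrite inE => z1K.
have Qpos : 0 < Q (x1, t1).
  apply: lt_le_trans (zmax (x0, t0) _); last by rewrite inE.
  by rewrite /Q /= subr0 etaE; lra.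
have e1 : eta * (1 + sqn x1) < e (x1, t1) by move: Qpos; rewrite /Q /= subr0 subr_gt0.
have [_ /= /andP[t1ge0 t1le]] := z1K.
pose E := expR (- m * t1); have E0 : 0 < E := expR_gt0 _.
have eta1 : eta <= eta * (1 + sqn x1) by rewrite ler_pMr// lerDl sqn_ge0.
have d1 : 0 < d (x1, t1).
  by have := lt_trans (lt_le_trans eta0 eta1) e1; rewrite /e /= pmulr_rgt0.
have t1pos : 0 < t1.
  rewrite lt_neqAle t1ge0 andbT; apply/eqP => t1E.
  by move: d1; rewrite -t1E ltNge d0.
have oh : open_half (x1, t1) by [].
have x1in i : `|x1 0 i| < rho.
  rewrite ltNge; apply/negP => H.
  by have := far x1 t1 (introT andP (conj t1ge0 t1le)) (le_trans H (coord_le_enorm _ _)); rewrite leNgt Qpos.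
have [dtd dxd] := rd _ oh.
have time : m * d (x1, t1) <= dt d (x1, t1).
  have dE : is_derive t1 1 (fun s : R => e (x1, s)) (E * (dt d (x1, t1) - m * d (x1, t1))).
    have L : is_derive t1 1 (fun s => d (x1, s)) (dt d (x1, t1)).
      have := @line_derive R _ d (x1, 0) tdir t1.
      rewrite tdir_shift /= add0r => /(_ dtd).
      by under eq_fun do rewrite tdir_shift /= add0r.
    have ex : is_derive t1 1 (fun s => expR (- m * s)) (- m * expR (- m * t1)).
      apply: dereq (dercomp (is_derive_expR _) (derZ (- m) (derid t1))) _.
      by rewrite mulr1 mulrC.
    apply: dereq (derM ex L) _; rewrite /E /=; ring.
  have neg : is_derive (- t1) 1 (fun s : R => e (x1, - s)) (- (E * (dt d (x1, t1) - m * d (x1, t1)))).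
    have dN : is_derive (- t1) 1 (fun s : R => - s) (-1).
      exact: is_deriveN (derid _).
    have dE' : is_derive (- - t1) 1 (fun s : R => e (x1, s)) (E * (dt d (x1, t1) - m * d (x1, t1))) by rewrite opprK.
    by apply: dereq (dercomp dE' dN) _; rewrite mulrN1.
  have := @derive_lower R _ _ _ 0 t1 t1pos neg.
  rewrite oppr_le0 pmulr_rge0// subr_ge0; apply => s /andP[s0 s1].
  rewrite mul0r opprD opprK subr_le0.
  have := zmax (x1, t1 - s); rewrite inE => H.
  have : Q (x1, t1 - s) <= Q (x1, t1).
    apply: H; have [H1 _] := z1K; split => //=; apply/andP; split; lra.
  by rewrite /Q /= lerD2r.
have space i : 'D_(xdir i) ('D_(xdir i) d) (x1, t1) <= 2 * (eta / E).
  have r0 : 0 < rho - `|x1 0 i| by rewrite subr_gt0.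
  apply: (proj2 (@touch_above R _ d (x1, t1) (xdir i) (2 * x1 0 i * eta / E) (eta / E) 0 _ r0 _ _ _)).
  - by move=> s _; have [] := rd _ (open_half_xdir s i oh) => _ /(_ i) [].
  - by have [] := dxd i.
  - move=> s sr; rewrite mul0r addr0.
    have : Q ((x1, t1) + s *: xdir i) <= Q (x1, t1).
      apply: zmax; rewrite inE; apply: box_shift => //=; by rewrite mxE subr0.
    rewrite xdir_shift /Q /e /= !subr0 sqn_shift -/E => H.
    rewrite -(ler_pM2l E0).
    have -> : E * (d (x1, t1) + 2 * x1 0 i * eta / E * s + eta / E * s ^+ 2) =
      E * d (x1, t1) + eta * (2 * x1 0 i * s + s ^+ 2) by field; rewrite gt_eqF.
    lra.
have sumle : \sum_i 'D_(xdir i) ('D_(xdir i) d) (x1, t1) <= 2 * (eta / E) * n%:R.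
  apply: le_trans (ler_sum _ (fun i _ => space i)) _.
  by rewrite sumr_const card_ord mulr_natr.
have H1 := pde _ oh d1.
have H2 : D * (\sum_i 'D_(xdir i) ('D_(xdir i) d) (x1, t1)) <= 2 * n%:R * D * (eta / E).
  by apply: le_trans (ler_wpM2l D0 sumle) _; lra.
have H3 : eta / E < d (x1, t1).
  by rewrite ltr_pdivrMr// mulrC; exact: le_lt_trans e1.
have H4 : 2 * n%:R * D * (eta / E) <= 2 * n%:R * D * d (x1, t1) by rewrite ler_wpM2l// ltW.
by move: time H1 H2 H4 d1; rewrite /m; lra.
Qed.

End Comparison.

Section Regularity.
Context {R : realType} {n : nat}.
Implicit Types (x y : 'rV[R]_n) (z w : 'rV[R]_n * R) (d f h u : 'rV[R]_n * R -> R).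

Lemma within_continuous_ball (A : set ('rV[R]_n * R)) f :
  {within A, continuous f} <->
  forall z, A z -> forall e : R, 0 < e -> exists2 r : R, 0 < r &
    forall w, A w -> `|z - w| < r -> `|f z - f w| < e.
Proof.
rewrite subspace_continuousP; split=> H z Az.
  move=> e e0; have /cvgrPdist_lt/(_ e e0) := H z Az.
  rewrite near_withinE => /nbhs_normP[r /= r0 Hr]; exists r => // w Aw zw.
  exact: Hr.
apply/cvgrPdist_lt => e e0; have [r r0 Hr] := H z Az e e0.
rewrite near_withinE; apply/nbhs_ballP; exists r => //= w.
by rewrite -ball_normE /= => zw Aw; exact: Hr.
Qed.

Lemma open_open_half : open (@open_half R n).
Proof.
have -> : @open_half R n = snd @^-1` [set t : R | 0 < t] by [].
by apply: open_comp; [move=> z _; exact: cvg_snd|exact: open_gt].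
Qed.

Lemma derive_from_line (V : normedModType R) (f : V -> R) (z v : V) (l : R) :
  is_derive (0 : R) 1 (fun r : R => f (z + r *: v)) l -> is_derive z v f l.
Proof.
have E : (fun h : R => h^-1 *: (((fun r : R => f (z + r *: v)) \o shift 0) (h *: (1 : R)) - f (z + 0 *: v))) =
         (fun h : R => h^-1 *: ((f \o shift z) (h *: v) - f z)).
  apply/funext => h; rewrite /shift /= scale0r !addr0; congr (_ *: (f _ - _)).
  by rewrite [h *: 1]mulr1 addrC.
by move=> [H1 H2]; split; [move: H1; rewrite /derivable E|move: H2; rewrite /derive E].
Qed.

Lemma derive_comb (V : normedModType R) (f h : V -> R) (a b : R) (z v : V) :
  derivable f z v -> derivable h z v ->
  is_derive z v (fun w : V => a * f w + b * h w) (a * 'D_v f z + b * 'D_v h z).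
Proof.
move=> /derivableP df /derivableP dh.
by apply: (@is_deriveD _ _ _ (fun w : V => a * f w) (fun w : V => b * h w)); exact: is_deriveZ.
Qed.

Lemma twice_derivable_comb f h (a b : R) : twice_derivable f -> twice_derivable h ->
  let d w := a * f w + b * h w in
  twice_derivable d /\ forall z, open_half z ->
    dt d z = a * dt f z + b * dt h z /\
    forall i, 'D_(xdir i) ('D_(xdir i) d) z =
      a * 'D_(xdir i) ('D_(xdir i) f) z + b * 'D_(xdir i) ('D_(xdir i) h) z.
Proof.
move=> rf rh d.
have D2 z i : open_half z -> is_derive z (xdir i) ('D_(xdir i) d)
    (a * 'D_(xdir i) ('D_(xdir i) f) z + b * 'D_(xdir i) ('D_(xdir i) h) z).
  move=> oz; have [_ /(_ i) [_ f2]] := rf z oz; have [_ /(_ i) [_ h2]] := rh z oz.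
  apply: near_eq_is_derive (derive_comb a b f2 h2).
  apply: filterS (open_nbhs_nbhs (conj open_open_half oz)) => w ow.
  have [_ /(_ i) [f1 _]] := rf w ow; have [_ /(_ i) [h1 _]] := rh w ow.
  by have [_ ->] := derive_comb a b f1 h1.
split=> z oz.
  have [ft fx] := rf z oz; have [ht hx] := rh z oz.
  split; first by have [] := derive_comb a b ft ht.
  move=> i; have [f1 _] := fx i; have [h1 _] := hx i.
  by split; [have [] := derive_comb a b f1 h1|have [] := D2 z i oz].
have [ft fx] := rf z oz; have [ht hx] := rh z oz.
split; first by have [] := derive_comb a b ft ht.
by move=> i; have [] := D2 z i oz.
Qed.

Definition paraboloid (c a b : R) x0 (z : 'rV[R]_n * R) : R :=
  c + a * sqn (z.1 - x0) + b * z.2.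

Lemma paraboloid_xdir (c a b s : R) x0 z i :
  paraboloid c a b x0 (z + s *: xdir i) =
  c + a * (sqn (z.1 - x0) + 2 * (z.1 0 i - x0 0 i) * s + s * s) + b * z.2.
Proof.
rewrite /paraboloid xdir_shift /=; congr (_ + _ * _ + _).
by rewrite addrAC sqn_shift !mxE expr2.
Qed.

Lemma paraboloid_derive (c a b : R) x0 z :
  is_derive z tdir (paraboloid c a b x0) b /\
  forall i, is_derive z (xdir i) (paraboloid c a b x0) (2 * a * (z.1 0 i - x0 0 i)).
Proof.
split=> [|i]; apply: derive_from_line.
  rewrite /paraboloid; under eq_fun do rewrite tdir_shift /=.
  apply: dereq (derD (dercst _ _) (derZ b (derD (dercst z.2 _) (derid _)))) _.
  by rewrite !add0r mulr1.
under eq_fun do rewrite paraboloid_xdir.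
apply: dereq (derD (derD (dercst c 0) (derZ a (derD (derD (dercst (sqn (z.1 - x0)) 0)
  (derZ (2 * (z.1 0 i - x0 0 i)) (derid 0))) (derM (derid 0) (derid 0))))) (dercst (b * z.2) 0)) _.
by ring.
Qed.

Lemma paraboloid_regular (c a b : R) x0 :
  twice_derivable (paraboloid c a b x0) /\
  forall z, dt (paraboloid c a b x0) z = b /\
    forall i, 'D_(xdir i) ('D_(xdir i) (paraboloid c a b x0)) z = 2 * a.
Proof.
have D2 z i : is_derive z (xdir i) ('D_(xdir i) (paraboloid c a b x0)) (2 * a).
  have -> : 'D_(xdir i) (paraboloid c a b x0) = fun w => 2 * a * (w.1 0 i - x0 0 i).
    by apply/funext => w; have [_ /(_ i) []] := paraboloid_derive c a b x0 w.
  apply: derive_from_line; under eq_fun do rewrite xdir_shift /= !mxE !eqxx mulr1.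
  apply: dereq (derZ (2 * a) (derB (derD (dercst (z.1 0 i) 0) (derid 0)) (dercst (x0 0 i) 0))) _.
  by ring.
split=> [z _|z]; have [[H1 H2] H3] := paraboloid_derive c a b x0 z.
  by split=> [|i]; [exact: H1|split; [have [] := H3 i|have [] := D2 z i]].
by split=> [|i]; [exact: H2|have [] := D2 z i].
Qed.

Lemma twice_derivable_shift f w : 0 <= w.2 -> twice_derivable f ->
  let d z := f (z + w) in
  twice_derivable d /\ forall z, open_half z ->
    dt d z = dt f (z + w) /\
    forall i, 'D_(xdir i) ('D_(xdir i) d) z = 'D_(xdir i) ('D_(xdir i) f) (z + w).
Proof.
move=> w0 rf d.
have quot (h : 'rV[R]_n * R -> R) z (v : 'rV[R]_n * R) :
    (fun s : R => s^-1 *: (((fun z' : 'rV[R]_n * R => h (z' + w)) \o shift z) (s *: v) - h (z + w))) =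
    (fun s : R => s^-1 *: ((h \o shift (z + w)) (s *: v) - h (z + w))).
  by apply/funext => s; rewrite /= /shift /= -addrA.
have Dd h z (v : 'rV[R]_n * R) : 'D_v (fun z' : 'rV[R]_n * R => h (z' + w)) z = 'D_v h (z + w).
  by rewrite /derive quot.
have dd h z (v : 'rV[R]_n * R) : derivable (fun z' : 'rV[R]_n * R => h (z' + w)) z v = derivable h (z + w) v.
  by rewrite /derivable quot.
have DdE (v : 'rV[R]_n * R) : 'D_v d = fun z' => 'D_v f (z' + w) by apply/funext => z'; exact: Dd.
have oh z : open_half z -> open_half (z + w).
  by rewrite /open_half /= => z0; exact: ltr_wpDr.
split=> z oz; have [ft fx] := rf _ (oh z oz).
  split; first by rewrite (dd f).
  by move=> i; have [f1 f2] := fx i; split; [rewrite (dd f)|rewrite DdE (dd ('D_(xdir i) f))].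
by split; [exact: (Dd f)|move=> i; rewrite DdE (Dd ('D_(xdir i) f))].
Qed.

Lemma within_continuous_shift u w : 0 <= w.2 ->
  {within closed_half, continuous u} ->
  {within closed_half, continuous (fun z => u (z + w))}.
Proof.
move=> w0 /within_continuous_ball cu; apply/within_continuous_ball => z z0 e e0.
have ch (y : 'rV[R]_n * R) : closed_half y -> closed_half (y + w).
  by rewrite /closed_half /= => y0; exact: addr_ge0.
have [r r0 H] := cu (z + w) (ch _ z0) e e0; exists r => // y y0 zy.
by apply: H; [exact: ch|rewrite opprD addrACA subrr addr0].
Qed.

Lemma paraboloid_continuous (c a b : R) x0 : continuous (paraboloid c a b x0).
Proof.
move=> z; apply: cvgD; first apply: cvgD; first exact: cvg_cst.
  by apply: cvgM; [exact: cvg_cst|exact: sqn_continuous].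
by apply: cvgM; [exact: cvg_cst|exact: cvg_snd].
Qed.

End Regularity.

(** * Lipschitz estimate for the approximate problems *)

Section HeatSolutions.
Context {R : realType} {n : nat}.
Implicit Types (x y h : 'rV[R]_n) (z w : 'rV[R]_n * R) (u : 'rV[R]_n * R -> R).
Implicit Types (g : R -> R).

Lemma enormD_le x y : enorm (x + y) <= 2 * (enorm x + enorm y).
Proof.
have s0 : 0 <= 2 * (enorm x + enorm y) by rewrite mulr_ge0// addr_ge0 ?enorm_ge0.
rewrite -[leRHS]ger0_norm// -sqrtr_sqr; apply: ler_wsqrtr; rewrite -/(sqn (x + y)).
have H : sqn (x + y) <= 2 * sqn x + 2 * sqn y.
  rewrite /sqn !mulr_sumr -big_split /=; apply: ler_sum => i _; rewrite mxE.
  by have := sqr_ge0 (x 0 i - y 0 i); rewrite !expr2; lra.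
apply: le_trans H _; rewrite -!enorm_sq !expr2.
have := enorm_ge0 x; have := enorm_ge0 y => hy hx.
by have := mulr_ge0 hx hy; have := mulr_ge0 hx hx; have := mulr_ge0 hy hy; lra.
Qed.

Lemma heat_solution_regular (eps alpha : R) g (u0 : 'rV[R]_n -> R) u :
  heat_solution eps alpha g u0 u ->
  twice_derivable u /\ forall z, open_half z ->
    dt u z - eps `^ alpha * (\sum_i 'D_(xdir i) ('D_(xdir i) u) z) = g (u z / eps).
Proof.
move=> [_ _ reg eqn _].
have half : 0 < (2^-1 : R) < 1 by rewrite invr_gt0 ltr0n/= invf_lt1// ltr1n.
have [[rd _ _ _ _] _ _] := reg _ half.
split=> [z oz|z oz].
  have [ht hx] := rd z oz; split; [exact: ht|move=> i].
  by have [h1 h2] := hx i; split; [exact: h1|exact: h2].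
have := eqn z oz; rewrite /laplacian /mxtrace => /eqP; rewrite subr_eq0 => /eqP <-.
by congr (_ - _ * _); apply: eq_bigr => i _; rewrite mxE.
Qed.

Lemma heat_growth (eps alpha : R) g (u0 : 'rV[R]_n -> R) u : heat_solution eps alpha g u0 u ->
  forall T : R, exists2 C : R, 0 <= C &
    forall x (t : R), 0 <= t <= T -> `|u (x, t)| <= C * (1 + enorm x).
Proof.
move=> [_ _ _ _ gr] T; have [C HC] := gr T; exists `|C|; first exact: normr_ge0.
move=> x t tT; apply: le_trans (HC x t tT) _.
by rewrite ler_wpM2r ?ler_norm// addr_ge0// enorm_ge0.
Qed.

(** A paraboloid dominates the cone L |y - x| up to L delta / 2, and adding a
    multiple of t makes it a supersolution. *)
Lemma heat_initial_oscillation (eps alpha L G delta s : R) g (u0 : 'rV[R]_n -> R) u x (t : R) :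
  0 <= L -> 0 < delta -> `|s| = 1 -> 0 <= t ->
  (forall a, `|g a| <= G) ->
  (forall x y, `|u0 x - u0 y| <= L * enorm (x - y)) ->
  heat_solution eps alpha g u0 u ->
  s * (u (x, t) - u0 x) <=
    L * delta / 2 + (eps `^ alpha * L * n%:R / delta + G) * t.
Proof.
move=> L0 delta0 s1 t0 gG u0L hs.
have [ru eqn] := heat_solution_regular hs; have [cu iu _ _ _] := hs.
set D := eps `^ alpha in eqn *; have D0 : 0 <= D := powR_ge0 _ _.
have G0 : 0 <= G := le_trans (normr_ge0 _) (gG 0).
pose a := L / (2 * delta); have a0 : 0 <= a by rewrite divr_ge0// mulr_ge0// ltW.
pose b := D * L * n%:R / delta + G.
have b0 : 0 <= b by rewrite addr_ge0// !mulr_ge0// invr_ge0 ltW.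
pose q := paraboloid (s * u0 x + L * delta / 2) a b x.
have [rq dq] := paraboloid_regular (s * u0 x + L * delta / 2) a b x.
have [rd dd] := @twice_derivable_comb R n u q s (-1) ru rq.
have cq := @paraboloid_continuous R n (s * u0 x + L * delta / 2) a b x.
have su v : s * v <= `|v| by rewrite -[leRHS]mul1r -s1 -normrM ler_norm.
suff H : s * u (x, t) + (-1) * q (x, t) <= 0.
  by move: H; rewrite /q /paraboloid /= subrr sqn0 /b; lra.
apply: (@parabolic_comparison R n D 0 (fun w => s * u w + (-1) * q w)) => //.
- have cq' := @continuous_subspaceT _ _ closed_half _ cq.
  move=> z; apply: cvgD; apply: cvgM; [exact: cvg_cst|exact: cu|exact: cvg_cst|exact: cq'].
- move=> y; rewrite iu /q /paraboloid /= mulr0 addr0.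
  have h1 : s * (u0 y - u0 x) <= L * enorm (y - x) by apply: le_trans (su _) (u0L _ _).
  have h2 : L * enorm (y - x) <= L * delta / 2 + a * sqn (y - x).
    rewrite -subr_ge0 -enorm_sq.
    have -> : L * delta / 2 + a * enorm (y - x) ^+ 2 - L * enorm (y - x) =
      a * (enorm (y - x) - delta) ^+ 2 by rewrite /a; field; rewrite gt_eqF.
    by rewrite mulr_ge0// sqr_ge0.
  lra.
- move=> z oz _; have [-> ddz] := dd z oz; have [-> dqz] := dq z.
  under eq_bigr => i _ do rewrite ddz dqz.
  rewrite big_split /= -[X in D * (X + _)]mulr_sumr sumr_const card_ord mul0r.
  have := eqn z oz; have := le_trans (su _) (gG (u z / eps)) => h1 h2.
  rewrite -h2 in h1.
  have : (-1 * (2 * a)) *+ n = - (L * n%:R / delta).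
    by rewrite -mulr_natr /a; field; rewrite gt_eqF.
  by move=> ->; move: h1; rewrite /b; lra.
- move=> T; have [C C0 HC] := heat_growth hs T.
  exists (C + `|s * u0 x|) => y r rT; have /andP[r0 _] := rT.
  have h1 := le_trans (su _) (HC y r rT).
  have h2 : 0 <= a * sqn (y - x) + b * r by rewrite addr_ge0// mulr_ge0// sqn_ge0.
  have h3 : - (s * u0 x) <= `|s * u0 x| * (1 + enorm y).
    apply: (@le_trans _ _ `|s * u0 x|); first by rewrite -normrN ler_norm.
    by rewrite ler_peMr ?normr_ge0// lerDl enorm_ge0.
  have h4 : 0 <= L * delta / 2 by rewrite !mulr_ge0// ?invr_ge0 ?ltW.
  by rewrite /q /paraboloid /=; move: h1 h2 h3 h4; lra.
Qed.

(** Since g is 1-periodic, u + eps k solves the same equation, so it stays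
    above every translate that it dominates initially. *)
Lemma heat_translation (eps alpha l s : R) g (u0 : 'rV[R]_n -> R) u w (k : nat) :
  0 < eps -> 0 <= l -> (s = 1 \/ s = -1) -> 0 <= w.2 ->
  (forall a b, `|g a - g b| <= l * `|a - b|) -> periodic g 1 ->
  heat_solution eps alpha g u0 u ->
  (forall x, s * (u (x + w.1, w.2) - u0 x) <= eps * k%:R) ->
  forall x (t : R), 0 <= t -> s * (u (x + w.1, t + w.2) - u (x, t)) <= eps * k%:R.
Proof.
move=> eps0 l0 s1 w0 gl pg hs H0 x t t0.
have [ru eqn] := heat_solution_regular hs; have [cu iu _ _ _] := hs.
set D := eps `^ alpha in eqn *; have D0 : 0 <= D := powR_ge0 _ _.
have [rw dw] := twice_derivable_shift w0 ru.
have [rc dc] := paraboloid_regular (eps * k%:R) 0 0 (0 : 'rV[R]_n).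
have [r1 d1] := @twice_derivable_comb R n u (paraboloid (eps * k%:R) 0 0 0) (- s) (-1) ru rc.
have [r2 d2] := twice_derivable_comb s 1 rw r1.
set d := (fun z : 'rV[R]_n * R => _) in r2 d2.
have dE z : d z = s * (u (z + w) - u z) - eps * k%:R.
  by rewrite /d /paraboloid; ring.
have su v : s * v <= `|v|.
  by case: s1 => ->; rewrite ?mul1r ?ler_norm// mulN1r -normrN ler_norm.
suff : d (x, t) <= 0 by rewrite dE subr_le0; case: (w).
apply: (@parabolic_comparison R n D (l / eps) d) => //.
- by rewrite divr_ge0// ltW.
- have cw := within_continuous_shift w0 cu.
  have cp := @continuous_subspaceT _ _ closed_half _ (@paraboloid_continuous R n (eps * k%:R) 0 0 0).
  move=> z; apply: cvgD; apply: cvgM; [exact: cvg_cst|exact: cw|exact: cvg_cst|].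
  by apply: cvgD; apply: cvgM; [exact: cvg_cst|exact: cu|exact: cvg_cst|exact: cp].
- move=> y; rewrite dE iu subr_le0.
  have -> : (y, 0) + w = (y + w.1, w.2) by case: (w) => a b; congr (_, _); rewrite /= add0r.
  exact: H0.
- move=> z oz dpos; have [-> ddz] := d2 z oz; have [-> dwz] := dw z oz.
  have [-> d1z] := d1 z oz; have [-> dcz] := dc z.
  under eq_bigr => i _ do rewrite ddz dwz d1z dcz.
  rewrite big_split /= -[X in D * (X + _)]mulr_sumr -[X in D * (_ + X)]mulr_sumr.
  rewrite big_split /= -[X in D * (_ + 1 * (X + _))]mulr_sumr mulr0.
  rewrite [X in D * (_ + 1 * (_ + X))]big1 => [|i _]; last by rewrite !mulr0.
  have ozw : open_half (z + w) by rewrite /open_half /=; exact: ltr_wpDr.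
  have := eqn z oz; have := eqn _ ozw => e1 e2.
  have gs : s * (g (u (z + w) / eps) - g (u z / eps)) <= l / eps * d z.
    have -> : g (u z / eps) = g (u z / eps + s * k%:R).
      case: s1 => ->; first by rewrite mul1r periodicn.
      by rewrite mulN1r -[RHS](periodicn pg k) subrK.
    apply: le_trans (su _) _; apply: le_trans (gl _ _) _.
    have -> : u (z + w) / eps - (u z / eps + s * k%:R) = s * (d z / eps).
      have ss : s * s = 1 by case: s1 => ->; rewrite ?mulrNN mulr1.
      have -> : s * (d z / eps) = (s * s) * ((u (z + w) - u z) / eps) - s * k%:R.
        by rewrite dE; field; rewrite gt_eqF.
      by rewrite ss; ring.
    have -> : `|s * (d z / eps)| = d z / eps.
      rewrite normrM (gtr0_norm (divr_gt0 dpos eps0)).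
      by case: s1 => ->; rewrite ?normrN normr1 mul1r.
    by rewrite mulrA mulrAC.
  move: gs; rewrite -e1 -e2.
  have combine (X1 X2 Y1 Y2 rhs : R) : s * (X1 - D * Y1 - (X2 - D * Y2)) <= rhs ->
      s * X1 + 1 * (- s * X2 + 0) - D * (s * Y1 + 1 * (- s * Y2 + 0)) <= rhs.
    by clear; lra.
  exact: combine.
- move=> T; have [C C0 HC] := heat_growth hs (T + w.2).
  exists (C * (3 + 2 * enorm w.1 + 1)) => y r /andP[r0 rT].
  have h1 : `|u ((y, r) + w)| <= C * (1 + enorm (y + w.1)).
    by move: HC; case: (w) w0 => a b /= b0 HC; apply: HC; rewrite addr_ge0//= lerD2r.
  have h2 : `|u (y, r)| <= C * (1 + enorm y).
    by apply: HC; rewrite r0 (le_trans rT)// lerDl.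
  have h3 : C * (1 + enorm (y + w.1)) <= C * (1 + 2 * (enorm y + enorm w.1)).
    by rewrite ler_wpM2l// lerD2l enormD_le.
  have h4 := su (u ((y, r) + w) - u (y, r)).
  have h5 := ler_normB (u ((y, r) + w)) (u (y, r)).
  have h6 : 0 <= eps * k%:R by rewrite mulr_ge0// ltW.
  have h7 : 0 <= C * enorm y by rewrite mulr_ge0// enorm_ge0.
  have h8 : 0 <= C * enorm w.1 by rewrite mulr_ge0// enorm_ge0.
  have h9 : 0 <= C * enorm y * enorm w.1 by rewrite mulr_ge0// enorm_ge0.
  rewrite dE; lra.
Qed.

(** Translations in space and time are compared with the initial datum by
    [heat_initial_oscillation] and then propagated by [heat_translation]. *)
Lemma heat_modulus (eps alpha l L G delta : R) g (u0 : 'rV[R]_n -> R) u x h (t s : R) :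
  0 < eps -> 0 <= l -> 0 <= L -> 0 < delta -> 0 <= t -> 0 <= s ->
  (forall a b, `|g a - g b| <= l * `|a - b|) -> periodic g 1 ->
  (forall a, `|g a| <= G) ->
  (forall x y, `|u0 x - u0 y| <= L * enorm (x - y)) ->
  heat_solution eps alpha g u0 u ->
  `|u (x + h, t + s) - u (x, t)| <=
    L * enorm h + L * delta / 2 + (eps `^ alpha * L * n%:R / delta + G) * s + eps.
Proof.
move=> eps0 l0 L0 delta0 t0 s0 gl pg gG u0L hs.
set M := L * enorm h + L * delta / 2 + (eps `^ alpha * L * n%:R / delta + G) * s.
have init (r : R) : (r = 1 \/ r = -1) -> forall y, r * (u (y + h, s) - u0 y) <= M.
  move=> r1 y.
  have nr : `|r| = 1 by case: r1 => ->; rewrite ?normrN normr1.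
  have h1 := heat_initial_oscillation (y + h) L0 delta0 nr s0 gG u0L hs.
  have h2 : r * (u0 (y + h) - u0 y) <= L * enorm h.
    apply: le_trans (ler_norm _) _; rewrite normrM nr mul1r.
    by apply: le_trans (u0L _ _) _; rewrite addrAC subrr add0r.
  by rewrite /M; move: h1 h2; lra.
have M0 : 0 <= M.
  have i1 := init 1 (or_introl erefl) 0; have i2 := init (-1) (or_intror erefl) 0.
  by move: i1 i2; lra.
(* the shift is rounded up to a multiple of eps, which the nonlinearity does not see *)
pose k := (Num.truncn (M / eps)).+1.
have kM : M <= eps * k%:R.
  by rewrite mulrC -ler_pdivrMr// ltW// truncnS_gt.
have kM' : eps * k%:R <= M + eps.
  have : (Num.truncn (M / eps))%:R <= M / eps by rewrite truncn_le divr_ge0// ltW.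
  by rewrite ler_pdivlMr// /k -natr1; lra.
have tr (r : R) : (r = 1 \/ r = -1) -> r * (u (x + h, t + s) - u (x, t)) <= M + eps.
  move=> r1; apply: le_trans kM'.
  apply: (@heat_translation eps alpha l r g u0 u (h, s)) => // y.
  exact: le_trans (init r r1 y) kM.
have t1 := tr 1 (or_introl erefl); have t2 := tr (-1) (or_intror erefl).
by rewrite ler_norml; apply/andP; split; move: t1 t2; lra.
Qed.

End HeatSolutions.

(** * Rectification of the equation along a profile *)

Section WaveCoordinate.
Context {R : realType}.
Implicit Types (g A V : R -> R).

(** The rectifying coordinate S.  The factor c makes S (y + eps) = S y + eps when
    A is a primitive of 1 / V, so that S is at bounded distance from the identity. *)
Definition wave_coordinate V A (eps y : R) : R :=
  harmonic_avg V * eps * (A (y / eps) - A 0).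

Lemma wave_coordinate_derive V A (eps y : R) : 0 < eps ->
  (forall s : R, is_derive s 1 A (V s)^-1) ->
  is_derive y 1 (wave_coordinate V A eps) (harmonic_avg V / V (y / eps)).
Proof.
move=> eps0 dA; rewrite /wave_coordinate.
have dl : is_derive y 1 (fun x => x / eps) eps^-1.
  have -> : (fun x => x / eps) = (fun x => eps^-1 * x) by apply/funext => x; rewrite mulrC.
  by apply: dereq (derZ eps^-1 (derid y)) _; rewrite mulr1.
have dAl : is_derive (y / eps) 1 A (V (y / eps))^-1 by exact: dA.
apply: dereq (derZ (harmonic_avg V * eps) (derB (dercomp (f := fun x => x / eps) dAl dl) (dercst (A 0) y))) _.
by rewrite subr0 mulrACA mulfV ?gt_eqF// mulr1.
Qed.

Lemma wave_coordinate_derive2 g (k : R) V (eps y : R) : 0 < eps -> 0 < k ->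
  wave_profile g k V ->
  is_derive y 1 (fun x => harmonic_avg V / V (x / eps))
    (- (harmonic_avg V * (V (y / eps) - g (y / eps)) / (k * eps * V (y / eps) ^+ 3))).
Proof.
move=> eps0 k0 [_ V0 dV].
have dl : is_derive y 1 (fun x => x / eps) eps^-1.
  have -> : (fun x => x / eps) = (fun x => eps^-1 * x) by apply/funext => x; rewrite mulrC.
  by apply: dereq (derZ eps^-1 (derid y)) _; rewrite mulr1.
have dVl : is_derive (y / eps) 1 V ((V (y / eps) - g (y / eps)) / (k * V (y / eps))) by exact: dV.
have Vn0 : V (y / eps) != 0 by rewrite gt_eqF.
apply: dereq (derZ (harmonic_avg V) (derV (f := fun x => V (x / eps)) Vn0 (dercomp (f := fun x => x / eps) dVl dl))) _.
by field; rewrite !gt_eqF.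
Qed.

(** The function c (A x - A 0) - x is periodic, and on a period both terms lie
    between 0 and 1. *)
Lemma wave_coordinate_close V A (eps y : R) : 0 < eps ->
  periodic V 1 -> continuous V -> (forall s, 0 < V s) ->
  (forall s : R, is_derive s 1 A (V s)^-1) ->
  `|wave_coordinate V A eps y - y| <= eps.
Proof.
move=> eps0 pV cV V0 dA; have ciV := continuous_inv cV V0.
have c0 := harmonic_avg_gt0 cV V0; set c := harmonic_avg V in c0 *.
have A1 : A 1 - A 0 = c^-1 by rewrite -(unit_avg_primitive ciV dA) /c /harmonic_avg invrK.
have Aincr x1 x2 : x1 <= x2 -> A x1 <= A x2.
  move=> x12; rewrite -subr_ge0.
  have := @increment_le R (fun=> 0) A (fun=> 0) (fun s => (V s)^-1) x1 x2 x12
    (fun x => dercst 0 x) dA (fun s => ltW _); rewrite subrr; apply => s.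
  by rewrite invr_gt0.
have pB : periodic (fun x => c * (A x - A 0) - x) 1.
  move=> x.
  have dS (s : R) : is_derive s 1 (fun t => A (t + 1)) (V s)^-1.
    apply: dereq (dercomp (dA _) (derD (derid s) (dercst 1 s))) _.
    by rewrite pV addr0 mulr1.
  have E : A (x + 1) - A x = A 1 - A 0.
    have [x0|x0] := leP 0 x.
      have := eq_of_derive x0 (fun s _ => dA s) (fun s _ => dS s); rewrite add0r; lra.
    have := eq_of_derive (ltW x0) (fun s _ => dA s) (fun s _ => dS s); rewrite add0r; lra.
  have -> : A (x + 1) = A x + c^-1 by rewrite -A1; lra.
  by field; rewrite gt_eqF.
have H x : `|c * (A x - A 0) - x| <= 1.
  have [y' /andP[y0 y1] [m [_ ->]]] := periodic_floor pB x.
  have h1 := Aincr _ _ y0; have h2 := Aincr _ _ (ltW y1).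
  have h3 : 0 <= c * (A y' - A 0) by rewrite mulr_ge0 ?subr_ge0// ltW.
  have h4 : c * (A y' - A 0) <= 1.
    apply: (@le_trans _ _ (c * (A 1 - A 0))); last by rewrite A1 mulfV ?gt_eqF.
    by rewrite ler_wpM2l// ?lerD2r// ltW.
  by rewrite ler_norml; lra.
have -> : wave_coordinate V A eps y - y = eps * (c * (A (y / eps) - A 0) - y / eps).
  by rewrite /wave_coordinate -/c; field; rewrite gt_eqF.
by rewrite normrM (gtr0_norm eps0) ler_piMr ?H// ltW.
Qed.

Lemma derive_compose (W : normedModType R) (u : W -> R) (z v : W) (S : R -> R) (d : R) :
  derivable u z v -> is_derive (u z) 1 S d ->
  is_derive z v (fun w => S (u w)) (d * 'D_v u z).
Proof.
move=> du dS; apply: derive_from_line.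
have zE : z + 0 *: v = z by rewrite scale0r addr0.
have := @line_derive R W u z v 0; rewrite zE => /(_ du) L.
have dS' : is_derive (u (z + 0 *: v)) 1 S d by rewrite zE.
exact: (dercomp dS' L).
Qed.

Lemma touch_below_derive (f : R -> R) (d a C r : R) : 0 < r -> is_derive (0 : R) 1 f d ->
  (forall s : R, `|s| < r -> f s <= f 0 + a * s + C * s ^+ 2) -> d = a.
Proof.
move=> r0 df H; apply/eqP; rewrite -subr_eq0; apply/eqP.
have dG : is_derive (0 : R) 1 (fun s => f s - (a * s + C * (s * s))) (d - a).
  apply: dereq (derB df (derD (derZ a (derid 0)) (derZ C (derM (derid 0) (derid 0))))) _.
  by ring.
apply: (derive_at_max r0 dG) => t; rewrite subr0 => tr.
by have := H t tr; rewrite expr2; lra.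
Qed.

End WaveCoordinate.

Section TouchingTheWave.
Context {R : realType} {n : nat}.
Implicit Types (g A V : R -> R) (u : 'rV[R]_n * R -> R).

(** The equation for v = S u at a point where v is touched from below (s = 1) or
    above (s = -1), with gradient q, second derivatives - 2 s m and time derivative a of
    the touching function.  Since S' = c / V, the second derivative of S produces
    the term with |q|^2 and V' = (V - g) / (k V).  When (D / eps) |q|^2 = k c^2 the
    bracket equals 1 and the right-hand side becomes the constant speed c. *)
Lemma transformed_touch (s D eps k a C r : R) g V A u (z : 'rV[R]_n * R) (q m : 'I_n -> R) :
  (s = 1 \/ s = -1) -> 0 <= D -> 0 < eps -> 0 < k -> wave_profile g k V ->
  (forall s : R, is_derive s 1 A (V s)^-1) ->
  twice_derivable u -> open_half z ->
  dt u z - D * (\sum_i 'D_(xdir i) ('D_(xdir i) u) z) = g (u z / eps) ->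
  let S y := wave_coordinate V A eps y in
  0 < r ->
  (forall i (x : R), `|x| < r -> s * (S (u (z + x *: xdir i)) - S (u z)) >=
    s * q i * x - m i * x ^+ 2 - C * `|x| ^+ 3) ->
  (forall x : R, `|x| < r -> s * (S (u (z + x *: tdir)) - S (u z)) >= s * a * x - C * x ^+ 2) ->
  forall y c : R, y = u z / eps -> c = harmonic_avg V ->
  s * c * (D / eps * (\sum_i q i ^+ 2) / (k * c ^+ 2) * ((V y - g y) / V y) + g y / V y)
    - 2 * D * (\sum_i m i) <= s * a.
Proof.
move=> s1 D0 eps0 k0 wV dA ru oz eqn S r0 Hx Ht y c yE cE.
have [pV V0 _] := wV; have cV := profile_continuous wV.
have c0 : 0 < c by rewrite cE; exact: harmonic_avg_gt0.
have ss : s * s = 1 by case: s1 => ->; rewrite ?mulrNN mulr1.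
have [ut ux] := ru z oz.
pose S1 x := c / V (x / eps).
have dS (x : R) : is_derive x 1 S (S1 x) by rewrite /S1 cE; exact: wave_coordinate_derive.
pose S2 := - (c * (V y - g y) / (k * eps * V y ^+ 3)).
have dS1 : is_derive (u z) 1 S1 S2.
  by rewrite /S1 /S2 cE yE; exact: wave_coordinate_derive2.
have ox (x : R) i : open_half (z + x *: xdir i) by exact: open_half_xdir.
(* the zero summand gives f the shape of a linear combination *)
pose f w := - s * S (u w) + 0 * S (u w).
have dSu w v : derivable u w v -> derivable (fun w => S (u w)) w v /\ 'D_v (fun w => S (u w)) w = S1 (u w) * 'D_v u w.
  by move=> duw; have [] := derive_compose duw (dS (u w)).
have df w v : derivable u w v -> derivable f w v /\ 'D_v f w = - s * (S1 (u w) * 'D_v u w).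
  move=> duw; have [d1 E1] := dSu w v duw.
  by have [d2 ->] := derive_comb (- s) 0 d1 d1; rewrite E1 mul0r addr0; split.
have fE w : f w = - s * S (u w) by rewrite /f mul0r addr0.
have space i : q i = S1 (u z) * 'D_(xdir i) u z /\
   - s * (S2 * 'D_(xdir i) u z ^+ 2 + S1 (u z) * 'D_(xdir i) ('D_(xdir i) u) z) <= 2 * m i.
  have [u1 u2] := ux i.
  have dd : is_derive z (xdir i) ('D_(xdir i) f)
      (- s * (S2 * 'D_(xdir i) u z ^+ 2 + S1 (u z) * 'D_(xdir i) ('D_(xdir i) u) z)).
    have e1 := derive_compose u1 dS1.
    have e2 : is_derive z (xdir i) (fun w => S1 (u w) * 'D_(xdir i) u w)
        (S2 * 'D_(xdir i) u z ^+ 2 + S1 (u z) * 'D_(xdir i) ('D_(xdir i) u) z).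
      apply: is_derive_eq (is_deriveM e1 (derivableP u2)) _.
      by rewrite /GRing.scale /=; ring.
    have e3 : is_derive z (xdir i) (fun w => - s * (S1 (u w) * 'D_(xdir i) u w))
        (- s * (S2 * 'D_(xdir i) u z ^+ 2 + S1 (u z) * 'D_(xdir i) ('D_(xdir i) u) z)).
      exact: is_deriveZ.
    apply: near_eq_is_derive e3.
    apply: filterS (open_nbhs_nbhs (conj open_open_half oz)) => w ow.
    have [_ /(_ i) [f1 _]] := ru w ow.
    by have [_ ->] := df w (xdir i) f1.
  have [dd1 dd2] := dd.
  have [E1 E2] := @touch_above R _ f z (xdir i) (- (s * q i)) (m i) C r r0
     (fun x _ => (df _ _ ((ru _ (ox x i)).2 i).1).1) dd1
     ltac:(move=> x xr; have := Hx i x xr; rewrite !fE; clear; lra).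
  have [_ D1] := df z (xdir i) u1.
  split; last by rewrite -dd2.
  rewrite D1 in E1.
  have : s * (s * q i) = s * (s * (S1 (u z) * 'D_(xdir i) u z)) by congr (_ * _); move: E1; clear; lra.
  by rewrite !mulrA ss !mul1r.
have time : s * a = s * (S1 (u z) * dt u z).
  have zE : z + 0 *: tdir = z by rewrite scale0r addr0.
  have [dft Eft] := df z tdir ut.
  have L : is_derive (0 : R) 1 (fun x => f (z + x *: tdir)) ('D_tdir f z).
    by have := @line_derive R _ f z tdir 0; rewrite zE => /(_ dft).
  have := @touch_below_derive R _ _ (- (s * a)) C r r0 L
    ltac:(move=> x xr; have := Ht x xr; rewrite zE !fE; lra).
  by rewrite Eft -/(dt u z); lra.
have S1E : S1 (u z) = c / V y by rewrite yE.
have S10 : 0 < S1 (u z) by rewrite S1E divr_gt0.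
have ineq i : D * (s * (S1 (u z) * 'D_(xdir i) ('D_(xdir i) u) z)) >=
   s * (c * (D / eps / (k * c ^+ 2) * ((V y - g y) / V y))) * q i ^+ 2 - 2 * D * m i.
  have [Eq Em] := space i.
  have uq : 'D_(xdir i) u z = q i * V y / c by rewrite Eq S1E; field; rewrite !gt_eqF.
  have := ler_wpM2l D0 Em; rewrite uq.
  have -> : D * (- s * (S2 * (q i * V y / c) ^+ 2 + S1 (u z) * 'D_(xdir i) ('D_(xdir i) u) z)) =
    s * (c * (D / eps / (k * c ^+ 2) * ((V y - g y) / V y))) * q i ^+ 2
    - D * (s * (S1 (u z) * 'D_(xdir i) ('D_(xdir i) u) z)).
    by rewrite /S2; field; rewrite !gt_eqF.
  lra.
have := ler_sum (index_enum 'I_n) (P := xpredT) (fun i _ => ineq i).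
rewrite sumrB -!mulr_sumr => H.
have dtE : dt u z = D * (\sum_i 'D_(xdir i) ('D_(xdir i) u) z) + g y by move: eqn; rewrite yE; lra.
rewrite time dtE S1E.
rewrite S1E in H; move: H.
set sq := \sum_i q i ^+ 2; set sm := \sum_i m i; set su := \sum_i _.
have -> : s * c * (D / eps * sq / (k * c ^+ 2) * ((V y - g y) / V y) + g y / V y) =
  s * (c * (D / eps / (k * c ^+ 2) * ((V y - g y) / V y))) * sq + s * (c / V y * g y) by ring.
lra.
Qed.

End TouchingTheWave.

(** * Minimisation over a family of profiles *)

Section ProfileFamily.
Context {R : realType}.
Implicit Types (g V : R -> R).

Lemma bernoulli (x : R) (N : nat) : 0 <= x -> 1 + N%:R * x <= (1 + x) ^+ N.
Proof.
move=> x0; elim: N => [|N IH]; first by rewrite mul0r addr0 expr0.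
rewrite exprS; apply: le_trans (ler_wpM2l _ IH); last by rewrite addr_ge0.
have : 0 <= N%:R * x * x by rewrite !mulr_ge0.
rewrite -natr1; lra.
Qed.

(** The numbers k_j form a geometric progression of ratio 1 + t.  By
    [profile_compare] the speeds of neighbours differ by a factor 1 + O (t), so the
    kappa_j = k_j c_j^2 grow by a factor of at most 1 + theta when t is small. *)
Lemma profile_family g (a b k0 theta : R) : 0 < a -> 0 < k0 -> 0 < theta ->
  (forall s, a <= g s <= b) -> continuous g -> periodic g 1 ->
  exists (k kap : nat -> R) (V : nat -> R -> R),
    [/\ k 0%N = k0,
        forall j, 0 < k j /\ wave_profile g (k j) (V j),
        forall j, kap j = k j * harmonic_avg (V j) ^+ 2,
        forall j, k0 * a ^+ 2 <= kap j /\ kap j.+1 <= (1 + theta) * kap j &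
        forall X : R, exists N, X <= kap N].
Proof.
move=> a0 k00 th0 gab cg pg.
have ab : a <= b by have /andP[] := gab 0; exact: le_trans.
have b0 : 0 < b by exact: lt_le_trans ab.
pose C := b ^+ 2 / a ^+ 2 * (b ^+ 2 / a) / a.
have C0 : 0 <= C by rewrite !mulr_ge0 ?invr_ge0 ?exprn_ge0// ltW.
pose A := C * (2 + C); have A0 : 0 <= A by rewrite mulr_ge0// addr_ge0.
pose t := Num.min 1 (theta / (1 + 2 * A)).
have A1 : 0 < 1 + 2 * A by rewrite ltr_pwDl// mulr_ge0.
have t0 : 0 < t by rewrite lt_min ltr01 divr_gt0.
have t1 : t <= 1 by rewrite ge_min lexx.
have tA : t * (1 + 2 * A) <= theta by rewrite -ler_pdivlMr// ge_min lexx orbT.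
clearbody t.
pose k j := k0 * (1 + t) ^+ j.
have r0 : 0 < 1 + t by rewrite addr_gt0.
have kpos j : 0 < k j by rewrite mulr_gt0// exprn_gt0.
have ex j : exists W, wave_profile g (k j) W := wave_profile_exists a0 (kpos j) gab cg pg.
pose V j := sval (cid (ex j)).
have wV j : wave_profile g (k j) (V j) by rewrite /V; case: cid.
pose c j := harmonic_avg (V j).
have cb j : a <= c j <= b.
  have [_ V0 _] := wV j.
  have [s _] := harmonic_avg_attained (profile_continuous (wV j)) V0.
  rewrite -/(c j) => ->.
  exact: profile_bounds (kpos j) gab (wV j) s.
have c0 j : 0 < c j by have /andP[/(lt_le_trans a0)] := cb j.
have cstep j : c j.+1 <= c j * (1 + C * t).
  have ratio : k j.+1 / k j - 1 = t.
    by rewrite /k exprS; field; rewrite !gt_eqF// exprn_gt0.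
  have cmp := profile_compare (kpos j.+1) (kpos j) a0 gab (wV j.+1) (wV j).
  have := harmonic_avg_close a0 (profile_continuous (wV j.+1)) (profile_continuous (wV j))
    (profile_bounds (kpos _) gab (wV _)) (profile_bounds (kpos _) gab (wV _)) cmp.
  rewrite ratio (gtr0_norm t0) -/(c _) -/(c j) ler_norml => /andP[_ H].
  have /andP[ca _] := cb j.
  have : b ^+ 2 / a ^+ 2 * (b ^+ 2 / a * t) = a * (C * t) by rewrite /C; field; rewrite gt_eqF.
  have : a * (C * t) <= c j * (C * t) by rewrite ler_wpM2r// mulr_ge0// ltW.
  lra.
pose kap j := k j * c j ^+ 2.
have kap_ge j : k j * a ^+ 2 <= kap j.
  have /andP[ca _] := cb j.
  by rewrite ler_pM2l// ler_sqr// nnegrE ltW.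
exists k, kap, V; split => //.
- by rewrite /k expr0 mulr1.
- move=> j; split.
    apply: le_trans (kap_ge j); rewrite ler_pM2r ?exprn_gt0// /k.
    by rewrite ler_peMr ?(ltW k00)// exprn_ege1// lerDl ltW.
  have kj : k j.+1 = (1 + t) * k j by rewrite /k exprS; ring.
  have h1 : c j.+1 ^+ 2 <= (c j * (1 + C * t)) ^+ 2.
    by have cs := cstep j; have cj := ltW (c0 j.+1); rewrite !expr2 ler_pM.
  have h2 : (1 + t) * (1 + C * t) ^+ 2 <= 1 + theta.
    have ct : C * C * (t * t) <= C * C * t.
      have tt : t * t <= t by apply: ler_piMr => //; exact: ltW.
      by apply: ler_wpM2l => //; exact: mulr_ge0.
    have h3 : (1 + C * t) ^+ 2 <= 1 + A * t by rewrite /A expr2; move: ct; lra.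
    have h4 : (1 + t) * (1 + C * t) ^+ 2 <= (1 + t) * (1 + A * t) by rewrite ler_wpM2l// ltW.
    have h5 : A * t * t <= A * t * 1 by rewrite ler_wpM2l// mulr_ge0// ltW.
    by lra.
  have -> : (1 + theta) * kap j = (k j * c j ^+ 2) * (1 + theta) by rewrite /kap mulrC.
  apply: (@le_trans _ _ ((k j * c j ^+ 2) * ((1 + t) * (1 + C * t) ^+ 2))); last first.
    by rewrite ler_wpM2l// mulr_ge0 ?exprn_ge0// ltW.
  have -> : k j * c j ^+ 2 * ((1 + t) * (1 + C * t) ^+ 2) = k j.+1 * (c j * (1 + C * t)) ^+ 2.
    by rewrite kj; ring.
  by rewrite /kap ler_pM2l.
- move=> X; pose N := (Num.truncn (`|X| / (k0 * t * a ^+ 2))).+1; exists N.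
  apply: le_trans (kap_ge N); apply: le_trans (ler_norm _) _.
  have d0 : 0 < k0 * t * a ^+ 2 by rewrite !mulr_gt0// exprn_gt0.
  have : `|X| / (k0 * t * a ^+ 2) <= N%:R by rewrite ltW// truncnS_gt.
  rewrite ler_pdivrMr// => h1; apply: le_trans h1 _.
  have h2 : N%:R * t <= (1 + t) ^+ N.
    by have := bernoulli N (ltW t0); lra.
  have := ler_wpM2l (ltW (mulr_gt0 k00 (exprn_gt0 2 a0))) h2.
  by rewrite /k; lra.
Qed.

(** The predecessor of the first index with xi <= kappa_j works (or that index
    itself, if it is 0). *)
Lemma geometric_cover (kap : nat -> R) (theta xi : R) (N : nat) : 0 <= theta ->
  (forall j, 0 < kap j) -> (forall j, kap j.+1 <= (1 + theta) * kap j) ->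
  kap 0%N <= xi <= kap N -> exists2 j, (j <= N)%N & `|xi / kap j - 1| <= theta.
Proof.
move=> th0 kp kstep /andP[xi0]; elim: N => [|N IH] xiN.
  exists 0%N => //; have -> : xi = kap 0%N by apply/eqP; rewrite eq_le xiN xi0.
  by rewrite mulfV ?gt_eqF// subrr normr0.
have [/IH[j jN H]|lt] := leP xi (kap N); first by exists j => //; exact: leqW.
exists N => //; have h1 := le_trans xiN (kstep N).
have h2 : 1 <= xi / kap N by rewrite ler_pdivlMr// mul1r ltW.
have h3 : xi / kap N <= 1 + theta by rewrite ler_pdivrMr.
by rewrite ler_norml; apply/andP; split; lra.
Qed.

Lemma finite_compact_min (T : topologicalType) (K : set T) (Phi : nat -> T -> R) (N : nat) :
  K !=set0 -> compact K -> (forall j, {within K, continuous (Phi j)}) ->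
  exists j z, [/\ (j <= N)%N, K z & forall i w, (i <= N)%N -> K w -> Phi j z <= Phi i w].
Proof.
move=> K0 cK cPhi; elim: N => [|N [j [z [jN Kz H]]]].
  have [z zK H] := compact_EVT_min K0 cK (cPhi 0%N).
  exists 0%N, z; split => //; first by rewrite inE in zK.
  by move=> i w; rewrite leqn0 => /eqP -> Kw; apply: H; rewrite inE.
have [z' zK' H'] := compact_EVT_min K0 cK (cPhi N.+1).
have [le|lt] := leP (Phi j z) (Phi N.+1 z').
  exists j, z; split => //; first exact: leqW.
  move=> i w; rewrite leq_eqVlt => /orP[/eqP -> Kw|]; last by rewrite ltnS; exact: H.
  by apply: le_trans le _; apply: H'; rewrite inE.
exists N.+1, z'; split => //; first by rewrite inE in zK'.
move=> i w; rewrite leq_eqVlt => /orP[/eqP -> Kw|iN Kw]; first by apply: H'; rewrite inE.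
by apply: le_trans (ltW lt) _; exact: H.
Qed.

End ProfileFamily.

Section WaveMinimum.
Context {R : realType} {n : nat}.
Implicit Types (g A V : R -> R) (u : 'rV[R]_n * R -> R).

(** The consequence of [transformed_touch] at a minimum of the penalised function.
    The penalty changes the gradient by the factor 1 + tau and the second
    derivatives by the last two error terms on the left, which are small with D. *)
Lemma wave_minimum (s D eps k r M B kap kap0 lam t1 y c beta tau : R) g V A u
    (z : 'rV[R]_n * R) (y0 : 'rV[R]_n) :
  (s = 1 \/ s = -1) -> 0 <= D -> 0 < eps -> 0 < k -> wave_profile g k V ->
  (forall s : R, is_derive s 1 A (V s)^-1) ->
  twice_derivable u -> open_half z ->
  dt u z - D * (\sum_i 'D_(xdir i) ('D_(xdir i) u) z) = g (u z / eps) ->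
  0 < r -> r <= 1 -> 0 < M -> 0 < B -> y = u z / eps -> c = harmonic_avg V ->
  kap = k * c ^+ 2 ->
  let xi (w : 'rV[R]_n * R) := D / eps * (4 * M ^+ 2) * sqn (w.1 - y0) + kap0 in
  let Phi (w : 'rV[R]_n * R) := s * wave_coordinate V A eps (u w)
    + M * sqn (w.1 - y0) - s * lam * (w.2 - t1) + M * (w.2 - t1) ^+ 2
    + eps * (B * (xi w / kap - 1) ^+ 2) in
  (forall i (x : R), `|x| < r -> Phi z <= Phi (z + x *: xdir i)) ->
  (forall x : R, `|x| < r -> Phi z <= Phi (z + x *: tdir)) ->
  beta = xi z / kap - 1 -> tau = 8 * B * beta * M * D / kap ->
  s * c * ((xi z - kap0) * (1 + tau) ^+ 2 / kap * ((V y - g y) / V y) + g y / V y)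
    - 2 * D * (n%:R * M) - 32 * B * M ^+ 2 * D ^+ 2 * (xi z - kap0) / kap ^+ 2
    - 16 * n%:R * B * M ^+ 2 * D ^+ 2 * `|beta| / kap
   <= s * lam - 2 * M * (z.2 - t1).
Proof.
move=> s1 D0 eps0 k0 wV dA ru oz eqn r0 r1 M0 B0 yE cE kapE xi Phi Hx Ht betaE tauE.
have [pV V0 _] := wV; have cV := profile_continuous wV.
have c0 : 0 < c by rewrite cE; exact: harmonic_avg_gt0.
have kap_gt0 : 0 < kap by rewrite kapE mulr_gt0// exprn_gt0.
have ss : s * s = 1 by case: s1 => ->; rewrite ?mulrNN mulr1.
pose h := sqn (z.1 - y0); have h0 : 0 <= h by exact: sqn_ge0.
have [b2 b2E] : exists b2 : R, b2 = D / eps * (4 * M ^+ 2) / kap by eexists.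
have b20 : 0 <= b2 by rewrite b2E !mulr_ge0 ?invr_ge0 ?exprn_ge0// ltW.
pose d i := z.1 0 i - y0 0 i.
have hd : h = \sum_i d i ^+ 2 by apply: eq_bigr => i _; rewrite !mxE.
pose q i := - 2 * s * M * d i * (1 + tau).
pose m i := M + eps * B * (4 * d i ^+ 2 * b2 ^+ 2 + 2 * `|beta| * b2).
pose C := M + eps * B * (\sum_i (4 * `|d i| * b2 ^+ 2) + b2 ^+ 2).
have bnn : 0 <= \sum_i (4 * `|d i| * b2 ^+ 2).
  by apply: sumr_ge0 => i _; rewrite mulr_ge0 ?sqr_ge0// mulr_ge0.
have eB : 0 < eps * B by rewrite mulr_gt0.
have tauE2 : M * tau = 2 * eps * B * beta * b2.
  by rewrite tauE b2E; field; rewrite !gt_eqF.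
have xiz : xi z = D / eps * (4 * M ^+ 2) * h + kap0 by [].
have aqE : s * (s * lam - 2 * M * (z.2 - t1)) = lam - 2 * s * M * (z.2 - t1).
  by rewrite mulrBr mulrA ss; ring.
have X : forall i (x : R), `|x| < r ->
   s * (wave_coordinate V A eps (u (z + x *: xdir i)) - wave_coordinate V A eps (u z)) >=
    s * q i * x - m i * x ^+ 2 - C * `|x| ^+ 3.
  move=> i x xr; have := Hx i x xr; rewrite /Phi.
  have zi : (z + x *: xdir i).2 = z.2 by rewrite xdir_shift.
  have hi : sqn ((z + x *: xdir i).1 - y0) = h + 2 * d i * x + x ^+ 2.
    by rewrite xdir_shift /= addrAC sqn_shift !mxE.
  have bi : xi (z + x *: xdir i) / kap - 1 = beta + 2 * d i * b2 * x + b2 * x ^+ 2.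
    by rewrite betaE /xi hi -/h b2E; field; rewrite !gt_eqF.
  rewrite zi hi bi -betaE -/h => H.
  have absx : x ^+ 3 <= `|x| ^+ 3 /\ - `|x| ^+ 3 <= x ^+ 3.
    by rewrite -normrX; split; [exact: ler_norm|rewrite lerNl -normrN ler_norm].
  have x4 : x ^+ 4 <= `|x| ^+ 3.
    have -> : x ^+ 4 = `|x| ^+ 4 by rewrite -normrX ger0_norm// (exprM x 2 2) sqr_ge0.
    rewrite [leLHS]exprSr ler_piMr ?exprn_ge0//; exact: le_trans (ltW xr) r1.
  have dx3 : d i * x ^+ 3 <= `|d i| * `|x| ^+ 3.
    by rewrite -normrX -normrM ler_norm.
  have sq_i : s * q i = - 2 * M * d i - 2 * (M * tau) * d i.
    have -> : s * q i = (s * s) * (- 2 * M * d i * (1 + tau)) by rewrite /q; ring.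
    by rewrite ss; ring.
  have di_le : 4 * `|d i| * b2 ^+ 2 <= \sum_i (4 * `|d i| * b2 ^+ 2).
    rewrite (bigD1 i)//= lerDl; apply: sumr_ge0 => j _.
    by rewrite mulr_ge0 ?sqr_ge0// mulr_ge0.
  have bb : beta <= `|beta| by exact: ler_norm.
  have x2 : 0 <= x ^+ 2 by exact: sqr_ge0.
  have x3 : 0 <= `|x| ^+ 3 by rewrite exprn_ge0.
  (* expansion of the square of a quadratic polynomial *)
  have expand : (beta + 2 * d i * b2 * x + b2 * x ^+ 2) ^+ 2 - beta ^+ 2 =
     4 * beta * b2 * d i * x + (4 * d i ^+ 2 * b2 ^+ 2 + 2 * beta * b2) * x ^+ 2
     + 4 * b2 ^+ 2 * (d i * x ^+ 3) + b2 ^+ 2 * x ^+ 4 by ring.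
  have up : (beta + 2 * d i * b2 * x + b2 * x ^+ 2) ^+ 2 - beta ^+ 2 <=
     4 * beta * b2 * d i * x + (4 * d i ^+ 2 * b2 ^+ 2 + 2 * `|beta| * b2) * x ^+ 2
     + (\sum_i (4 * `|d i| * b2 ^+ 2) + b2 ^+ 2) * `|x| ^+ 3.
    rewrite expand.
    have e1 : 2 * beta * b2 * x ^+ 2 <= 2 * `|beta| * b2 * x ^+ 2.
      by rewrite !ler_wpM2r// ler_wpM2l.
    have e2 : 4 * b2 ^+ 2 * (d i * x ^+ 3) <= 4 * b2 ^+ 2 * (`|d i| * `|x| ^+ 3).
      by rewrite ler_wpM2l// mulr_ge0// exprn_ge0.
    have e3 : b2 ^+ 2 * x ^+ 4 <= b2 ^+ 2 * `|x| ^+ 3 by rewrite ler_wpM2l// exprn_ge0.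
    have e4 := ler_wpM2r x3 di_le.
    by move: e1 e2 e3 e4; rewrite !mulrDl; clear; lra.
  have up' := ler_wpM2l (ltW eB) up.
  have Mx : 0 <= M * `|x| ^+ 3 by rewrite mulr_ge0// ltW.
  rewrite sq_i tauE2 /m /C; move: H up' Mx.
  move: (\sum_i _) (wave_coordinate V A eps (u _)) (wave_coordinate V A eps (u _)) => S1 W1 W2.
  rewrite !mulrDl !mulrDr; clear; lra.
have T : forall x : R, `|x| < r ->
   s * (wave_coordinate V A eps (u (z + x *: tdir)) - wave_coordinate V A eps (u z)) >=
    s * (lam - 2 * s * M * (z.2 - t1)) * x - C * x ^+ 2.
  move=> x xr; have := Ht x xr; rewrite /Phi.
  have -> : xi (z + x *: tdir) = xi z by rewrite /xi tdir_shift.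
  rewrite tdir_shift /= => H.
  have x2 : 0 <= eps * B * (\sum_i (4 * `|d i| * b2 ^+ 2) + b2 ^+ 2) * x ^+ 2.
    by rewrite mulr_ge0 ?sqr_ge0// mulr_ge0 ?(ltW eB)// addr_ge0// exprn_ge0.
  have -> : s * (lam - 2 * s * M * (z.2 - t1)) * x = s * lam * x - (s * s) * (2 * M * (z.2 - t1)) * x by ring.
  rewrite ss /C; move: H x2; move: (\sum_i _) => S1; lra.
have := @transformed_touch R n s D eps k (lam - 2 * s * M * (z.2 - t1)) C r g V A u z q m
  s1 D0 eps0 k0 wV dA ru oz eqn r0 X T y c yE cE.
have sumq : \sum_i q i ^+ 2 = 4 * M ^+ 2 * (1 + tau) ^+ 2 * h.
  rewrite hd mulr_sumr; apply: eq_bigr => i _.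
  have -> : q i ^+ 2 = (s * s) * (4 * M ^+ 2 * (1 + tau) ^+ 2 * d i ^+ 2) by rewrite /q; ring.
  by rewrite ss mul1r.
have summ : \sum_i m i = n%:R * M + eps * B * (4 * h * b2 ^+ 2 + n%:R * (2 * `|beta| * b2)).
  have -> : \sum_i m i = \sum_(i < n) ((M + eps * B * (2 * `|beta| * b2)) + (eps * B * 4 * b2 ^+ 2) * d i ^+ 2).
    by apply: eq_bigr => i _; rewrite /m; ring.
  rewrite big_split /= sumr_const card_ord -mulr_sumr -hd -[X in X + _]mulr_natl; ring.
have sa : s * (lam - 2 * s * M * (z.2 - t1)) = s * lam - 2 * M * (z.2 - t1).
  have -> : s * (lam - 2 * s * M * (z.2 - t1)) = s * lam - (s * s) * (2 * M * (z.2 - t1)) by ring.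
  by rewrite ss mul1r.
rewrite sa sumq summ -kapE.
have -> : D / eps * (4 * M ^+ 2 * (1 + tau) ^+ 2 * h) = (xi z - kap0) * (1 + tau) ^+ 2.
  by rewrite xiz; ring.
have e1 : 2 * D * (eps * B * (4 * h * b2 ^+ 2)) = 32 * B * M ^+ 2 * D ^+ 2 * (xi z - kap0) / kap ^+ 2.
  by rewrite xiz b2E; field; rewrite !gt_eqF.
have e2 : 2 * D * (eps * B * (n%:R * (2 * `|beta| * b2))) = 16 * n%:R * B * M ^+ 2 * D ^+ 2 * `|beta| / kap.
  by rewrite b2E; field; rewrite !gt_eqF.
have -> : 2 * D * (n%:R * M + eps * B * (4 * h * b2 ^+ 2 + n%:R * (2 * `|beta| * b2))) =
  2 * D * (n%:R * M) + 2 * D * (eps * B * (4 * h * b2 ^+ 2)) + 2 * D * (eps * B * (n%:R * (2 * `|beta| * b2))) by ring.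
rewrite e1 e2; lra.
Qed.

End WaveMinimum.

Section WaveBound.
Context {R : realType} {n : nat}.
Implicit Types (g A V : R -> R) (u U : 'rV[R]_n * R -> R).

Lemma sqn_sum_le (x y : 'rV[R]_n) : sqn x <= 2 * sqn (x + y) + 2 * sqn y.
Proof.
rewrite /sqn !mulr_sumr -big_split /=; apply: ler_sum => i _; rewrite mxE.
by have := sqr_ge0 (x 0 i + 2 * y 0 i); rewrite !expr2; lra.
Qed.

Definition dotv (p x : 'rV[R]_n) : R := \sum_i p 0 i * x 0 i.

(** A linear function plus a paraboloid is a paraboloid with another vertex. *)
Lemma sqn_center (s M : R) (p x x1 : 'rV[R]_n) : s * s = 1 -> 0 < M ->
  M * sqn (x - (x1 + (s / (2 * M)) *: p)) =
  M * sqn (x - x1) - s * dotv p (x - x1) + M * sqn (x1 - (x1 + (s / (2 * M)) *: p)).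
Proof.
move=> ss M0; rewrite /sqn /dotv !mulr_sumr -sumrB -big_split /=.
apply: eq_bigr => i _; rewrite !mxE.
have -> : M * (x 0 i - (x1 0 i + s / (2 * M) * p 0 i)) ^+ 2 =
  M * (x 0 i - x1 0 i) ^+ 2 - s * (p 0 i * (x 0 i - x1 0 i))
   + (s * s) * (M * (p 0 i / (2 * M)) ^+ 2) by field; rewrite gt_eqF.
have -> : M * (x1 0 i - (x1 0 i + s / (2 * M) * p 0 i)) ^+ 2 =
  (s * s) * (M * (p 0 i / (2 * M)) ^+ 2) by field; rewrite gt_eqF.
by [].
Qed.

Lemma square_le_abs (x y : R) : 0 <= y -> x ^+ 2 <= y ^+ 2 -> `|x| <= y.
Proof.
move=> y0 H; rewrite -(ger0_norm y0) -!sqrtr_sqr; exact: ler_wsqrtr.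
Qed.

(** The bracket in [wave_minimum] differs from 1 by two effects: the mismatch of
    the gradient with kappa_j, of relative size dl, and the offset kap0, which matters
    only for small k; but then V - g is itself of order k. *)
Lemma speed_error (b0 be tau K c k kap0 k0 G a b l dl : R) :
  0 < a -> a <= b -> 0 < c -> a <= c <= b -> 0 < k -> 0 < k0 -> 0 <= l -> 0 <= dl -> dl <= 1 / 2 ->
  `|be| <= dl -> `|tau| <= dl -> K = k * c ^+ 2 -> 0 <= kap0 -> kap0 <= k0 * b ^+ 2 ->
  `|G| <= (b - a) / a -> `|G| <= k * l * b / a ->
  b0 = K * (1 + be) ->
  c * `|((b0 - kap0) * (1 + tau) ^+ 2 / K - 1) * G| <=
    b * (5 * dl * ((b - a) / a) + 4 * (k0 * b ^+ 2 / a ^+ 2) * (l * b / a)).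
Proof.
move=> a0 ab c0 /andP[ca cb] kp k00 l0 dl0 dl2 hbe htau KE kap00 kapb G1 G2 b0E.
have b_gt0 : 0 < b by exact: lt_le_trans ab.
have K0 : 0 < K by rewrite KE mulr_gt0// exprn_gt0.
have E : ((b0 - kap0) * (1 + tau) ^+ 2 / K - 1) * G =
   (be * (1 + tau) ^+ 2 + (2 * tau + tau ^+ 2)) * G - kap0 / K * (1 + tau) ^+ 2 * G.
  by rewrite b0E; field; rewrite gt_eqF.
have /andP[t1 t2] : - dl <= tau <= dl by rewrite -ler_norml.
have sq : (1 + tau) ^+ 2 <= 9 / 4.
  have : (1 + tau) * (1 + tau) <= (3 / 2) * (3 / 2) by rewrite ler_pM//; clear - t1 t2 dl2 dl0; lra.
  by rewrite expr2; lra.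
have sq0 : 0 <= (1 + tau) ^+ 2 by exact: sqr_ge0.
have h1 : `|be * (1 + tau) ^+ 2 + (2 * tau + tau ^+ 2)| <= 5 * dl.
  apply: le_trans (ler_normD _ _) _.
  have e1 : `|be * (1 + tau) ^+ 2| <= dl * (9 / 4) by rewrite normrM (ger0_norm sq0) ler_pM.
  have e2 : `|2 * tau + tau ^+ 2| <= dl * (5 / 2).
    have -> : 2 * tau + tau ^+ 2 = tau * (2 + tau) by ring.
    rewrite normrM ler_pM// ger0_norm; lra.
  lra.
have h2 : `|kap0 / K * (1 + tau) ^+ 2 * G| <= 4 * (k0 * b ^+ 2 / a ^+ 2) * (l * b / a).
  rewrite normrM; have nn : 0 <= kap0 / K * (1 + tau) ^+ 2 by rewrite mulr_ge0// divr_ge0// ltW.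
  rewrite (ger0_norm nn); apply: le_trans (ler_wpM2l nn G2) _.
  have -> : kap0 / K * (1 + tau) ^+ 2 * (k * l * b / a) = (kap0 / c ^+ 2 * (1 + tau) ^+ 2) * (l * b / a).
    by rewrite KE; field; rewrite !gt_eqF.
  rewrite ler_wpM2r ?mulr_ge0 ?invr_ge0 ?(ltW a0) ?(ltW b_gt0)//.
  have e1 : kap0 / c ^+ 2 <= k0 * b ^+ 2 / a ^+ 2.
    apply: ler_pM => //; first by rewrite invr_ge0 exprn_ge0// ltW.
    rewrite lef_pV2 ?posrE ?exprn_gt0// !expr2.
    by apply: ler_pM => //; exact: ltW.
  have e0 : 0 <= kap0 / c ^+ 2 by rewrite divr_ge0// exprn_ge0// ltW.
  have := ler_pM e0 sq0 e1 sq.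
  have q0 : 0 <= k0 * b ^+ 2 / a ^+ 2.
    by apply: mulr_ge0; rewrite ?invr_ge0 ?exprn_ge0 ?(ltW a0)// mulr_ge0 ?exprn_ge0 ?(ltW b_gt0)// ltW.
  lra.
rewrite E; apply: ler_pM => //; first exact: ltW.
apply: le_trans (ler_normB _ _) _; apply: lerD => //.
by rewrite normrM ler_pM.
Qed.

(** The minimum over a box and over the profiles.  The offset kap0 in xi keeps
    the required kappa away from 0, so that a profile exists even where the gradient
    vanishes.  Since some profile of the family makes the penalty at most eps and all
    S_j differ from the identity by at most eps, the minimum is close to the contact
    point and its penalty is bounded by 4 eps, which forces kappa_j to be within a
    factor 1 + dl of the actual gradient. *)
Lemma wave_bound_fixed (s D eps eta a b l M lam om r nu k0 dl : R) g U u
    (x1 p : 'rV[R]_n) (t1 : R) (kf kapf : nat -> R) (Vf : nat -> R -> R) :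
  (s = 1 \/ s = -1) -> 0 < a -> (forall y, a <= g y <= b) -> 0 <= l ->
  (forall x y, `|g x - g y| <= l * `|x - y|) -> continuous g -> periodic g 1 ->
  0 <= D -> D <= 1 -> 0 < eps -> 0 < eta -> 1 <= M ->
  0 < r -> r <= 1 -> 0 < t1 - r -> 0 < nu -> nu <= r / 2 -> 2 * M * nu <= eta / 4 ->
  0 < dl -> dl <= 1 / 2 -> 0 < k0 ->
  kf 0%N = k0 -> (forall j, 0 < kf j /\ wave_profile g (kf j) (Vf j)) ->
  (forall j, kapf j = kf j * harmonic_avg (Vf j) ^+ 2) ->
  (forall j, k0 * a ^+ 2 <= kapf j /\ kapf j.+1 <= (1 + dl / 2) * kapf j) ->
  (forall X : R, exists N, X <= kapf N) ->
  {within closed_half, continuous U} -> twice_derivable U ->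
  (forall z, open_half z ->
    dt U z - D * (\sum_i 'D_(xdir i) ('D_(xdir i) U) z) = g (U z / eps)) ->
  let K := box x1 r (t1 - r) (t1 + r) in
  (forall w, K w -> `|U w - u w| <= om) ->
  2 * om + 3 * eps <= nu ^+ 2 ->
  8 * (4 / dl ^+ 2) * M * D <= k0 * a ^+ 2 ->
  D * (2 * n%:R * M + (64 + 16 * n%:R) * (4 / dl ^+ 2) * M ^+ 2 / (k0 * a ^+ 2)) <= eta / 4 ->
  b * (5 * dl * ((b - a) / a) + 4 * (k0 * b ^+ 2 / a ^+ 2) * (l * b / a)) <= eta / 2 ->
  (forall w, K w -> - (M - 1) * (sqn (w.1 - x1) + (w.2 - t1) ^+ 2) <=
     s * (u w - u (x1, t1) - dotv p (w.1 - x1) - lam * (w.2 - t1))) ->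
  exists (j : nat) (z : 'rV[R]_n * R), [/\ s * harmonic_avg (Vf j) - eta <= s * lam,
    sqn (z.1 - x1) <= nu ^+ 2 &
    D / eps * (4 * M ^+ 2) * sqn (z.1 - (x1 + (s / (2 * M)) *: p)) <= 2 * kapf j].
Proof.
move=> s1 a0 gab l0 gl cg pg D0 D1 eps0 eta0 M1 r0 r1 t1r nu0 nur Mnu dl0 dl2 k00
  kf0 prof kapE kaps kapinf cU rU eqn K Uu omnu Dsmall Dsmall2 errs touch.
have ab : a <= b by have /andP[] := gab 0; exact: le_trans.
have b0 : 0 < b by exact: lt_le_trans ab.
have ss : s * s = 1 by case: s1 => ->; rewrite ?mulrNN mulr1.
have sle x y e : `|x - y| <= e -> s * x <= s * y + e.
  by rewrite ler_norml; case: s1 => ->; clear; lra.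
have M0 : 0 < M by exact: lt_le_trans M1.
have [B BE] : exists B : R, B = 4 / dl ^+ 2 by eexists.
have B0 : 0 < B by rewrite BE divr_gt0// exprn_gt0.
have Bdl : B * dl ^+ 2 = 4 by rewrite BE divfK// gt_eqF// exprn_gt0.
set y0 := x1 + (s / (2 * M)) *: p.
pose xi (w : 'rV[R]_n * R) := D / eps * (4 * M ^+ 2) * sqn (w.1 - y0) + kapf 0%N.
have De : 0 <= D / eps * (4 * M ^+ 2) by rewrite !mulr_ge0 ?invr_ge0 ?exprn_ge0// ltW.
have kap_ge j : k0 * a ^+ 2 <= kapf j by have [] := kaps j.
have km0 : 0 < k0 * a ^+ 2 by rewrite mulr_gt0// exprn_gt0.
have kap0 j : 0 < kapf j by exact: lt_le_trans (kap_ge j).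
(* primitives of the reciprocals of the profiles *)
have exA j : exists A, forall x : R, is_derive x 1 A (Vf j x)^-1.
  have [_ wV] := prof j; have [_ V0 _] := wV.
  exact: primitive_exists (continuous_inv (profile_continuous wV) V0).
pose Af j := sval (cid (exA j)).
have dAf j : forall x : R, is_derive x 1 (Af j) (Vf j x)^-1 by rewrite /Af; case: cid.
pose S j y := wave_coordinate (Vf j) (Af j) eps y.
have Sclose j y : `|S j y - y| <= eps.
  have [_ wV] := prof j; have [pV V0 _] := wV.
  exact: (wave_coordinate_close y eps0 pV (profile_continuous wV) V0 (dAf j)).
pose Phi j (w : 'rV[R]_n * R) := s * S j (U w)
    + M * sqn (w.1 - y0) - s * lam * (w.2 - t1) + M * (w.2 - t1) ^+ 2
    + eps * (B * (xi w / kapf j - 1) ^+ 2).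
have K0 : K (x1, t1).
  by split => /=; [move=> i; rewrite subrr normr0 ltW|apply/andP; split; clear - r0; lra].
have Kne : K !=set0 by exists (x1, t1).
have cK : compact K by exact: box_compact.
have Koh : K `<=` open_half.
  by move=> w [_ /andP[h _]]; exact: lt_le_trans h.
have Kch : K `<=` closed_half by move=> w /Koh; exact: ltW.
have csq : continuous (fun w : 'rV[R]_n * R => sqn (w.1 - y0)) by exact: sqn_continuous.
have cxi : continuous xi.
  move=> w; apply: cvgD; last exact: cvg_cst.
  by apply: cvgM; [exact: cvg_cst|exact: csq].
have cPhi j : {within K, continuous (Phi j)}.
  have c1 : {within K, continuous (fun w => S j (U w))}.
    have cUK := continuous_subspaceW Kch cU.
    move=> w; apply: (@continuous_comp _ _ _ (U : subspace K -> R) (S j)); first exact: cUK.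
    by apply: is_derive_continuous (wave_coordinate_derive _ eps0 (dAf j)).
  have c2 : continuous (fun w : 'rV[R]_n * R => M * sqn (w.1 - y0) - s * lam * (w.2 - t1)
      + M * (w.2 - t1) ^+ 2 + eps * (B * (xi w / kapf j - 1) ^+ 2)).
    move=> w.
    have c3 : (w.2 - t1) @[w --> w] --> w.2 - t1 by apply: cvgB; [exact: cvg_snd|exact: cvg_cst].
    have c4 : (xi w / kapf j - 1) @[w --> w] --> xi w / kapf j - 1.
      by apply: cvgB; [apply: cvgM; [exact: cxi|exact: cvg_cst]|exact: cvg_cst].
    apply: cvgD; last by apply: cvgM; [exact: cvg_cst|apply: cvgM; [exact: cvg_cst|apply: cvgM; exact: c4]].
    apply: cvgD; last by apply: cvgM; [exact: cvg_cst|apply: cvgM; exact: c3].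
    apply: cvgB; first by apply: cvgM; [exact: cvg_cst|exact: csq].
    by apply: cvgM; [exact: cvg_cst|exact: c3].
  have -> : Phi j = (fun w => s * S j (U w) + (M * sqn (w.1 - y0) - s * lam * (w.2 - t1)
      + M * (w.2 - t1) ^+ 2 + eps * (B * (xi w / kapf j - 1) ^+ 2))).
    by apply/funext => w; rewrite /Phi; ring.
  move=> w; apply: cvgD; first by apply: cvgM; [exact: cvg_cst|exact: c1].
  exact: (continuous_subspaceT c2).
have [zm _ zmax] := compact_EVT_max Kne cK (continuous_subspaceT csq).
have [N HN] := kapinf (xi zm).
have xiN w : K w -> kapf 0%N <= xi w <= kapf N.
  move=> Kw; apply/andP; split; first by rewrite lerDr mulr_ge0// sqn_ge0.
  by apply: le_trans HN; rewrite lerD2r ler_wpM2l// zmax// inE.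
have [j [z [jN Kz zmin]]] := finite_compact_min N Kne cK cPhi.
have cover w : K w -> exists2 i, (i <= N)%N & B * (xi w / kapf i - 1) ^+ 2 <= 1.
  move=> Kw; have [i iN Hi] := geometric_cover (ltW (divr_gt0 dl0 (ltr0n R 2)))
    kap0 (fun j => (kaps j).2) (xiN w Kw).
  exists i => //; have : (xi w / kapf i - 1) ^+ 2 <= (dl / 2) ^+ 2.
    by rewrite -real_normK ?num_real// !expr2 ler_pM.
  by move=> /(ler_wpM2l (ltW B0)); have := Bdl; rewrite !expr2; clear; lra.
have pen0 i w : 0 <= eps * (B * (xi w / kapf i - 1) ^+ 2).
  by apply: mulr_ge0; [exact: ltW|apply: mulr_ge0; [exact: ltW|exact: sqr_ge0]].
(* the minimum point is close to the touching point *)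
have zclose : sqn (z.1 - x1) + (z.2 - t1) ^+ 2 <= nu ^+ 2.
  have [i iN Hi] := cover _ K0.
  have H1 := zmin i (x1, t1) iN K0.
  have H2 := sqn_center p z.1 x1 ss M0; rewrite -/y0 in H2.
  have H3 := touch z Kz.
  have H4 := sle _ _ _ (Sclose i (U (x1, t1))).
  have H5 : s * U z <= s * S j (U z) + eps by apply: sle; rewrite distrC.
  have H6 := sle _ _ _ (Uu _ K0).
  have H7 : s * u z <= s * U z + om by apply: sle; rewrite distrC; exact: Uu.
  have H8 := pen0 j z.
  have H9 : eps * (B * (xi (x1, t1) / kapf i - 1) ^+ 2) <= eps by rewrite ler_piMr// ltW.
  move: H1; rewrite /Phi /= subrr expr0n /= !mulr0 subr0 addr0.
  move: H3 H2 H4 H5 H6 H7 H8 H9 omnu.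
  rewrite /Phi /=; move: (dotv _ _) (sqn (z.1 - x1)) (sqn (x1 - y0)) (sqn (z.1 - y0)).
  move=> d1 d2 d3 d4; move: (S i _) (S j _) (B * _) (B * _) => s2 s3 q1 q2; rewrite !mulrDr.
  clear; lra.
have beta_le : `|xi z / kapf j - 1| <= dl.
  have [i iN Hi] := cover _ Kz.
  have H1 := zmin i z iN Kz.
  have H2 : s * S i (U z) <= s * U z + eps by exact: sle (Sclose i _).
  have H3 : s * U z <= s * S j (U z) + eps by apply: sle; rewrite distrC.
  have H4 : eps * (B * (xi z / kapf i - 1) ^+ 2) <= eps by rewrite ler_piMr// ltW.
  have : eps * (B * (xi z / kapf j - 1) ^+ 2) <= eps * 4 by move: H1 H2 H3 H4 eps0; rewrite /Phi; clear; lra.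
  by rewrite ler_pM2l// -Bdl ler_pM2l// => /(square_le_abs (ltW dl0)).
have nuge : 0 <= (z.2 - t1) ^+ 2 by exact: sqr_ge0.
have sqz : sqn (z.1 - x1) <= nu ^+ 2 by apply: le_trans zclose; rewrite lerDl.
have coordz i : `|z.1 0 i - x1 0 i| <= nu.
  apply: (square_le_abs (ltW nu0)); apply: le_trans sqz.
  by have := coord_sq_le (z.1 - x1) i; rewrite !mxE.
have timez : `|z.2 - t1| <= nu.
  apply: (square_le_abs (ltW nu0)); apply: le_trans zclose.
  by rewrite lerDr sqn_ge0.
have r20 : 0 < r / 2 by rewrite divr_gt0.
have minx i (x : R) : `|x| < r / 2 -> Phi j z <= Phi j (z + x *: xdir i).
  move=> xr; apply: zmin => //; apply: box_shift => //.
    by apply: le_lt_trans (coordz i) _; clear - nur r0; lra.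
  have := coordz i; clear - nur xr; lra.
have mint (x : R) : `|x| < r / 2 -> Phi j z <= Phi j (z + x *: tdir).
  move=> xr; apply: zmin => //; rewrite tdir_shift; have [Kz1 _] := Kz; split => //=.
  by move: timez; rewrite ler_norml; move: xr; rewrite ltr_norml => /andP[x2 x3] /andP[x4 x5]; apply/andP; split; clear - nur x2 x3 x4 x5; lra.
have [kj0 wV] := prof j; have [pV V0 _] := wV; have Vb := profile_bounds kj0 gab wV.
set c := harmonic_avg (Vf j).
have cb : a <= c <= b.
  by have [y _] := harmonic_avg_attained (profile_continuous wV) V0; rewrite -/c => ->.
have c0 : 0 < c by have /andP[/(lt_le_trans a0)] := cb.
have oz := Koh _ Kz.
have kapc : kapf j = kf j * c ^+ 2 by rewrite kapE.
have r21 : r / 2 <= 1 by clear - r1; lra.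
have := @wave_minimum R n s D eps (kf j) (r / 2) M B (kapf j) (kapf 0%N) lam t1 (U z / eps) c
  (xi z / kapf j - 1) (8 * B * (xi z / kapf j - 1) * M * D / kapf j) g (Vf j) (Af j) U z y0
  s1 D0 eps0 kj0 wV (dAf j) rU oz (eqn z oz) r20 r21 M0 B0 erefl erefl kapc minx mint erefl erefl.
set be := xi z / kapf j - 1; set tau := 8 * B * be * M * D / kapf j.
rewrite -/(xi z).
set y := U z / eps => main.
have xiE : xi z = kapf j * (1 + be) by rewrite /be; field; rewrite gt_eqF.
have htau : `|tau| <= dl.
  have -> : tau = be * (8 * B * M * D / kapf j) by rewrite /tau; ring.
  rewrite normrM -[leRHS]mulr1 ler_pM// ger0_norm.
    by rewrite ler_pdivrMr// mul1r (le_trans _ (kap_ge j))// BE.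
  apply: mulr_ge0; last by rewrite invr_ge0 ltW.
  by apply: mulr_ge0 => //; apply: mulr_ge0; [apply: mulr_ge0 => //; exact: ltW|exact: ltW].
have kk0 : 0 <= kapf 0%N by exact: ltW.
have k0b : kapf 0%N <= k0 * b ^+ 2.
  have [q0 wV0] := prof 0%N; have [_ V00 _] := wV0.
  rewrite kapE kf0 ler_pM2l//.
  have [y' _ ->] := harmonic_avg_attained (profile_continuous wV0) V00.
  have /andP[h1 h2] := profile_bounds q0 gab wV0 y'.
  by rewrite !expr2 ler_pM// ltW.
have V0y := V0 y; have /andP[v1 v2] := Vb y; have /andP[g1 g2] := gab y.
have G1 : `|(Vf j y - g y) / Vf j y| <= (b - a) / a.
  rewrite normrM normfV (gtr0_norm V0y) ler_pM// ?invr_ge0 ?(ltW V0y)//.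
    by rewrite ler_norml; apply/andP; split; clear - v1 v2 g1 g2; lra.
  by rewrite lef_pV2.
have G2 : `|(Vf j y - g y) / Vf j y| <= kf j * l * b / a.
  rewrite normrM normfV (gtr0_norm V0y) ler_pM// ?invr_ge0 ?(ltW V0y)//.
    exact: (profile_close kj0 a0 gab gl pg cg wV).
  by rewrite lef_pV2.
have err := speed_error a0 ab c0 cb kj0 k00 l0 (ltW dl0) dl2 beta_le htau kapc kk0 k0b G1 G2 xiE.
set G := (Vf j y - g y) / Vf j y in main G1 G2 err.
have gV : g y / Vf j y = 1 - G by rewrite /G; field; rewrite gt_eqF.
set X := (xi z - kapf 0%N) * (1 + tau) ^+ 2 / kapf j in main err.
have sc : s * c - c * `|(X - 1) * G| <= s * c * (X * G + g y / Vf j y).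
  rewrite gV; have -> : s * c * (X * G + (1 - G)) = s * c + c * (s * ((X - 1) * G)) by ring.
  rewrite lerD2l -mulrN ler_wpM2l ?(ltW c0)//.
  rewrite lerNl -mulNr; case: s1 => ->; rewrite ?opprK ?mul1r ?mulN1r ?ler_norm//.
  by rewrite -normrN ler_norm.
have xik : xi z / kapf j <= 3 / 2.
  by move: beta_le; rewrite -/be ler_norml /be => /andP[_ h]; clear - h dl2; lra.
have kapi : (kapf j)^-1 <= (k0 * a ^+ 2)^-1 by rewrite lef_pV2 ?posrE.
have kapi0 : 0 <= (kapf j)^-1 by rewrite invr_ge0 ltW.
have DD : D ^+ 2 <= D by rewrite expr2 ler_piMr.
have BM0 : 0 <= B * M ^+ 2 by rewrite mulr_ge0 ?exprn_ge0// ltW.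
have xi0 : 0 <= xi z - kapf 0%N by rewrite subr_ge0; have /andP[] := xiN _ Kz.
have q0 : 0 <= (k0 * a ^+ 2)^-1 by rewrite invr_ge0 ltW.
have nn : 0 <= n%:R :> R by [].
have P1 : 32 * B * M ^+ 2 * D ^+ 2 * (xi z - kapf 0%N) / kapf j ^+ 2 <=
    64 * B * M ^+ 2 * D / (k0 * a ^+ 2).
  have -> : 32 * B * M ^+ 2 * D ^+ 2 * (xi z - kapf 0%N) / kapf j ^+ 2 =
    (32 * (B * M ^+ 2) * D ^+ 2) * (((xi z - kapf 0%N) / kapf j) * (kapf j)^-1).
    by field; rewrite gt_eqF.
  have -> : 64 * B * M ^+ 2 * D / (k0 * a ^+ 2) =
    (32 * (B * M ^+ 2) * D) * (2 * (k0 * a ^+ 2)^-1) by ring.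
  apply: ler_pM.
  - by rewrite mulr_ge0 ?sqr_ge0// mulr_ge0.
  - by rewrite mulr_ge0// mulr_ge0.
  - by rewrite ler_wpM2l// mulr_ge0.
  - apply: ler_pM => //; first by rewrite mulr_ge0.
    have : kapf 0%N / kapf j >= 0 by rewrite mulr_ge0.
    by move: xik; rewrite mulrBl; clear; lra.
have P2 : 16 * n%:R * B * M ^+ 2 * D ^+ 2 * `|be| / kapf j <=
    16 * n%:R * B * M ^+ 2 * D / (k0 * a ^+ 2).
  have -> : 16 * n%:R * B * M ^+ 2 * D ^+ 2 * `|be| / kapf j =
    (16 * n%:R * (B * M ^+ 2)) * (D ^+ 2 * (`|be| * (kapf j)^-1)) by ring.
  have -> : 16 * n%:R * B * M ^+ 2 * D / (k0 * a ^+ 2) =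
    (16 * n%:R * (B * M ^+ 2)) * (D * (1 * (k0 * a ^+ 2)^-1)) by ring.
  apply: ler_wpM2l; first by rewrite mulr_ge0// mulr_ge0.
  apply: ler_pM; rewrite ?sqr_ge0 ?mulr_ge0//.
  by apply: ler_pM => //; apply: le_trans beta_le _; clear - dl2; lra.
have Dexp : D * (2 * n%:R * M + (64 + 16 * n%:R) * (4 / dl ^+ 2) * M ^+ 2 / (k0 * a ^+ 2)) =
  2 * D * (n%:R * M) + 64 * B * M ^+ 2 * D / (k0 * a ^+ 2) + 16 * n%:R * B * M ^+ 2 * D / (k0 * a ^+ 2).
  by rewrite -BE; ring.
rewrite Dexp in Dsmall2.
have tz : - (2 * M * (z.2 - t1)) <= 2 * M * nu.
  rewrite -mulrN ler_wpM2l//; first by rewrite mulr_ge0// ltW.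
  by move: timez; rewrite ler_norml lerNl => /andP[].
exists j, z; split => //.
- by move: main sc err P1 P2 Dsmall2 errs tz Mnu; rewrite -/c; clear; lra.
- have h : xi z <= 3 / 2 * kapf j by rewrite -ler_pdivrMr.
  have := kap0 0%N; have := kap0 j; move: h; rewrite /xi; clear; lra.
Qed.

End WaveBound.

(** * Passage to the limit *)

Section WaveLimit.
Context {R : realType} {n : nat}.
Implicit Types (g V : R -> R) (u : 'rV[R]_n * R -> R).

Lemma powR_small (be d : R) : 0 < be -> 0 < d ->
  exists2 e0 : R, 0 < e0 & forall e : R, 0 < e -> e <= e0 -> e `^ be <= d.
Proof.
move=> be0 d0; exists (d `^ be^-1); first exact: powR_gt0.
move=> e e0 ee; apply: (@le_trans _ _ ((d `^ be^-1) `^ be)).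
  by apply: ge0_ler_powR; rewrite ?nnegrE ?powR_ge0// ltW.
by rewrite -powRrM mulVf ?gt_eqF// powRr1// ltW.
Qed.

(** What is used of the approximate solutions along the sequence that
    defines the limit. *)
Definition wave_approximation (alpha : R) g (e : nat -> R)
    (U : nat -> 'rV[R]_n * R -> R) u :=
  [/\ forall k, 0 < e k,
      forall d : R, 0 < d -> exists N, forall k, (N <= k)%N -> e k <= d,
      forall k, {within closed_half, continuous (U k)} /\ twice_derivable (U k),
      forall k z, open_half z ->
        dt (U k) z - e k `^ alpha * (\sum_i 'D_(xdir i) ('D_(xdir i) (U k)) z) = g (U k z / e k) &
      forall K : set ('rV[R]_n * R), compact K -> K `<=` closed_half ->
        forall d : R, 0 < d -> exists N, forall k, (N <= k)%N -> forall z, K z -> `|U k z - u z| <= d].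

(** All parameters in [wave_bound_fixed] are chosen: first nu, dl and k0 from
    eta, then the index of the sequence.  When p is not 0 the gradient near
    the contact point is bounded away from 0, and D / eps = eps^(alpha - 1) makes k
    arbitrarily large. *)
Lemma wave_limit (alpha a b l s M lam r eta t1 : R) g e U u (x1 p : 'rV[R]_n) :
  0 < alpha < 1 -> 0 < a -> (forall y, a <= g y <= b) ->
  (forall x y, `|g x - g y| <= l * `|x - y|) -> continuous g -> periodic g 1 ->
  wave_approximation alpha g e U u ->
  (s = 1 \/ s = -1) -> 0 < t1 -> 0 < r -> 0 < eta ->
  (forall w : 'rV[R]_n * R, (forall i, `|w.1 0 i - x1 0 i| <= r) -> `|w.2 - t1| <= r ->
     - M * (sqn (w.1 - x1) + (w.2 - t1) ^+ 2) <=
     s * (u w - u (x1, t1) - dotv p (w.1 - x1) - lam * (w.2 - t1))) ->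
  exists k V, [/\ 0 < k, wave_profile g k V,
    s * harmonic_avg V - eta <= s * lam & p <> 0 -> eta^-1 <= k].
Proof.
move=> /andP[al0 al1] a0 gab gl cg pg [e0 elim UU Ueq Uconv] s1 t10 r0 eta0 touch.
have ab : a <= b by have /andP[] := gab 0; exact: le_trans.
have b0 : 0 < b by exact: lt_le_trans ab.
have ss : s * s = 1 by case: s1 => ->; rewrite ?mulrNN mulr1.
have l0 : 0 <= l by have := gl 0 1; rewrite sub0r normrN normr1 mulr1; apply: le_trans.
pose M1 := `|M| + 2; have M11 : 1 <= M1 by rewrite /M1; have := normr_ge0 M; lra.
have M10 : 0 < M1 by exact: lt_le_trans M11.
pose r' := Num.min (Num.min r 1) (t1 / 2).
have r'0 : 0 < r' by rewrite !lt_min r0 ltr01 divr_gt0.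
have r'r : r' <= r by rewrite !ge_min lexx.
have r'1 : r' <= 1 by rewrite !ge_min lexx orbT.
have r't : 0 < t1 - r' by have : r' <= t1 / 2 by [rewrite !ge_min lexx !orbT]; lra.
clearbody r'.
pose y0 := x1 + (s / (2 * M1)) *: p; pose h1 := sqn (x1 - y0).
have h1_pos : p <> 0 -> 0 < h1.
  move=> p0; rewrite lt_neqAle sqn_ge0 andbT; apply/eqP => h10; apply: p0.
  apply/rowP => i; rewrite mxE.
  have := coord_sq_le (x1 - y0) i; rewrite -/h1 -h10 => hi.
  have : (x1 - y0) 0 i = 0 by apply/eqP; rewrite -sqrf_eq0 eq_le hi sqr_ge0.
  rewrite !mxE opprD addrA subrr sub0r => /eqP; rewrite oppr_eq0 mulf_eq0 => /orP[|/eqP//].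
  rewrite mulf_eq0 invr_eq0 mulf_eq0 (gt_eqF M10) !orbF pnatr_eq0 orbF => /eqP s0.
  by move: ss; rewrite s0 mul0r => /eqP; rewrite eq_sym oner_eq0.
pose q1 : R := if p == 0 then 1 else h1 / 4.
have q10 : 0 < q1.
  rewrite /q1; case: eqP => // p0; by rewrite divr_gt0// h1_pos.
pose nu := Num.min (Num.min (r' / 2) (eta / (8 * M1))) (Num.sqrt q1).
have nu0 : 0 < nu by rewrite !lt_min sqrtr_gt0 q10 !divr_gt0// mulr_gt0.
have nur : nu <= r' / 2 by rewrite !ge_min lexx.
have nueta : 2 * M1 * nu <= eta / 4.
  have : nu <= eta / (8 * M1) by rewrite !ge_min lexx orbT.
  by rewrite ler_pdivlMr ?mulr_gt0//; lra.
have nuq : nu ^+ 2 <= q1.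
  have : nu <= Num.sqrt q1 by rewrite !ge_min lexx orbT.
  by move=> h; rewrite -(sqr_sqrtr (ltW q10)) !expr2 ler_pM// ltW.
clearbody nu.
pose dl := Num.min (1 / 2) (eta * a / (20 * b ^+ 2)).
have b2 : 0 < 20 * b ^+ 2 by rewrite mulr_gt0// exprn_gt0.
have dl0 : 0 < dl by rewrite lt_min !divr_gt0// mulr_gt0.
have dl2 : dl <= 1 / 2 by rewrite ge_min lexx.
have dlE : 20 * b ^+ 2 * dl <= eta * a.
  by rewrite mulrC -ler_pdivlMr// ge_min lexx orbT.
clearbody dl.
pose k0 := eta * a ^+ 3 / (16 * (l + 1) * b ^+ 4).
have k00 : 0 < k0 by rewrite divr_gt0 ?mulr_gt0 ?exprn_gt0// ltr_wpDl.
have errs : b * (5 * dl * ((b - a) / a) + 4 * (k0 * b ^+ 2 / a ^+ 2) * (l * b / a)) <= eta / 2.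
  have E1 : b * (5 * dl * ((b - a) / a)) <= eta / 4.
    have -> : b * (5 * dl * ((b - a) / a)) = 5 * dl * b * (b - a) / a by ring.
    rewrite ler_pdivrMr//.
    have : 5 * dl * b * (b - a) <= 5 * dl * b * b.
      by rewrite ler_wpM2l ?mulr_ge0 ?(ltW dl0) ?(ltW b0)//; lra.
    by move: dlE; rewrite expr2; lra.
  have E2 : b * (4 * (k0 * b ^+ 2 / a ^+ 2) * (l * b / a)) = eta / 4 * (l / (l + 1)).
    by rewrite /k0; field; rewrite !gt_eqF// ltr_wpDl.
  have E3 : l / (l + 1) <= 1 by rewrite ler_pdivrMr ?ltr_wpDl//; lra.
  have E4 : eta / 4 * (l / (l + 1)) <= eta / 4 by rewrite ler_piMr// divr_ge0// ltW.
  by rewrite mulrDr E2; lra.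
clearbody k0.
have th0 : 0 < dl / 2 by rewrite divr_gt0.
have [kf [kapf [Vf [kf0 prof kapE kaps kapinf]]]] := profile_family a0 k00 th0 gab cg pg.
have km0 : 0 < k0 * a ^+ 2 by rewrite mulr_gt0// exprn_gt0.
pose c1 := 8 * (4 / dl ^+ 2) * M1.
have c10 : 0 < c1 by rewrite !mulr_gt0// invr_gt0 exprn_gt0.
pose c2 := 2 * n%:R * M1 + (64 + 16 * n%:R) * (4 / dl ^+ 2) * M1 ^+ 2 / (k0 * a ^+ 2).
have c20 : 0 < c2.
  rewrite ltr_wpDl ?mulr_ge0// ?(ltW M10)// divr_gt0// mulr_gt0 ?exprn_gt0//.
  by rewrite mulr_gt0 ?ltr_wpDr ?mulr_ge0// divr_gt0// exprn_gt0.
have ial : 0 < 1 - alpha by rewrite subr_gt0.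
have [d1 d10 Hd1] := powR_small al0 ltr01.
have [d2 d20 Hd2] := powR_small al0 (divr_gt0 km0 c10).
have [d3 d30 Hd3] := powR_small al0 (divr_gt0 (divr_gt0 eta0 (ltr0n R 4)) c20).
pose Y := M1 ^+ 2 * h1 * eta / (2 * b ^+ 2).
have Y4 : 0 < (if p == 0 then 1 else Y).
  by case: eqP => // p0; rewrite !mulr_gt0 ?invr_gt0 ?exprn_gt0 ?h1_pos ?mulr_gt0 ?exprn_gt0.
have [d4 d40 Hd4] := powR_small ial Y4.
have nu20 : 0 < nu ^+ 2 by rewrite exprn_gt0.
have [N1 HN1] := elim d1 d10; have [N2 HN2] := elim d2 d20; have [N3 HN3] := elim d3 d30.
have [N4 HN4] := elim d4 d40.
have [N5 HN5] := elim (nu ^+ 2 / 6) (divr_gt0 nu20 (ltr0n R 6)).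
have Ksub : box x1 r' (t1 - r') (t1 + r') `<=` closed_half by apply: box_closed_half; exact: ltW.
have [N6 HN6] := Uconv _ (@box_compact R n x1 r' (t1 - r') (t1 + r')) Ksub (nu ^+ 2 / 4) (divr_gt0 nu20 (ltr0n R 4)).
pose k := (N1 + N2 + N3 + N4 + N5 + N6)%N.
have ek := e0 k; set eps := e k in ek *.
have D1 : eps `^ alpha <= 1 by apply: Hd1 => //; apply: HN1; rewrite /k -!addnA leq_addr.
have D2 : eps `^ alpha <= k0 * a ^+ 2 / c1.
  by apply: Hd2 => //; apply: HN2; rewrite /k; rewrite -!addnA addnCA leq_addr.
have D3 : eps `^ alpha <= eta / 4 / c2.
  by apply: Hd3 => //; apply: HN3; rewrite /k -!addnA !(addnCA _ N3) leq_addr.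
have D4 : eps `^ (1 - alpha) <= (if p == 0 then 1 else Y).
  by apply: Hd4 => //; apply: HN4; rewrite /k -!addnA !(addnCA _ N4) leq_addr.
have D5 : eps <= nu ^+ 2 / 6.
  by apply: HN5; rewrite /k -!addnA !(addnCA _ N5) leq_addr.
have kN6 : (N6 <= k)%N by rewrite /k leq_addl.
have [cU rU] := UU k.
have D0 : 0 <= eps `^ alpha by exact: powR_ge0.
have D2' : 8 * (4 / dl ^+ 2) * M1 * (eps `^ alpha) <= k0 * a ^+ 2.
  by move: D2; rewrite ler_pdivlMr// mulrC.
have D3' : (eps `^ alpha) * (2 * n%:R * M1 + (64 + 16 * n%:R) * (4 / dl ^+ 2) * M1 ^+ 2 / (k0 * a ^+ 2)) <= eta / 4.
  by move: D3; rewrite ler_pdivlMr.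
have omnu : 2 * (nu ^+ 2 / 4) + 3 * eps <= nu ^+ 2 by clear - D5; lra.
have touch' w : box x1 r' (t1 - r') (t1 + r') w ->
   - (M1 - 1) * (sqn (w.1 - x1) + (w.2 - t1) ^+ 2) <=
     s * (u w - u (x1, t1) - dotv p (w.1 - x1) - lam * (w.2 - t1)).
  move=> [Hx /andP[h2 h3]]; apply: le_trans (touch w _ _).
  - rewrite !mulNr lerN2 ler_wpM2r ?addr_ge0 ?sqn_ge0 ?sqr_ge0//.
    by apply: le_trans (ler_norm _) _; rewrite /M1; clear; lra.
  - by move=> i; exact: le_trans (Hx i) r'r.
  - by rewrite ler_norml; apply/andP; split; clear - h2 h3 r'r; lra.
have [j [z [H1 H2 H3]]] := @wave_bound_fixed R n s (eps `^ alpha) eps eta a b l M1 lam (nu ^+ 2 / 4) r' nu k0 dl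
  g (U k) u x1 p t1 kf kapf Vf s1 a0 gab l0 gl cg pg D0 D1 ek eta0 M11 r'0 r'1 r't nu0 nur nueta dl0 dl2 k00
  kf0 prof kapE kaps kapinf cU rU (Ueq k) (HN6 k kN6) omnu D2' D3' errs touch'.
have [kj0 wV] := prof j.
exists (kf j), (Vf j); split => // p0.
have [V0 cb] : (forall x, 0 < Vf j x) /\ harmonic_avg (Vf j) <= b.
  have [_ V0 _] := wV; split => //.
  have [y _ ->] := harmonic_avg_attained (profile_continuous wV) V0.
  by have /andP[] := profile_bounds kj0 gab wV y.
have c0 : 0 < harmonic_avg (Vf j) by apply: harmonic_avg_gt0; first exact: profile_continuous wV.
have kb : kapf j <= kf j * b ^+ 2.
  by rewrite kapE ler_pM2l// !expr2 ler_pM// ltW.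
have pn : (p == 0) = false by apply/eqP.
rewrite pn in D4; rewrite /q1 pn in nuq.
have hz : h1 / 4 <= sqn (z.1 - y0).
  have := sqn_sum_le (x1 - y0) (z.1 - x1).
  have -> : x1 - y0 + (z.1 - x1) = z.1 - y0 by rewrite addrC addrA subrK.
  by rewrite -/h1; move: H2 nuq; clear; lra.
have De : eps `^ alpha / eps = (eps `^ (1 - alpha))^-1.
  have : eps `^ alpha * eps `^ (1 - alpha) = eps.
    rewrite -powRD; first by rewrite addrC subrK powRr1// ltW.
    by apply/implyP => _; rewrite gt_eqF.
  move=> E; have p1 : 0 < eps `^ (1 - alpha) by exact: powR_gt0.
  apply: (mulIf (lt0r_neq0 p1)); rewrite mulVf ?gt_eqF// mulrAC E mulfV// gt_eqF//.
have h10 := h1_pos p0.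
have Y0 : 0 < Y by rewrite !mulr_gt0 ?invr_gt0 ?mulr_gt0 ?exprn_gt0.
have DY : Y^-1 <= eps `^ alpha / eps by rewrite De lef_pV2 ?posrE// powR_gt0.
have X1 : Y^-1 * (4 * M1 ^+ 2) * (h1 / 4) <= 2 * (kf j * b ^+ 2).
  apply: (@le_trans _ _ (2 * kapf j)); last by rewrite ler_wpM2l.
  apply: le_trans H3; apply: ler_pM => //.
  - by rewrite mulr_ge0 ?invr_ge0 ?(ltW Y0)// mulr_ge0 ?exprn_ge0// ltW.
  - by rewrite divr_ge0// ltW.
  - by rewrite ler_wpM2r// mulr_ge0 ?exprn_ge0// ltW.
have E : Y^-1 * (4 * M1 ^+ 2) * (h1 / 4) = eta^-1 * (2 * b ^+ 2).
  by rewrite /Y; field; rewrite !gt_eqF.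
have bb : 0 < 2 * b ^+ 2 by rewrite mulr_gt0 ?exprn_gt0.
by rewrite -(ler_pM2r bb) -E (le_trans X1)//; clear; lra.
Qed.

End WaveLimit.

(** * Viscosity inequalities for touching quadratics *)

Section ViscosityInequalities.
Context {R : realType} {n : nat}.
Implicit Types (g V : R -> R) (u : 'rV[R]_n * R -> R).

(** The speed of every profile is at least the harmonic average, and it tends to
    the arithmetic average as k tends to infinity. *)
Lemma limit_supersolution (alpha a b l M lam r t1 : R) g e U u (x1 p : 'rV[R]_n) :
  0 < alpha < 1 -> 0 < a -> (forall y, a <= g y <= b) ->
  (forall x y, `|g x - g y| <= l * `|x - y|) -> continuous g -> periodic g 1 ->
  wave_approximation alpha g e U u -> 0 < t1 -> 0 < r ->
  (forall w : 'rV[R]_n * R, (forall i, `|w.1 0 i - x1 0 i| <= r) -> `|w.2 - t1| <= r ->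
     u (x1, t1) + dotv p (w.1 - x1) + lam * (w.2 - t1)
       - M * (sqn (w.1 - x1) + (w.2 - t1) ^+ 2) <= u w) ->
  harmonic_avg g <= lam /\ (p <> 0 -> unit_avg g <= lam).
Proof.
move=> al a0 gab gl cg pg app t10 r0 touch.
have g0 y : 0 < g y by have /andP[/(lt_le_trans a0)] := gab y.
have ab : a <= b by have /andP[] := gab 0; exact: le_trans.
have lim (eta : R) : 0 < eta -> exists k V, [/\ 0 < k, wave_profile g k V,
    harmonic_avg V - eta <= lam & p <> 0 -> eta^-1 <= k].
  move=> eta0.
  have [|k [V [k0 wV H1 H2]]] := wave_limit (s := 1) (M := M) (lam := lam) (p := p) (x1 := x1)
     al a0 gab gl cg pg app (or_introl erefl) t10 r0 eta0.
    by move=> w w1 w2; have := touch w w1 w2; lra.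
  by exists k, V; split => //; move: H1; rewrite !mul1r.
split.
  apply/ler_addgt0Pr => eta eta0; have [k [V [k0 wV H _]]] := lim eta eta0.
  by have := profile_speed_ge k0 cg g0 wV; lra.
move=> p0; apply/ler_addgt0Pr => eta eta0.
pose C := (b - a) / a + 1.
have C0 : 0 < C by rewrite ltr_wpDl// divr_ge0 ?subr_ge0// ltW.
have eta10 : 0 < eta / (2 * C) by rewrite divr_gt0// mulr_gt0.
pose eta1 := Num.min (eta / 2) (eta / (2 * C)).
have eta1_gt0 : 0 < eta1 by rewrite lt_min eta10 divr_gt0.
have [k [V [k0 wV H1 H2]]] := lim eta1 eta1_gt0.
have kE := H2 p0.
have H3 := profile_speed_large k0 a0 cg gab wV.
have H4 : (b - a) / (a * k) <= eta / 2.
  have -> : (b - a) / (a * k) = ((b - a) / a) * k^-1 by rewrite invfM mulrA.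
  have ki : k^-1 <= eta / (2 * C).
    rewrite -[leRHS]invrK lef_pV2 ?posrE ?invr_gt0//.
    apply: le_trans kE; rewrite lef_pV2 ?posrE//.
    by rewrite ge_min lexx orbT.
  have E : C * (eta / (2 * C)) = eta / 2 by field; rewrite gt_eqF.
  rewrite -E; apply: ler_pM => //.
  - by rewrite divr_ge0 ?subr_ge0// ltW.
  - by rewrite invr_ge0 ltW.
  - by rewrite lerDl.
have H5 : eta1 <= eta / 2 by rewrite ge_min lexx.
by clearbody eta1; lra.
Qed.

(** The speed of every profile is at most the arithmetic average. *)
Lemma limit_subsolution (alpha a b l M lam r t1 : R) g e U u (x1 p : 'rV[R]_n) :
  0 < alpha < 1 -> 0 < a -> (forall y, a <= g y <= b) ->
  (forall x y, `|g x - g y| <= l * `|x - y|) -> continuous g -> periodic g 1 ->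
  wave_approximation alpha g e U u -> 0 < t1 -> 0 < r ->
  (forall w : 'rV[R]_n * R, (forall i, `|w.1 0 i - x1 0 i| <= r) -> `|w.2 - t1| <= r ->
     u w <= u (x1, t1) + dotv p (w.1 - x1) + lam * (w.2 - t1)
       + M * (sqn (w.1 - x1) + (w.2 - t1) ^+ 2)) ->
  lam <= unit_avg g.
Proof.
move=> al a0 gab gl cg pg app t10 r0 touch.
have g0 y : 0 < g y by have /andP[/(lt_le_trans a0)] := gab y.
apply/ler_addgt0Pr => eta eta0.
have [|k [V [k0 wV H _]]] := wave_limit (s := -1) (M := M) (lam := lam) (p := p) (x1 := x1)
     al a0 gab gl cg pg app (or_intror erefl) t10 r0 eta0.
  by move=> w w1 w2; have := touch w w1 w2; lra.
by have := profile_speed_le k0 cg g0 wV; lra.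
Qed.

(** The test function is made to depend on t only, so that at the contact
    point the transformed gradient vanishes and one profile with small k suffices; strict
    concavity in space still localises the contact. *)
Lemma limit_subsolution_concave (alpha a b l M lam r t1 d : R) g e U u (x1 : 'rV[R]_n) :
  0 < a -> (forall y, a <= g y <= b) ->
  (forall x y, `|g x - g y| <= l * `|x - y|) -> continuous g -> periodic g 1 ->
  wave_approximation alpha g e U u -> 0 < t1 -> 0 < r -> 0 < d ->
  (forall w : 'rV[R]_n * R, (forall i, `|w.1 0 i - x1 0 i| <= r) -> `|w.2 - t1| <= r ->
     u w <= u (x1, t1) + lam * (w.2 - t1) - d * sqn (w.1 - x1) + M * (w.2 - t1) ^+ 2) ->
  lam <= harmonic_avg g.
Proof.
move=> a0 gab gl cg pg [e0 elim UU Ueq Uconv] t10 r0 d0 touch.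
have g0 y : 0 < g y by have /andP[/(lt_le_trans a0)] := gab y.
have ab : a <= b by have /andP[] := gab 0; exact: le_trans.
have b0 : 0 < b by exact: lt_le_trans ab.
have l0 : 0 <= l by have := gl 0 1; rewrite sub0r normrN normr1 mulr1; apply: le_trans.
apply/ler_addgt0Pr => eta eta0.
pose C := b ^+ 2 / a ^+ 2 * (l * b) + b * (l * b / a) + 1.
have C0 : 0 < C.
  by rewrite ltr_wpDl// addr_ge0// !mulr_ge0 ?invr_ge0 ?exprn_ge0// ltW.
pose k := eta / (2 * C); have k0 : 0 < k by rewrite divr_gt0// mulr_gt0.
have kC : k * C = eta / 2 by rewrite /k; field; rewrite gt_eqF.
clearbody k.
have [V wV] := wave_profile_exists a0 k0 gab cg pg.
have cV := profile_continuous wV; have [pV V0 _] := wV.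
have Vb := profile_bounds k0 gab wV.
have Vclose := profile_close k0 a0 gab gl pg cg wV.
have [A dA] := primitive_exists (continuous_inv cV V0).
set c := harmonic_avg V.
have c0 : 0 < c by exact: harmonic_avg_gt0.
have cb : c <= b.
  have [y _] := harmonic_avg_attained cV V0; rewrite -/c => ->.
  by have /andP[] := Vb y.
have cg' : c <= harmonic_avg g + b ^+ 2 / a ^+ 2 * (k * l * b).
  have := harmonic_avg_close a0 cV cg Vb gab Vclose.
  by rewrite -/c ler_norml => /andP[_]; lra.
pose M1 := `|M| + 1; have M10 : 0 < M1 by rewrite ltr_wpDl.
pose r' := Num.min (Num.min r 1) (t1 / 2).
have r'0 : 0 < r' by rewrite !lt_min r0 ltr01 divr_gt0.
have r'r : r' <= r by rewrite !ge_min lexx.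
have r't : 0 < t1 - r' by have : r' <= t1 / 2 by [rewrite !ge_min lexx !orbT]; lra.
clearbody r'.
pose nu := Num.min (r' / 2) (eta / (4 * M1)).
have nu0 : 0 < nu by rewrite lt_min !divr_gt0// mulr_gt0.
have nur : nu <= r' / 2 by rewrite ge_min lexx.
have nueta : 2 * M1 * nu <= eta / 2.
  have : nu <= eta / (4 * M1) by rewrite ge_min lexx orbT.
  by rewrite ler_pdivlMr ?mulr_gt0//; lra.
clearbody nu.
pose nu2 := Num.min 1 d * nu ^+ 2.
have md : 0 < Num.min 1 d by rewrite lt_min ltr01.
have nu20 : 0 < nu2 by rewrite mulr_gt0// exprn_gt0.
pose K := box x1 r' (t1 - r') (t1 + r').
have Ksub : K `<=` closed_half by apply: box_closed_half; exact: ltW.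
have cK : compact K by exact: box_compact.
have [N1 HN1] := elim (nu2 / 4) (divr_gt0 nu20 (ltr0n R 4)).
have [N2 HN2] := Uconv K cK Ksub (nu2 / 4) (divr_gt0 nu20 (ltr0n R 4)).
pose j := (N1 + N2)%N.
have ej := e0 j; have ej1 : e j <= nu2 / 4 by apply: HN1; exact: leq_addr.
have Uu w : K w -> `|U j w - u w| <= nu2 / 4 by apply: HN2; exact: leq_addl.
have [cU rU] := UU j.
pose S y := wave_coordinate V A (e j) y.
have Sclose y : `|S y - y| <= e j by exact: wave_coordinate_close.
pose Phi (w : 'rV[R]_n * R) := lam * (w.2 - t1) + M1 * (w.2 - t1) ^+ 2 - S (U j w).
have K1 : K (x1, t1).
  by split => /=; [move=> i; rewrite subrr normr0 ltW|apply/andP; split; clear - r'0; lra].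
have cPhi : {within K, continuous Phi}.
  have c1 : {within K, continuous (fun w => S (U j w))}.
    have cUK := continuous_subspaceW Ksub cU.
    move=> w; apply: (@continuous_comp _ _ _ (U j : subspace K -> R) S); first exact: cUK.
    by apply: is_derive_continuous (wave_coordinate_derive _ ej dA).
  have c2 : continuous (fun w : 'rV[R]_n * R => lam * (w.2 - t1) + M1 * (w.2 - t1) ^+ 2).
    move=> w.
    have c3 : (w.2 - t1) @[w --> w] --> w.2 - t1 by apply: cvgB; [exact: cvg_snd|exact: cvg_cst].
    apply: cvgD; first by apply: cvgM; [exact: cvg_cst|exact: c3].
    by apply: cvgM; [exact: cvg_cst|apply: cvgM; exact: c3].
  by move=> w; apply: cvgB; [exact: (continuous_subspaceT c2)|exact: c1].
have Kne : K !=set0 by exists (x1, t1).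
have [z Kz zmin] := compact_EVT_min Kne cK cPhi.
rewrite inE in Kz.
have {}zmin w : K w -> Phi z <= Phi w by move=> Kw; apply: zmin; rewrite inE.
have Kz1 := Kz; case: Kz1 => zx /andP[zt1 zt2].
have zt : `|z.2 - t1| <= r' by rewrite ler_norml; apply/andP; split; clear - zt1 zt2; lra.
have zclose : d * sqn (z.1 - x1) + (z.2 - t1) ^+ 2 <= nu2.
  have H1 := zmin _ K1.
  have H2 := touch z (fun i => le_trans (zx i) r'r) (le_trans zt r'r).
  have := Sclose (U j (x1, t1)); have := Sclose (U j z); have := Uu _ K1; have := Uu _ Kz.
  rewrite !ler_norml => /andP[h1 h2] /andP[h3 h4] /andP[h5 h6] /andP[h7 h8].
  have H3 : M * (z.2 - t1) ^+ 2 <= `|M| * (z.2 - t1) ^+ 2 by rewrite ler_wpM2r ?sqr_ge0// ler_norm.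
  move: H1; rewrite /Phi /= subrr expr0n /= !mulr0 addr0 /M1 mulrDl mul1r => H1.
  by move: H1 H2 H3 h1 h2 h3 h4 h5 h6 h7 h8 ej1; clear; lra.
have sq0 := sqn_ge0 (z.1 - x1); have tq0 : 0 <= (z.2 - t1) ^+ 2 by exact: sqr_ge0.
have nusq : 0 <= nu ^+ 2 by exact: sqr_ge0.
have nu2d : nu2 <= d * nu ^+ 2 by rewrite ler_wpM2r// ge_min lexx orbT.
have nu21 : nu2 <= 1 * nu ^+ 2 by rewrite ler_wpM2r// ge_min lexx.
have sqz : sqn (z.1 - x1) <= nu ^+ 2.
  by rewrite -(ler_pM2l d0); clear - zclose nu2d tq0; lra.
have coordz i : `|z.1 0 i - x1 0 i| <= nu.
  apply: (square_le_abs (ltW nu0)); apply: le_trans sqz.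
  by have := coord_sq_le (z.1 - x1) i; rewrite !mxE.
have timez : `|z.2 - t1| <= nu.
  apply: (square_le_abs (ltW nu0)).
  have := mulr_ge0 (ltW d0) sq0; clear - zclose nu21; lra.
have r20 : 0 < r' / 2 by rewrite divr_gt0.
have oz : open_half z by exact: lt_le_trans zt1.
have minx i (x : R) : `|x| < r' / 2 ->
    -1 * (wave_coordinate V A (e j) (U j (z + x *: xdir i)) - wave_coordinate V A (e j) (U j z)) >=
    -1 * 0 * x - 0 * x ^+ 2 - M1 * `|x| ^+ 3.
  move=> xr; have : Phi z <= Phi (z + x *: xdir i).
    apply: zmin; apply: box_shift => //; first by apply: le_lt_trans (coordz i) _; clear - nur r'0; lra.
    have := coordz i; clear - nur xr; lra.
  have : 0 <= M1 * `|x| ^+ 3 by rewrite mulr_ge0 ?exprn_ge0// ltW.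
  by rewrite /Phi /S xdir_shift /=; clear; lra.
have mint (x : R) : `|x| < r' / 2 ->
    -1 * (wave_coordinate V A (e j) (U j (z + x *: tdir)) - wave_coordinate V A (e j) (U j z)) >=
    -1 * (lam + 2 * M1 * (z.2 - t1)) * x - M1 * x ^+ 2.
  move=> xr; have : Phi z <= Phi (z + x *: tdir).
    apply: zmin; rewrite tdir_shift; split => //=.
    by move: timez; rewrite ler_norml; move: xr; rewrite ltr_norml => /andP[x2 x3] /andP[x4 x5]; apply/andP; split; clear - nur x2 x3 x4 x5; lra.
  by rewrite /Phi /S tdir_shift /=; clear; lra.
have := @transformed_touch R n (-1) (e j `^ alpha) (e j) k (lam + 2 * M1 * (z.2 - t1)) M1 (r' / 2)
  g V A (U j) z (fun=> 0) (fun=> 0) (or_intror erefl) (powR_ge0 _ _) ej k0 wV dA rU oz (Ueq j z oz)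
  r20 minx mint (U j z / e j) c erefl erefl.
set y := U j z / e j.
rewrite big1 => [|i _]; last by rewrite expr0n.
rewrite big1// !(mulr0, mul0r) add0r subr0 => main.
have gV : g y / V y <= 1 + k * l * b / a.
  have -> : g y / V y = 1 - (V y - g y) / V y by field; rewrite gt_eqF.
  rewrite lerD2l lerNl; have := Vclose y; rewrite ler_norml => /andP[h _].
  have kn : 0 <= k * l * b by rewrite !mulr_ge0// ltW.
  apply: (@le_trans _ _ (- (k * l * b) / V y)).
    rewrite mulNr lerN2 ler_wpM2l// lef_pV2 ?posrE//.
    by have /andP[] := Vb y.
  by rewrite ler_wpM2r// invr_ge0 ltW.
have tz : - (2 * M1 * (z.2 - t1)) <= 2 * M1 * nu.
  rewrite -mulrN ler_wpM2l//; first by rewrite mulr_ge0// ltW.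
  by move: timez; rewrite ler_norml lerNl => /andP[].
have h1 : c * (g y / V y) <= c * (1 + k * l * b / a) by rewrite ler_wpM2l// ltW.
have h2 : c * (k * l * b / a) <= b * (k * l * b / a).
  by rewrite ler_wpM2r// !mulr_ge0 ?invr_ge0 ?(ltW a0) ?(ltW b0)// ltW.
have h3 : b ^+ 2 / a ^+ 2 * (k * l * b) + b * (k * l * b / a) + k = k * C by rewrite /C; ring.
by move: main h1 h2 h3 tz nueta cg' kC k0; clear; lra.
Qed.

End ViscosityInequalities.

(** * Second-order expansion of C2 functions *)

Section TwiceDifferentiable.
Context {R : realType} {n : nat}.
Implicit Types (x y h : 'rV[R]_n) (z v w : 'rV[R]_n * R) (f phi : 'rV[R]_n * R -> R).

Lemma rV_norm_le h (r : R) : 0 <= r -> (forall i, `|h 0 i| <= r) -> `|h| <= r.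
Proof.
move=> r0 H; rewrite [leLHS]/Num.norm /= mx_normrE; apply/bigmax_leP; split => // -[i j] _ /=.
by rewrite (ord1 i).
Qed.

Lemma open_half_ball z w : open_half z -> `|z - w| < z.2 -> open_half w.
Proof.
move=> oz; rewrite prod_normE /= gt_max => /andP[_]; rewrite /open_half /=.
by rewrite ltr_norml => /andP[_]; lra.
Qed.

Lemma C1_derive_cts f v z : C1_on open_half f -> open_half z ->
  forall e : R, 0 < e -> exists2 r : R, 0 < r &
    forall w, `|z - w| < r -> open_half w /\ `|'D_v f z - 'D_v f w| < e.
Proof.
move=> [_ /(_ v) [_ /within_continuous_ball cf]] oz e e0.
have [r r0 H] := cf z oz e e0; exists (Num.min r z.2); first by rewrite lt_min r0.
move=> w; rewrite lt_min => /andP[h1 h2].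
by have ow := open_half_ball oz h2; split => //; exact: H.
Qed.

Lemma C1_line f v z (s : R) : C1_on open_half f -> open_half (z + s *: v) ->
  is_derive s 1 (fun r : R => f (z + r *: v)) ('D_v f (z + s *: v)).
Proof. by move=> [_ /(_ v) [df _]] oz; apply: line_derive; exact: df. Qed.

Lemma C1_mean_value f v z (s : R) : C1_on open_half f -> 0 <= s ->
  (forall r, 0 <= r <= s -> open_half (z + r *: v)) ->
  exists2 c, 0 <= c <= s & f (z + s *: v) - f z = 'D_v f (z + c *: v) * s.
Proof.
move=> cf s0 H.
have [c c01 E] := mean_value (f := fun r => f (z + r *: v)) s0
  (fun r rs => C1_line cf (H r rs)).
by exists c => //; move: E; rewrite scale0r addr0 subr0.
Qed.

Lemma derive_dirZ (a : R) f v z : derivable f z v -> 'D_(a *: v) f z = a * 'D_v f z.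
Proof.
move=> df.
have zE : z + 0 *: v = z by rewrite scale0r addr0.
have L := @line_derive R _ f z v 0; rewrite zE in L.
have d0 : is_derive (0 : R) 1 (fun r : R => a * r) a.
  by apply: dereq (derZ a (derid 0)) _; rewrite mulr1.
have L' : is_derive (a * 0) 1 (fun r => f (z + r *: v)) ('D_v f z) by rewrite mulr0; exact: L.
have := dercomp (f := fun r => a * r) L' d0.
under eq_fun do rewrite mulrC -scalerA.
by move=> /derive_from_line [_ ->]; rewrite mulrC.
Qed.

(** The increment along v + w is split into an increment along v and one along
    w; continuity of the derivatives makes both mean values converge. *)
Lemma derive_dirD f v w z : C1_on open_half f -> open_half z ->
  'D_(v + w) f z = 'D_v f z + 'D_w f z.
Proof.
move=> cf oz; apply/eqP; rewrite -subr_eq0 -normr_le0; apply/ler_addgt0Pr => e e0; rewrite add0r.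
have e3 : 0 < e / 3 by rewrite divr_gt0.
have zE u : z + 0 *: u = z by rewrite scale0r addr0.
have Lw := C1_line (v := w) (z := z) (s := 0) cf; rewrite zE in Lw.
have Lvw := C1_line (v := v + w) (z := z) (s := 0) cf; rewrite zE in Lvw.
have [r1 r10 H1] := is_derive_eps (Lw oz) e3.
have [r2 r20 H2] := is_derive_eps (Lvw oz) e3.
have [r3 r30 H3] := C1_derive_cts v cf oz e3.
pose m := `|v| + `|w| + 1; have m0 : 0 < m by rewrite ltr_wpDl// addr_ge0.
pose s := Num.min (Num.min r1 r2) (r3 / m) / 2.
have s0 : 0 < s by rewrite divr_gt0// !lt_min r10 r20 divr_gt0.
have smin : s < Num.min (Num.min r1 r2) (r3 / m).
  by rewrite ltr_pdivrMr//; have : 0 < Num.min (Num.min r1 r2) (r3 / m); [rewrite !lt_min r10 r20 divr_gt0|lra].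
move: smin; rewrite !lt_min => /andP[/andP[sr1 sr2] sr3].
clearbody s.
have sm : s * m < r3 by move: sr3; rewrite ltr_pdivlMr.
have near c : 0 <= c <= s -> `|z - (z + s *: w + c *: v)| < r3.
  move=> /andP[c0 cs]; rewrite -addrA opprD addrA subrr sub0r normrN.
  apply: le_lt_trans (ler_normD _ _) _; rewrite !normrZ (gtr0_norm s0) (ger0_norm c0).
  apply: le_lt_trans sm; rewrite /m.
  by have := ler_wpM2r (normr_ge0 v) cs; have := ltW s0; lra.
have seg c : 0 <= c <= s -> open_half (z + s *: w + c *: v).
  by move=> /near /H3 [].
have [c c0s E] := C1_mean_value cf (ltW s0) seg.
have [_ hc] := H3 _ (near c c0s).
have h1 := H1 s; rewrite add0r zE (gtr0_norm s0) in h1; have {}h1 := h1 sr1.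
have h2 := H2 s; rewrite add0r zE (gtr0_norm s0) in h2; have {}h2 := h2 sr2.
have E2 : z + s *: (v + w) = z + s *: w + s *: v by rewrite scalerDr addrAC addrA addrAC.
rewrite E2 in h2.
have hc' : `|('D_v f z - 'D_v f (z + s *: w + c *: v)) * s| <= e / 3 * s.
  by rewrite normrM (gtr0_norm s0) ler_wpM2r// ltW.
rewrite -(ler_pM2r s0) -{1}(gtr0_norm s0) -normrM.
move: h1 h2 hc' E; clear - s0.
move: ('D_v f z) ('D_w f z) ('D_(v + w) f z) ('D_v f _) => d1 d2 d3 d4.
move: (f z) (f (z + s *: w)) (f _) => f1 f2 f3.
rewrite !ler_norml => /andP[a1 a2] /andP[a3 a4] /andP[a5 a6] E.
by apply/andP; split; lra.
Qed.

Lemma derive_dir_sum (I : Type) (r : seq I) (d : I -> 'rV[R]_n * R) f z :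
  C1_on open_half f -> open_half z ->
  'D_(\sum_(i <- r) d i) f z = \sum_(i <- r) 'D_(d i) f z.
Proof.
move=> cf oz; elim: r => [|i r IH]; first by rewrite !big_nil derive0.
by rewrite !big_cons derive_dirD// IH.
Qed.

Lemma dir_expansion v : v = \sum_i v.1 0 i *: xdir i + v.2 *: tdir.
Proof.
case: v => h t /=.
have -> : \sum_i h 0 i *: xdir i = (h, 0 : R).
  rewrite [h in RHS]row_sum_delta.
  rewrite (eq_bigr (fun i => (h 0 i *: delta_mx 0 i, 0))); last first.
    by move=> i _; rewrite /xdir; congr (_, _); rewrite /= ?scaler0.
  elim/big_rec2 : _ => // i y1 y2 _ ->.
  by congr (_, _); rewrite /= addr0.
by congr (_, _); rewrite /= ?scaler0 ?addr0// add0r [t *: 1]mulr1.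
Qed.

Lemma derive_expansion f v z : C1_on open_half f -> open_half z ->
  'D_v f z = \sum_i v.1 0 i * 'D_(xdir i) f z + v.2 * 'D_tdir f z.
Proof.
move=> cf oz; have [_ cf2] := cf.
have df d : derivable f z d by have [H _] := cf2 d; exact: H.
rewrite {1}(dir_expansion v) derive_dirD// derive_dirZ// derive_dir_sum//.
by congr (_ + _); apply: eq_bigr => i _; rewrite derive_dirZ.
Qed.

(** The mean value theorem, applied twice, gives the mixed derivative at a
    nearby point. *)
Lemma second_difference f v w z (e : R) : C2_on open_half f -> open_half z -> 0 < e ->
  exists2 r : R, 0 < r & forall s, 0 < s -> s < r ->
    `|f (z + s *: w + s *: v) - f (z + s *: v) - f (z + s *: w) + f z
      - s ^+ 2 * 'D_w ('D_v f) z| <= e * s ^+ 2.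
Proof.
move=> [cf cDf] oz e0.
have [r3 r30 H3] := C1_derive_cts w (cDf v) oz e0.
pose m := `|v| + `|w| + 1; have m0 : 0 < m by rewrite ltr_wpDl// addr_ge0.
exists (r3 / m); first by rewrite divr_gt0.
move=> s s0; rewrite ltr_pdivlMr// => sm.
have near c d : 0 <= c <= s -> 0 <= d <= s -> `|z - (z + c *: v + d *: w)| < r3.
  move=> /andP[c0 cs] /andP[d0 ds]; rewrite -addrA opprD addrA subrr sub0r normrN.
  apply: le_lt_trans (ler_normD _ _) _; rewrite !normrZ (ger0_norm d0) (ger0_norm c0).
  apply: le_lt_trans sm; rewrite /m.
  by have := ler_wpM2r (normr_ge0 v) cs; have := ler_wpM2r (normr_ge0 w) ds; have := ltW s0; lra.
have oh c d (cs : 0 <= c <= s) (ds : 0 <= d <= s) : open_half (z + c *: v + d *: w).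
  by have [] := H3 _ (near c d cs ds).
have ss : 0 <= s <= s by rewrite lexx ltW.
have s00 : 0 <= (0 : R) <= s by apply/andP; split => //; exact: ltW.
pose G r := f (z + s *: w + r *: v) - f (z + r *: v).
have swap r : z + s *: w + r *: v = z + r *: v + s *: w by rewrite addrAC.
have dG r : 0 <= r <= s -> is_derive r 1 G ('D_v f (z + s *: w + r *: v) - 'D_v f (z + r *: v)).
  move=> rs; apply: derB; apply: C1_line => //; first by rewrite swap; exact: oh.
  by have := oh r 0 rs s00; rewrite scale0r addr0.
have [c cs E1] := mean_value (ltW s0) dG.
have [d ds E2] := C1_mean_value (cDf v) (ltW s0) (fun d ds => oh c d cs ds).
have [_ hcd] := H3 _ (near c d cs ds).
rewrite swap E2 subr0 in E1.
have -> : f (z + s *: w + s *: v) - f (z + s *: v) - f (z + s *: w) + f z = G s - G 0.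
  rewrite /G scale0r !addr0; move: (f z) (f (z + s *: w)) (f (z + s *: v)) (f _) => f1 f2 f3 f4.
  by ring.
rewrite E1.
have gen (p q : R) : p * s * s - s ^+ 2 * q = - (q - p) * s ^+ 2 by ring.
rewrite gen.
by rewrite normrM normrN [`|s ^+ 2|]ger0_norm ?sqr_ge0// ler_wpM2r ?sqr_ge0// ltW.
Qed.

(** Both iterated derivatives are limits of the same second difference quotient. *)
Lemma derive_symmetric f v w z : C2_on open_half f -> open_half z ->
  'D_w ('D_v f) z = 'D_v ('D_w f) z.
Proof.
move=> cf oz; apply/eqP; rewrite -subr_eq0 -normr_le0; apply/ler_addgt0Pr => e e0; rewrite add0r.
have e2 : 0 < e / 2 by rewrite divr_gt0.
have [r1 r10 H1] := second_difference v w cf oz e2.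
have [r2 r20 H2] := second_difference w v cf oz e2.
pose s := Num.min r1 r2 / 2; have s0 : 0 < s by rewrite divr_gt0// lt_min r10.
have sr1 : s < r1 by rewrite ltr_pdivrMr// gt_min; apply/orP; left; lra.
have sr2 : s < r2 by rewrite ltr_pdivrMr// gt_min; apply/orP; right; lra.
have h2 := H2 s s0 sr2; have h1 := H1 s s0 sr1.
have E : z + s *: v + s *: w = z + s *: w + s *: v by rewrite addrAC.
rewrite E in h2.
clearbody s; have s20 : 0 < s ^+ 2 by rewrite exprn_gt0.
rewrite -(ler_pM2r s20) -{1}(gtr0_norm s20) -normrM.
move: h1 h2; clear - s20.
move: ('D_w ('D_v f) z) ('D_v ('D_w f) z) (f z) (f _) (f _) (f _) => d1 d2 f1 f2 f3 f4.
by rewrite !ler_norml => /andP[a1 a2] /andP[a3 a4]; apply/andP; split; lra.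
Qed.

Lemma hess_symmetric f z : C2_on open_half f -> open_half z -> (hess f z)^T = hess f z.
Proof. by move=> cf oz; apply/matrixP => i j; rewrite !mxE; exact: derive_symmetric. Qed.

Definition quadf (X : 'M[R]_n) h : R := (h *m X *m h^T) 0 0.

Lemma quadfE X h : quadf X h = \sum_i \sum_j h 0 i * h 0 j * X i j.
Proof.
rewrite /quadf mxE exchange_big /=; apply: eq_bigr => j _.
rewrite !mxE mulr_suml; apply: eq_bigr => i _; ring.
Qed.

Lemma bilinear_expansion (B : 'rV[R]_n * R -> 'rV[R]_n * R -> R) v :
  (forall w w', B w w' = B w' w) ->
  (forall w d, B w d = \sum_i w.1 0 i * B (xdir i) d + w.2 * B tdir d) ->
  B v v = \sum_i \sum_j v.1 0 i * v.1 0 j * B (xdir i) (xdir j)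
    + 2 * v.2 * (\sum_i v.1 0 i * B (xdir i) tdir) + v.2 ^+ 2 * B tdir tdir.
Proof.
move=> symB expB.
have half d : B d v = \sum_i v.1 0 i * B (xdir i) d + v.2 * B tdir d by rewrite symB expB.
rewrite (expB v v) (half tdir).
have -> : \sum_i v.1 0 i * B (xdir i) v =
  \sum_i \sum_j v.1 0 i * v.1 0 j * B (xdir i) (xdir j) + v.2 * (\sum_i v.1 0 i * B (xdir i) tdir).
  rewrite mulr_sumr -big_split /=; apply: eq_bigr => i _.
  rewrite (half (xdir i)) mulrDr mulr_sumr; congr (_ + _).
    by apply: eq_bigr => j _; rewrite mulrA (symB (xdir i)).
  by rewrite (symB tdir); ring.
by ring.
Qed.

Lemma derive2_expansion f v z : C2_on open_half f -> open_half z ->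
  'D_v ('D_v f) z = \sum_i \sum_j v.1 0 i * v.1 0 j * 'D_(xdir i) ('D_(xdir j) f) z
    + 2 * v.2 * (\sum_i v.1 0 i * 'D_(xdir i) ('D_tdir f) z)
    + v.2 ^+ 2 * 'D_tdir ('D_tdir f) z.
Proof.
move=> cf oz; have [_ c2] := cf.
apply: (bilinear_expansion (B := fun v w => 'D_v ('D_w f) z)).
  by move=> w w'; exact: (derive_symmetric w' w cf oz).
by move=> w d; exact: (derive_expansion w (c2 d) oz).
Qed.

(** The mixed terms in space and time are absorbed by Young's inequality, at the
    price of a large multiple of s^2. *)
Lemma quadratic_remainder (A A' : 'I_n -> 'I_n -> R) (B B' : 'I_n -> R) (E E' d e s : R) h :
  0 < d -> 0 <= e -> e * n%:R <= d ->
  (forall i j, `|A i j - A' i j| <= e) -> (forall i, `|B i - B' i| <= e) -> `|E - E'| <= e ->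
  `|\sum_i \sum_j h 0 i * h 0 j * A' i j + 2 * s * (\sum_i h 0 i * B' i) + s ^+ 2 * E'
     - \sum_i \sum_j h 0 i * h 0 j * A i j| <=
   2 * (d * sqn h) + (\sum_i ((`|B i| + e) ^+ 2 / d) + (`|E| + e)) * s ^+ 2.
Proof.
move=> d0 e0 en HA HB HE.
pose T i := `|B i| + e.
have B1 : `|\sum_i \sum_j h 0 i * h 0 j * A' i j - \sum_i \sum_j h 0 i * h 0 j * A i j| <= d * sqn h.
  rewrite -sumrB.
  apply: le_trans (ler_norm_sum _ _ _) _.
  apply: (@le_trans _ _ (\sum_i \sum_(j < n) e * ((h 0 i ^+ 2 + h 0 j ^+ 2) / 2))).
    apply: ler_sum => i _; rewrite -sumrB; apply: le_trans (ler_norm_sum _ _ _) _.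
    apply: ler_sum => j _; rewrite -mulrBr normrM mulrC.
    apply: ler_pM => //; first by rewrite distrC.
    rewrite normrM -(real_normK (num_real (h 0 i))) -(real_normK (num_real (h 0 j))).
    by have := sqr_ge0 (`|h 0 i| - `|h 0 j|); rewrite !expr2; lra.
  have -> : \sum_i \sum_(j < n) e * ((h 0 i ^+ 2 + h 0 j ^+ 2) / 2) = e * n%:R * sqn h.
    have E2 i : \sum_(j < n) e * ((h 0 i ^+ 2 + h 0 j ^+ 2) / 2) = e / 2 * (n%:R * h 0 i ^+ 2 + sqn h).
      rewrite -mulr_sumr -mulr_suml big_split /= sumr_const card_ord -mulr_natl -/(sqn h); ring.
    rewrite (eq_bigr _ (fun i _ => E2 i)) -mulr_sumr big_split /= sumr_const card_ord -mulr_sumr -/(sqn h) -mulr_natl; lra.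
  by rewrite ler_wpM2r// sqn_ge0.
have B2 : `|2 * s * (\sum_i h 0 i * B' i)| <= d * sqn h + \sum_i (T i ^+ 2 / d) * s ^+ 2.
  rewrite mulr_sumr; apply: le_trans (ler_norm_sum _ _ _) _.
  rewrite /sqn mulr_sumr -big_split /=; apply: ler_sum => i _.
  have HT : `|B' i| <= T i.
    have := HB i; rewrite distrC; have := ler_normB (B' i) (B i).
    have := lerB_dist (B' i) (B i).
    rewrite /T; lra.
  have -> : `|2 * s * (h 0 i * B' i)| = 2 * (`|s| * `|h 0 i| * `|B' i|).
    by rewrite !normrM [`|2|]ger0_norm//; ring.
  apply: (@le_trans _ _ (2 * (`|s| * `|h 0 i| * T i))).
    by rewrite ler_wpM2l// ler_wpM2l// mulr_ge0.
  rewrite -(real_normK (num_real (h 0 i))) -(real_normK (num_real s)) -subr_ge0.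
  have -> : d * `|h 0 i| ^+ 2 + T i ^+ 2 / d * `|s| ^+ 2 - 2 * (`|s| * `|h 0 i| * T i) =
    (d * `|h 0 i| - T i * `|s|) ^+ 2 / d by field; rewrite gt_eqF.
  by rewrite divr_ge0 ?sqr_ge0// ltW.
have B3 : `|s ^+ 2 * E'| <= (`|E| + e) * s ^+ 2.
  rewrite normrM [X in X * _]ger0_norm ?sqr_ge0// mulrC ler_wpM2r ?sqr_ge0//.
  have := HE; rewrite distrC.
  have := lerB_dist E' E.
  lra.
rewrite -mulr_suml in B2.
have CE : (\sum_i ((`|B i| + e) ^+ 2 / d) + (`|E| + e)) * s ^+ 2 =
  (\sum_i (T i ^+ 2 / d)) * s ^+ 2 + (`|E| + e) * s ^+ 2 by rewrite mulrDl.
rewrite CE; move: B1 B2 B3; rewrite !ler_norml => /andP[p1 p2] /andP[p3 p4] /andP[p5 p6].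
move: p1 p2 p3 p4 p5 p6; clear.
move: (sqn h) (\sum_i _) (\sum_i _) (\sum_i \sum_j _) (\sum_i \sum_j _) => q1 q2 q3 q4 q5.
by move=> p1 p2 p3 p4 p5 p6; apply/andP; split; lra.
Qed.

(** The expansion is of second order in space only; the coefficient d of the
    space remainder is as small as desired, the one of s^2 is some constant. *)
Lemma taylor_C2 f x (t d : R) : C2_on open_half f -> 0 < t -> 0 < d ->
  exists2 r : R, 0 < r & exists2 C : R, 0 <= C & forall h (s : R),
    (forall i, `|h 0 i| <= r) -> `|s| <= r ->
    `|f (x + h, t + s) - f (x, t) - dotv (grad f (x, t)) h - dt f (x, t) * s
       - quadf (hess f (x, t)) h / 2| <= d * sqn h + C * s ^+ 2.
Proof.
move=> cf t0 d0; have [c1 c2] := cf.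
have oz : open_half (x, t) by [].
pose e := d / (n%:R + 1); have n1 : 0 < n%:R + 1 :> R by rewrite ltr_wpDl.
have e0 : 0 < e by rewrite divr_gt0.
have en : e * n%:R <= d.
  have : e * (n%:R + 1) = d by rewrite /e; field; rewrite gt_eqF.
  by rewrite mulrDr mulr1; have := ltW e0; lra.
have cts v w : \forall z0 \near (x, t), open_half z0 /\ `|'D_w ('D_v f) (x, t) - 'D_w ('D_v f) z0| < e.
  have [r r0 H] := C1_derive_cts w (c2 v) oz e0.
  by apply/nbhs_ballP; exists r => //= z0; rewrite -ball_normE; exact: H.
have [rho rho0 Hrho] : exists2 rho : R, 0 < rho & forall z0, `|(x, t) - z0| < rho ->
   [/\ open_half z0,
     forall i j, `|'D_(xdir i) ('D_(xdir j) f) (x, t) - 'D_(xdir i) ('D_(xdir j) f) z0| < e,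
     forall i, `|'D_(xdir i) ('D_tdir f) (x, t) - 'D_(xdir i) ('D_tdir f) z0| < e &
     `|'D_tdir ('D_tdir f) (x, t) - 'D_tdir ('D_tdir f) z0| < e].
  have N1 : \forall z0 \near (x, t), forall k : 'I_n * 'I_n, `|'D_(xdir k.1) ('D_(xdir k.2) f) (x, t) - 'D_(xdir k.1) ('D_(xdir k.2) f) z0| < e.
    apply: (@filter_forall _ _ (fun (k : 'I_n * 'I_n) z0 => `|'D_(xdir k.1) ('D_(xdir k.2) f) (x, t) - 'D_(xdir k.1) ('D_(xdir k.2) f) z0| < e) (nbhs (x, t)) (nbhs_filter (x, t))) => k.
    by apply: filterS (cts (xdir k.2) (xdir k.1)) => z0 [].
  have N2 : \forall z0 \near (x, t), forall i : 'I_n, `|'D_(xdir i) ('D_tdir f) (x, t) - 'D_(xdir i) ('D_tdir f) z0| < e.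
    apply: (@filter_forall _ _ (fun (i : 'I_n) z0 => `|'D_(xdir i) ('D_tdir f) (x, t) - 'D_(xdir i) ('D_tdir f) z0| < e) (nbhs (x, t)) (nbhs_filter (x, t))) => i.
    by apply: filterS (cts tdir (xdir i)) => z0 [].
  have N3 := cts tdir tdir.
  have [rho /= rho0 H] := (nbhs_ballP _ _).1 (filterI N1 (filterI N2 N3)).
  exists rho => // z0 yr.
  have := H z0; rewrite -ball_normE => /(_ yr) [a1 [a2 [a3 a4]]].
  by split; [exact: a3|move=> i j; exact: (a1 (i, j))|exact: a2|exact: a4].
pose T i := `|'D_(xdir i) ('D_tdir f) (x, t)| + e.
pose E := `|'D_tdir ('D_tdir f) (x, t)| + e.
pose C := \sum_i (T i ^+ 2 / d) + E.
have C0 : 0 <= C.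
  rewrite addr_ge0 ?addr_ge0 ?(ltW e0)//; apply: sumr_ge0 => i _.
  by rewrite divr_ge0 ?sqr_ge0// ltW.
exists (rho / 2); first by rewrite divr_gt0.
exists C => // h s hr sr.
pose v : 'rV[R]_n * R := (h, s).
have seg c : 0 <= c <= 1 -> `|(x, t) - ((x, t) + c *: v)| < rho.
  move=> /andP[c0 c1']; rewrite opprD addrA subrr sub0r normrN normrZ (ger0_norm c0).
  apply: (@le_lt_trans _ _ (1 * `|v|)); first by rewrite ler_wpM2r.
  rewrite mul1r prod_normE /= gt_max; apply/andP; split; last by lra.
  have r2 : 0 <= rho / 2 by rewrite divr_ge0// ltW.
  by apply: le_lt_trans (rV_norm_le r2 hr) _; lra.
have vE : (x, t) + 1 *: v = (x + h, t + s) by rewrite scale1r.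
have [c c01 E1] := @taylor_order2 R (fun r => f ((x, t) + r *: v))
  (fun r => 'D_v f ((x, t) + r *: v)) (fun r => 'D_v ('D_v f) ((x, t) + r *: v))
  (fun r rs => C1_line c1 (let: And4 o _ _ _ := Hrho _ (seg r rs) in o))
  (fun r rs => C1_line (c2 v) (let: And4 o _ _ _ := Hrho _ (seg r rs) in o)).
rewrite /= vE scale0r addr0 in E1.
have [oc HA HB HE] := Hrho _ (seg c c01).
set z0 := (x, t) + c *: v in E1 oc HA HB HE.
have D1E := derive_expansion v c1 oz; have D2E := derive2_expansion v cf oc; rewrite /= in D1E D2E.
have gradE : dotv (grad f (x, t)) h = \sum_i h 0 i * 'D_(xdir i) f (x, t).
  by apply: eq_bigr => i _; rewrite mxE mulrC.
have quadE : quadf (hess f (x, t)) h = \sum_i \sum_j h 0 i * h 0 j * 'D_(xdir i) ('D_(xdir j) f) (x, t).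
  by rewrite quadfE; apply: eq_bigr => i _; apply: eq_bigr => j _; rewrite mxE.
have := @quadratic_remainder (fun i j => 'D_(xdir i) ('D_(xdir j) f) (x, t)) (fun i j => 'D_(xdir i) ('D_(xdir j) f) z0)
  (fun i => 'D_(xdir i) ('D_tdir f) (x, t)) (fun i => 'D_(xdir i) ('D_tdir f) z0)
  ('D_tdir ('D_tdir f) (x, t)) ('D_tdir ('D_tdir f) z0) d e s h d0 (ltW e0) en
  (fun i j => ltW (HA i j)) (fun i => ltW (HB i)) (ltW HE).
rewrite -D2E -quadE -/C -gradE in D1E *.
have sq0 : 0 <= d * sqn h by rewrite mulr_ge0 ?sqn_ge0// ltW.
have C20 : 0 <= C * s ^+ 2 by rewrite mulr_ge0// sqr_ge0.
clearbody C; clear - E1 D1E sq0 C20.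
rewrite /dt; move: E1 D1E.
move: ('D_v ('D_v f) z0) ('D_v f (x, t)) ('D_tdir f (x, t)) (quadf _ _) (dotv _ _) => e1 e2 e3 e7 e8.
move: (f _) (f _) => f1 f2 E1 D1E.
by rewrite !ler_norml => /andP[p1 p2]; apply/andP; split; lra.
Qed.

End TwiceDifferentiable.

(** * From jets to touching quadratics *)

Section Jets.
Context {R : realType} {n : nat}.
Implicit Types (x p h : 'rV[R]_n) (X : 'M[R]_n) (z w : 'rV[R]_n * R) (u phi : 'rV[R]_n * R -> R).

(** Contact with a quadratic function whose second derivatives are left free: the
    limit operator depends on the gradient only. *)
Definition touches_below u x (t : R) p (lam : R) := exists M r : R, 0 < r /\
  forall w, (forall i, `|w.1 0 i - x 0 i| <= r) -> `|w.2 - t| <= r ->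
    u (x, t) + dotv p (w.1 - x) + lam * (w.2 - t)
      - M * (sqn (w.1 - x) + (w.2 - t) ^+ 2) <= u w.

Definition touches_above u x (t : R) p (lam : R) := exists M r : R, 0 < r /\
  forall w, (forall i, `|w.1 0 i - x 0 i| <= r) -> `|w.2 - t| <= r ->
    u w <= u (x, t) + dotv p (w.1 - x) + lam * (w.2 - t)
      + M * (sqn (w.1 - x) + (w.2 - t) ^+ 2).

Lemma mul_coord_le h i j : `|h 0 i * h 0 j| <= sqn h.
Proof.
rewrite normrM; have := coord_sq_le h i; have := coord_sq_le h j.
rewrite -(real_normK (num_real (h 0 i))) -(real_normK (num_real (h 0 j))).
by have := sqr_ge0 (`|h 0 i| - `|h 0 j|); rewrite !expr2; lra.
Qed.

Lemma quadf_bound X : exists2 C : R, 0 <= C & forall h, `|quadf X h| <= C * sqn h.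
Proof.
exists (\sum_i \sum_j `|X i j|).
  by apply: sumr_ge0 => i _; apply: sumr_ge0.
move=> h; rewrite quadfE mulr_suml; apply: le_trans (ler_norm_sum _ _ _) _.
apply: ler_sum => i _; rewrite mulr_suml; apply: le_trans (ler_norm_sum _ _ _) _.
by apply: ler_sum => j _; rewrite normrM mulrC ler_wpM2l// mul_coord_le.
Qed.

Lemma taylor_at phi x (t d : R) : C2_on open_half phi -> 0 < t -> 0 < d ->
  exists2 r : R, 0 < r < t & exists2 C : R, 0 <= C & forall w,
    (forall i, `|w.1 0 i - x 0 i| <= r) -> `|w.2 - t| <= r ->
    `|phi w - phi (x, t) - dotv (grad phi (x, t)) (w.1 - x) - dt phi (x, t) * (w.2 - t)
       - quadf (hess phi (x, t)) (w.1 - x) / 2| <= d * sqn (w.1 - x) + C * (w.2 - t) ^+ 2.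
Proof.
move=> cphi t0 d0; have [r r0 [C C0 H]] := taylor_C2 x cphi t0 d0.
exists (Num.min r (t / 2)).
  by rewrite lt_min r0 divr_gt0//= gt_min; apply/orP; right; lra.
exists C => // -[y s] /= Hy Hs.
have := H (y - x) (s - t); rewrite !(addrC _ (_ - _)) !subrK; apply.
  by move=> i; rewrite !mxE; apply: le_trans (Hy i) _; rewrite ge_min lexx.
by apply: le_trans Hs _; rewrite ge_min lexx.
Qed.

Lemma near_open_half (t r : R) w : r < t -> `|w.2 - t| <= r -> open_half w.
Proof. by move=> rt; rewrite ler_norml /open_half /= => /andP[h _]; lra. Qed.

Lemma subjet_touches u x (t : R) p X lam : 0 < t -> subjet u (x, t) (p, X, lam) ->
  X^T = X /\ touches_below u x t p lam.
Proof.
move=> t0 [phi [cphi le_phi eq_phi [-> -> ->]]].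
split; first exact: hess_symmetric.
have [r /andP[r0 rt] [C C0 H]] := taylor_at x cphi t0 ltr01.
have [K K0 HK] := quadf_bound (hess phi (x, t)).
exists (1 + C + K), r; split => // w w1 w2.
have h1 := H w w1 w2; have h2 := HK (w.1 - x); have h3 := le_phi w (near_open_half rt w2).
have s1 := sqn_ge0 (w.1 - x); have s2 := sqr_ge0 (w.2 - t).
have p1 := mulr_ge0 C0 s1; have p2 := mulr_ge0 K0 s2; have p3 := mulr_ge0 K0 s1; have p4 := mulr_ge0 C0 s2.
rewrite -eq_phi; move: h1 h2 h3 s1 s2 p1 p2 p3 p4; rewrite !ler_norml; clear.
move: (quadf _ _) (dotv _ _) (dt _ _) (sqn _) => a1 a2 a3 a4.
move: (phi _) (phi _) (u _) => f1 f2 f3 /andP[h1 h1'] /andP[h2 h2'] h3 s1 s2 p1 p2 p3 p4.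
by rewrite !mulrDr !mulrDl; lra.
Qed.

Lemma superjet_touches u x (t : R) p X lam : 0 < t -> superjet u (x, t) (p, X, lam) ->
  X^T = X /\ touches_above u x t p lam.
Proof.
move=> t0 [phi [cphi le_phi eq_phi [-> -> ->]]].
split; first exact: hess_symmetric.
have [r /andP[r0 rt] [C C0 H]] := taylor_at x cphi t0 ltr01.
have [K K0 HK] := quadf_bound (hess phi (x, t)).
exists (1 + C + K), r; split => // w w1 w2.
have h1 := H w w1 w2; have h2 := HK (w.1 - x); have h3 := le_phi w (near_open_half rt w2).
have s1 := sqn_ge0 (w.1 - x); have s2 := sqr_ge0 (w.2 - t).
have p1 := mulr_ge0 C0 s1; have p2 := mulr_ge0 K0 s2; have p3 := mulr_ge0 K0 s1; have p4 := mulr_ge0 C0 s2.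
rewrite -eq_phi; move: h1 h2 h3 s1 s2 p1 p2 p3 p4; rewrite !ler_norml; clear.
move: (quadf _ _) (dotv _ _) (dt _ _) (sqn _) => a1 a2 a3 a4.
move: (phi _) (phi _) (u _) => f1 f2 f3 /andP[h1 h1'] /andP[h2 h2'] h3 s1 s2 p1 p2 p3 p4.
by rewrite !mulrDr !mulrDl; lra.
Qed.

Lemma quadf_continuous X : continuous (quadf X).
Proof.
move=> h.
have -> : quadf X = fun h => \sum_i \sum_j h 0 i * h 0 j * X i j by apply/funext => k; exact: quadfE.
apply: (@cvg_sum R _ (nbhs h) (nbhs_filter h)) => i.
apply: (@cvg_sum R _ (nbhs h) (nbhs_filter h)) => j; apply: cvgM; last exact: cvg_cst.
by apply: cvgM; exact: coord_continuous.
Qed.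

Lemma quadfZ X (a : R) h : quadf X (a *: h) = a ^+ 2 * quadf X h.
Proof. by rewrite /quadf -scalemxAl linearZ /= -scalemxAl -scalemxAr !mxE; ring. Qed.

Lemma sqnZ (a : R) h : sqn (a *: h) = a ^+ 2 * sqn h.
Proof. by rewrite /sqn mulr_sumr; apply: eq_bigr => i _; rewrite mxE exprMn. Qed.

Lemma sqn_eq0 h : sqn h = 0 -> h = 0.
Proof.
move=> s0; apply/rowP => i; rewrite mxE; apply/eqP.
by rewrite -sqrf_eq0 eq_le sqr_ge0 andbT -s0 coord_sq_le.
Qed.

(** The maximum of the form over the compact Euclidean sphere is negative. *)
Lemma negative_definite_bound X : negative_definite X ->
  exists2 c : R, 0 < c & forall h, quadf X h <= - c * sqn h.
Proof.
move=> nX.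
pose S := [set h : 'rV[R]_n | sqn h = 1].
have [[h0 Sh0]|Sempty] := pselect (exists h, S h); last first.
  exists 1 => // h; have [h0|hn] := eqVneq (sqn h) 0.
    by rewrite h0 mulr0 (sqn_eq0 h0) -(scale0r 0) quadfZ expr0n mul0r.
  exfalso; apply: Sempty; exists ((Num.sqrt (sqn h))^-1 *: h).
  by rewrite /S /= sqnZ exprVn sqr_sqrtr ?sqn_ge0// mulVf.
have csq : continuous (@sqn R n).
  by move=> h; apply: (@cvg_sum R _ (nbhs h) (nbhs_filter h)) => i; apply: cvgM; exact: coord_continuous.
have cS : compact S.
  have sub : S `<=` [set h : 'rV[R]_n | forall i, [set` `[-1, 1]] (h ord0 i)].
    move=> h Sh i /=; rewrite in_itv /= -ler_norml.
    apply: square_le_abs => //; rewrite expr1n.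
    by apply: le_trans (coord_sq_le h i) _; rewrite Sh.
  apply: (subclosed_compact _ _ sub).
    have -> : S = (@sqn R n) @^-1` [set 1] by [].
    by apply: closed_comp; [move=> h _; exact: csq|exact: closed_eq].
  by apply: (@rV_compact R n (fun=> [set` `[-1, 1]])) => i; exact: segment_compact.
have [hm] := compact_EVT_max (ex_intro _ _ Sh0) cS (continuous_subspaceT (@quadf_continuous X)).
rewrite inE => Shm hmax.
have hm0 : hm != 0.
  by apply/eqP => hm0; move: Shm; rewrite /S /= hm0 sqn0 => /eqP; rewrite eq_sym oner_eq0.
exists (- quadf X hm); first by rewrite oppr_gt0; exact: nX.
move=> h; rewrite opprK; have [h0'|hn] := eqVneq (sqn h) 0.
  by rewrite h0' mulr0 (sqn_eq0 h0') -(scale0r 0) quadfZ expr0n mul0r.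
have s0 : 0 < sqn h by rewrite lt_neqAle eq_sym hn sqn_ge0.
have := hmax ((Num.sqrt (sqn h))^-1 *: h); rewrite inE => H.
have {}H := H (_ : S _).
have : quadf X ((Num.sqrt (sqn h))^-1 *: h) <= quadf X hm.
  by apply: H; rewrite /S /= sqnZ exprVn sqr_sqrtr ?sqn_ge0// mulVf.
by rewrite quadfZ exprVn sqr_sqrtr ?sqn_ge0// mulrC ler_pdivrMr.
Qed.

(** The part of order |x|^2 in the expansion of the test function is dominated by
    its negative definite Hessian. *)
Lemma superjet_concave u x (t : R) X lam : 0 < t -> superjet u (x, t) (0, X, lam) ->
  negative_definite X -> exists M r d : R, [/\ 0 < r, 0 < d & forall w,
    (forall i, `|w.1 0 i - x 0 i| <= r) -> `|w.2 - t| <= r ->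
     u w <= u (x, t) + lam * (w.2 - t) - d * sqn (w.1 - x) + M * (w.2 - t) ^+ 2].
Proof.
move=> t0 [phi [cphi le_phi eq_phi [gE XE lE]]] nX.
have [c c0 Hc] := negative_definite_bound nX.
have d0 : 0 < c / 4 by rewrite divr_gt0.
have [r /andP[r0 rt] [C C0 H]] := taylor_at x cphi t0 d0.
exists C, r, (c / 4); split => // w w1 w2.
have h1 := H w w1 w2; have h2 := Hc (w.1 - x); have h3 := le_phi w (near_open_half rt w2).
have dot0 : dotv (grad phi (x, t)) (w.1 - x) = 0.
  by rewrite -gE /dotv big1// => i _; rewrite mxE mul0r.
rewrite dot0 -XE -lE in h1; rewrite -eq_phi; move: h1 h2 h3; rewrite !ler_norml; clear.
move: (quadf _ _) (sqn _) => a1 a4.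
by move: (phi _) (phi _) (u _) => f1 f2 f3 /andP[h1 h1'] h2 h3; lra.
Qed.

Lemma dotvDr p h k : dotv p (h + k) = dotv p h + dotv p k.
Proof. by rewrite /dotv -big_split /=; apply: eq_bigr => i _; rewrite mxE mulrDr. Qed.

Lemma dotvDl p q h : dotv (p + q) h = dotv p h + dotv q h.
Proof. by rewrite /dotv -big_split /=; apply: eq_bigr => i _; rewrite mxE mulrDl. Qed.

Lemma dotvZl (a : R) p h : dotv (a *: p) h = a * dotv p h.
Proof. by rewrite /dotv mulr_sumr; apply: eq_bigr => i _; rewrite mxE mulrA. Qed.

Lemma dotvC p h : dotv p h = dotv h p.
Proof. by apply: eq_bigr => i _; rewrite mulrC. Qed.

Lemma dotvv h : dotv h h = sqn h.
Proof. by apply: eq_bigr => i _; rewrite expr2. Qed.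

Lemma sqnD h k : sqn (h + k) = sqn h + 2 * dotv h k + sqn k.
Proof. by rewrite -!dotvv dotvDr !dotvDl (dotvC k h); ring. Qed.

Lemma cauchy_schwarz_unit p h : sqn p = 1 -> dotv p h ^+ 2 <= sqn h.
Proof.
move=> p1; have := sqn_ge0 (h + (- dotv p h) *: p).
rewrite sqnD sqnZ p1 (dotvC h) dotvZl; have := dotvC p h; rewrite !expr2; lra.
Qed.

Lemma dotv_continuous p x : continuous (fun w : 'rV[R]_n * R => dotv p (w.1 - x)).
Proof.
move=> w; apply: cvg_sum => i; apply: cvgM; first exact: cvg_cst.
have -> : (fun v : 'rV[R]_n * R => (v.1 - x) 0 i) = (fun v => v.1 0 i - x 0 i).
  by apply/funext => v; rewrite !mxE.
by rewrite !mxE; apply: cvgB; [exact: coord_fst_continuous|exact: cvg_cst].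
Qed.

(** The mixed terms between eta and its orthogonal complement are absorbed by
    Young's inequality, at the price of a large negative multiple of the orthogonal
    part. *)
Lemma quadf_direction X eta (d : R) : sqn eta = 1 -> 0 < d -> d <= quadf X eta ->
  exists2 C : R, 0 <= C & forall h,
    d / 2 * dotv eta h ^+ 2 - C * (sqn h - dotv eta h ^+ 2) <= quadf X h.
Proof.
move=> e1 d0 dX; have [K K0 HK] := quadf_bound X.
pose B (h k : 'rV[R]_n) := \sum_i \sum_j h 0 i * k 0 j * X i j.
have BD (h k : 'rV[R]_n) : quadf X (h + k) = quadf X h + B h k + B k h + quadf X k.
  rewrite !quadfE /B -!big_split /=; apply: eq_bigr => i _.
  by rewrite -!big_split /=; apply: eq_bigr => j _; rewrite !mxE; ring.
pose S := \sum_i \sum_j `|X i j|.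
have S0 : 0 <= S by apply: sumr_ge0 => i _; apply: sumr_ge0.
have BS (h k : 'rV[R]_n) (a : R) : 0 < a -> `|B h k| <= S * (a * sqn h + sqn k / a).
  move=> a0; rewrite /B /S mulr_suml; apply: le_trans (ler_norm_sum _ _ _) _.
  apply: ler_sum => i _; rewrite mulr_suml; apply: le_trans (ler_norm_sum _ _ _) _.
  apply: ler_sum => j _; rewrite normrM mulrC ler_wpM2l//.
  have H1 := coord_sq_le h i; have H2 := coord_sq_le k j.
  have H3 : `|h 0 i * k 0 j| <= a * h 0 i ^+ 2 + k 0 j ^+ 2 / a.
    have E (e : R) : e * e = 1 -> 0 <= a * h 0 i ^+ 2 + k 0 j ^+ 2 / a + e * (h 0 i * k 0 j).
      move=> ee; have -> : a * h 0 i ^+ 2 + k 0 j ^+ 2 / a + e * (h 0 i * k 0 j) =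
        a * (h 0 i + e * k 0 j / (2 * a)) ^+ 2 + k 0 j ^+ 2 / a * (1 - (e * e) / 4).
        by field; rewrite gt_eqF.
      rewrite ee addr_ge0// mulr_ge0 ?sqr_ge0// ?(ltW a0)//; first by rewrite divr_ge0 ?sqr_ge0// ltW.
      lra.
    have E1 := E 1 ltac:(by rewrite mulr1); have E2 := E (-1) ltac:(by rewrite mulrNN mulr1).
    by rewrite ler_norml; apply/andP; split; lra.
  apply: le_trans H3 _; apply: lerD; first by rewrite ler_wpM2l// ltW.
  by rewrite ler_wpM2r// invr_ge0 ltW.
pose a := d / (4 * (S + 1)); have S1 : 0 < S + 1 by rewrite ltr_wpDl.
have a0 : 0 < a by rewrite divr_gt0// mulr_gt0.
have Sa : S * a <= d / 4.
  have : (S + 1) * a = d / 4 by rewrite /a; field; rewrite gt_eqF.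
  by rewrite mulrDl mul1r; have := ltW a0; lra.
clearbody a.
exists (2 * (S / a) + K).
  by rewrite addr_ge0// mulr_ge0// divr_ge0// ltW.
move=> h; pose y := dotv eta h; pose k := h - y *: eta.
have hE : h = y *: eta + k by rewrite /k addrC subrK.
have ek : dotv eta k = 0 by rewrite /k dotvDr (dotvC _ (- _)) -scaleNr dotvZl dotvv e1 -/y; ring.
have sqh : sqn h = y ^+ 2 + sqn k.
  by rewrite {1}hE sqnD sqnZ e1 dotvZl ek; ring.
have sqk : sqn k = sqn h - y ^+ 2 by rewrite sqh; ring.
rewrite -/y -sqk hE BD quadfZ.
have b1 := BS (y *: eta) k a a0.
have b2 : `|B k (y *: eta)| <= S * (a * sqn (y *: eta) + sqn k / a).
  have ai : 0 < a^-1 by rewrite invr_gt0.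
  by have := BS k (y *: eta) a^-1 ai; rewrite invrK addrC (mulrC a^-1) (mulrC _ a).
have b3 := HK k; rewrite sqnZ e1 mulr1 in b1 b2.
have b4 : y ^+ 2 * d <= y ^+ 2 * quadf X eta by rewrite ler_wpM2l// sqr_ge0.
have b5 : S * a * y ^+ 2 <= d / 4 * y ^+ 2 by rewrite ler_wpM2r// sqr_ge0.
move: b1 b2 b3 b4 b5; rewrite !ler_norml; clear.
move: (B _ _) (B _ _) (quadf X k) (quadf X eta) (sqn k) (y ^+ 2) => q1 q2 q3 q4 q5 q6.
move=> /andP[b1 _] /andP[b2 _] /andP[b3 _] b4 b5.
by rewrite !mulrDl; lra.
Qed.

(** The test function is bounded below by psi, strictly convex in the
    direction eta.  With y = eta . (x - x0), adding sg |y| to psi moves the contact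
    point slightly, and there a subgradient p of the sum satisfies
    sign (y) (p . eta) = 2 c |y| + sg, which is positive; hence p is not 0. *)
Lemma subjet_convex_direction u x (t gb : R) X lam : 0 < t ->
  {within closed_half, continuous u} ->
  (forall x1 (t1 : R) p l, 0 < t1 -> touches_below u x1 t1 p l -> p <> 0 -> gb <= l) ->
  subjet u (x, t) (0, X, lam) ->
  (exists eta : 'rV[R]_n, exists delta : R,
      [/\ eta != 0, 0 < delta & delta * enorm eta ^+ 2 <= (eta *m X *m eta^T) 0 0]) ->
  gb <= lam.
Proof.
move=> t0 cu supersol [phi [cphi le_phi eq_phi [gE XE lE]]] [eta0 [delta [eta0n delta0 Hdelta]]].
pose nrm := Num.sqrt (sqn eta0).
have sq0 : 0 < sqn eta0.
  by rewrite lt_neqAle sqn_ge0 andbT eq_sym; apply: contra eta0n => /eqP /sqn_eq0 ->.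
have n0 : 0 < nrm by rewrite sqrtr_gt0.
pose eta := nrm^-1 *: eta0.
have e1 : sqn eta = 1 by rewrite sqnZ exprVn sqr_sqrtr ?sqn_ge0// mulVf// gt_eqF.
have dX : delta <= quadf X eta.
  rewrite quadfZ exprVn sqr_sqrtr ?sqn_ge0// mulrC ler_pdivlMr//.
  by rewrite -enorm_sq.
clearbody eta.
have [C C0 HC] := quadf_direction e1 delta0 dX.
pose c := delta / 16; have c0 : 0 < c by rewrite divr_gt0.
have [r /andP[r0 rt] [C' C'0 H]] := taylor_at x cphi t0 c0.
pose M := C + C' + c; have M0 : 0 <= M by rewrite !addr_ge0// ltW.
(* strict lower bound by a quadratic function convex in the direction eta *)
pose psi w := lam * (w.2 - t) + (2 * c + M) * dotv eta (w.1 - x) ^+ 2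
   - (M + c) * sqn (w.1 - x) - (M + c) * (w.2 - t) ^+ 2.
pose K := box x r (t - r) (t + r).
have below w : K w -> u (x, t) + psi w + c * (sqn (w.1 - x) + (w.2 - t) ^+ 2) <= u w.
  move=> [w1 /andP[w2 w2']].
  have wt : `|w.2 - t| <= r by rewrite ler_norml; apply/andP; split; lra.
  have h1 := H w w1 wt; have h2 := HC (w.1 - x); have h3 := le_phi w (near_open_half rt wt).
  have dot0 : dotv (grad phi (x, t)) (w.1 - x) = 0.
    by rewrite -gE /dotv big1// => i _; rewrite mxE mul0r.
  have cs := cauchy_schwarz_unit (w.1 - x) e1.
  have s2 := sqr_ge0 (w.2 - t).
  have p1 : 0 <= (C / 2 + C') * (sqn (w.1 - x) - dotv eta (w.1 - x) ^+ 2).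
    by rewrite mulr_ge0 ?subr_ge0// addr_ge0// divr_ge0.
  have p2 : 0 <= C * (w.2 - t) ^+ 2 by rewrite mulr_ge0.
  have p3 : 0 <= c * (w.2 - t) ^+ 2 by rewrite mulr_ge0// ltW.
  have p4 : 0 <= c * dotv eta (w.1 - x) ^+ 2 by rewrite mulr_ge0 ?sqr_ge0// ltW.
  have dE : delta = 16 * c by rewrite /c; lra.
  rewrite dot0 -XE -lE in h1; rewrite -eq_phi /psi /M; move: h1 h2 h3 p1 p2 p3 p4.
  rewrite dE !ler_norml; clear.
  move: (quadf _ _) (sqn _) (dotv _ _ ^+ 2) => a1 a4 a5.
  move: (phi _) (phi _) (u _) ((w.2 - t) ^+ 2) => f1 f2 f3 f4 /andP[h1 h1'] h2 h3 p1 p2 p3 p4.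
  by rewrite !mulrDl !mulrDr; lra.
have Ksub : K `<=` closed_half by apply: box_closed_half; lra.
have cK : compact K by exact: box_compact.
have cuK := continuous_subspaceW Ksub cu.
have K0 : K (x, t).
  by split => /=; [move=> i; rewrite subrr normr0 ltW|apply/andP; split; lra].
apply/ler_addgt0Pr => err err0.
pose sg := Num.min (c * r / 2) (err * c / (2 * (M + c))).
have Mc0 : 0 < M + c by rewrite ltr_wpDl.
have sg0 : 0 < sg by rewrite lt_min !divr_gt0 ?mulr_gt0.
have sgr : sg <= c * r / 2 by rewrite ge_min lexx.
have sge : 2 * (M + c) * (sg / c) <= err.
  have : sg <= err * c / (2 * (M + c)) by rewrite ge_min lexx orbT.
  rewrite ler_pdivlMr ?mulr_gt0// => h.
  by rewrite mulrA ler_pdivrMr//; lra.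
clearbody sg.
pose Q w := u w - psi w - sg * `|dotv eta (w.1 - x)|.
have cQ : {within K, continuous Q}.
  have cpsi : continuous (fun w => psi w + sg * `|dotv eta (w.1 - x)|).
    move=> w.
    have c1 := @dotv_continuous eta x w.
    have c2 : (v.2 - t) @[v --> w] --> w.2 - t by apply: cvgB; [exact: cvg_snd|exact: cvg_cst].
    have c3 := @sqn_continuous R n x w.
    apply: cvgD; last by apply: cvgM; [exact: cvg_cst|apply: cvg_norm; exact: c1].
    apply: cvgB; last by apply: cvgM; [exact: cvg_cst|apply: cvgM; exact: c2].
    apply: cvgB; last by apply: cvgM; [exact: cvg_cst|exact: c3].
    apply: cvgD; first by apply: cvgM; [exact: cvg_cst|exact: c2].
    by apply: cvgM; [exact: cvg_cst|apply: cvgM; exact: c1].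
  have -> : Q = fun w => u w - (psi w + sg * `|dotv eta (w.1 - x)|).
    by apply/funext => w; rewrite /Q; ring.
  by move=> w; apply: cvgB; [exact: cuK|exact: (continuous_subspaceT cpsi)].
have Kne : K !=set0 by exists (x, t).
have [[x1 t1] Kz zmin] := compact_EVT_min Kne cK cQ.
rewrite inE in Kz.
have {}zmin w : K w -> Q (x1, t1) <= Q w by move=> Kw; apply: zmin; rewrite inE.
pose y := dotv eta (x1 - x).
have zclose : c * (sqn (x1 - x) + (t1 - t) ^+ 2) <= sg * `|y|.
  have h1 := below _ Kz; have h2 := zmin _ K0.
  have d0 : dotv eta (x - x) = 0 by rewrite subrr /dotv big1// => i _; rewrite mxE mulr0.
  move: h2; rewrite /Q /psi /= !subrr sqn0 -/y.
  have -> : dotv eta 0 = 0 by rewrite -d0 subrr.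
  rewrite expr0n /= normr0 !mulr0 !subr0 addr0 subr0.
  by move: h1; rewrite /psi /= -/y; lra.
have cs : y ^+ 2 <= sqn (x1 - x) by exact: cauchy_schwarz_unit.
have tq := sqr_ge0 (t1 - t).
have yle : `|y| <= sg / c.
  rewrite ler_pdivlMr//; have [->|yn] := eqVneq y 0; first by rewrite normr0 mul0r ltW.
  have yp : 0 < `|y| by rewrite normr_gt0.
  rewrite -(ler_pM2l yp); have : c * y ^+ 2 <= sg * `|y|.
    by apply: le_trans zclose; rewrite ler_pM2l//; lra.
  by rewrite -(real_normK (num_real y)) expr2; lra.
have sgc : 0 <= sg / c by rewrite divr_ge0// ltW.
have total : sqn (x1 - x) + (t1 - t) ^+ 2 <= (sg / c) ^+ 2.
  rewrite -(ler_pM2l c0); apply: le_trans zclose _.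
  have -> : c * (sg / c) ^+ 2 = sg * (sg / c) by field; rewrite gt_eqF.
  by rewrite ler_wpM2l// ltW.
have sgcr : sg / c <= r / 2 by rewrite ler_pdivrMr//; lra.
have xi i : `|x1 0 i - x 0 i| <= sg / c.
  apply: square_le_abs => //; apply: le_trans total.
  by have := coord_sq_le (x1 - x) i; rewrite !mxE; lra.
have ti : `|t1 - t| <= sg / c.
  by apply: square_le_abs => //; apply: le_trans total; rewrite lerDr sqn_ge0.
pose s : R := if 0 <= y then 1 else -1.
have sy : `|y| = s * y.
  rewrite /s; case: ifPn => h; first by rewrite mul1r ger0_norm.
  by rewrite mulN1r ltr0_norm// ltNge.
have s1 : s = 1 \/ s = -1 by rewrite /s; case: ifP; [left|right].
have sle v : s * v <= `|v|.
  by case: s1 => ->; rewrite ?mul1r ?ler_norm// mulN1r -normrN ler_norm.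
have ss : s * s = 1 by case: s1 => ->; rewrite ?mulrNN mulr1.
pose p := (2 * (2 * c + M) * y + sg * s) *: eta + (- (2 * (M + c))) *: (x1 - x).
have pn : p <> 0.
  move=> p0; have : s * dotv p eta = 0.
    by rewrite p0 /dotv big1 ?mulr0// => i _; rewrite mxE mul0r.
  rewrite /p dotvDl !dotvZl dotvv e1 (dotvC _ eta) -/y.
  have -> : s * ((2 * (2 * c + M) * y + sg * s) * 1 + - (2 * (M + c)) * y) =
    2 * c * (s * y) + sg * (s * s) by ring.
  rewrite ss mulr1 -sy => E.
  have : 0 <= 2 * c * `|y| by rewrite !mulr_ge0// ltW.
  by move: E sg0; clear; lra.
have t1pos : 0 < t1 by move: ti; rewrite ler_norml => /andP[h _]; clear - h sgcr rt r0; lra.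
have touch : touches_below u x1 t1 p (lam - 2 * (M + c) * (t1 - t)).
  exists (M + c), (r / 2); split; first by rewrite divr_gt0.
  move=> w w1 w2.
  have Kw : K w.
    split.
      move=> i; have -> : w.1 0 i - x 0 i = (w.1 0 i - x1 0 i) + (x1 0 i - x 0 i) by ring.
      by apply: le_trans (ler_normD _ _) _; have := w1 i; have := xi i; clear - sgcr; lra.
    by move: w2 ti; rewrite !ler_norml => /andP[x2 x3] /andP[x4 x5]; apply/andP; split; clear - sgcr x2 x3 x4 x5; lra.
  have := zmin w Kw; rewrite /Q /psi /= -/y sy.
  have -> : w.1 - x = (x1 - x) + (w.1 - x1) by rewrite [RHS]addrC addrA subrK.
  rewrite dotvDr (sqnD (x1 - x) (w.1 - x1)) -/y; set k := w.1 - x1.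
  have := sle (y + dotv eta k).
  rewrite /p (dotvDl (_ *: eta)) !dotvZl.
  have e2 : 0 <= (2 * c + M) * dotv eta k ^+ 2 by rewrite mulr_ge0 ?sqr_ge0// addr_ge0// mulr_ge0// ltW.
  move: (`|_|) => ab hab.
  have hsg := ler_wpM2l (ltW sg0) hab.
  move: hsg e2; clear.
  move: (u _) (u _) (dotv eta k) (dotv (x1 - x) k) (sqn k) (sqn _) => f1 f2 q1 q2 q3 q4.
  move: (w.2) => w2; rewrite !expr2 => hsg e2 hmin; lra.
have := supersol x1 t1 p _ t1pos touch pn.
move: ti; rewrite ler_norml => /andP[ti1 ti2].
have : - (t1 - t) * (2 * (M + c)) <= sg / c * (2 * (M + c)).
  by rewrite ler_pM2r ?mulr_gt0//; clear - ti1 ti2; lra.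
by move: sge err0; clear - ti1; lra.
Qed.

End Jets.

(** * Vertical segments that avoid a null set *)

Section NullSlices.
Context {R : realType}.

(** Chebyshev's inequality: if the weighted count of the intervals containing y
    exceeded 2 e / rho for all y, its integral over an interval of length rho would
    exceed e. *)
Lemma slice_point (c al be : nat -> R) (e x rho : R) :
  (forall k, 0 <= c k) -> (forall k, al k <= be k) -> 0 < e -> 0 < rho ->
  (\sum_(0 <= k <oo) (c k * (be k - al k))%:E <= e%:E)%E ->
  exists2 y : R, x <= y <= x + rho &
    (\sum_(0 <= k <oo) (c k * (al k <= y <= be k)%R%:R)%:E <= (2 * e / rho)%:E)%E.
Proof.
move=> c0 ab e0 rho0 tot; apply: contrapT => none.
pose S (y : measurableTypeR R) : \bar R := (\sum_(0 <= k <oo) (c k * (al k <= y <= be k)%R%:R)%:E)%E.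
pose D : set (measurableTypeR R) := [set` `[x, x + rho]].
have mD : measurable D by exact: measurable_itv.
have big y : D y -> ((2 * e / rho)%:E <= S y)%E.
  rewrite /D /= in_itv /= => Dy; rewrite leNgt; apply/negP => lt.
  by apply: none; exists y => //; exact: ltW.
pose A k : set (measurableTypeR R) := [set` `[al k, be k]].
have mA k : measurable (A k) by exact: measurable_itv.
pose f k (y : measurableTypeR R) : \bar R := (c k * \1_(A k) y)%:E.
have fE k y : (c k * (al k <= y <= be k)%R%:R)%:E = f k y.
  by rewrite /f indicE /= mem_setE in_itv.
have f0 k y : (0 <= f k y)%E.
  by rewrite /f lee_fin; apply: mulr_ge0; [exact: c0|rewrite indicE; exact: ler0n].
have mf k : measurable_fun D (f k).
  by apply/measurable_EFinP; apply: measurable_funM.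
have SE y : S y = (\sum_(0 <= k <oo) f k y)%E by apply: eq_eseriesr => k _; exact: fE.
have int_f k : (\int[lebesgue_measure]_(y in D) f k y <= (c k * (be k - al k))%:E)%E.
  rewrite /f (@integralZl_indic _ _ _ _ _ mD (fun=> A k))//; last first.
    by move=> ck; have := c0 k; rewrite leNgt ck.
  rewrite integral_indic// EFinM; apply: lee_wpmul2l; first by rewrite lee_fin.
  have muA : lebesgue_measure (A k) = (be k - al k)%:E.
    rewrite /A lebesgue_measure_itv /= lte_fin; case: ltP => [_|h]; first by rewrite EFinB.
    by rewrite (le_anti (introT andP (conj (ab k) h))) subrr.
  by rewrite -muA; apply: le_measure; rewrite ?inE//; exact: measurableI.
have int_S : (\int[lebesgue_measure]_(y in D) S y <= e%:E)%E.
  under eq_integral do rewrite SE.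
  rewrite integral_nneseries//; apply: le_trans tot.
  by apply: lee_nneseries => // k _ _; exact: integral_ge0.
have : ((2 * e)%:E <= \int[lebesgue_measure]_(y in D) S y)%E.
  have -> : (2 * e)%:E = (\int[lebesgue_measure]_(y in D) (2 * e / rho)%:E)%E.
    have muD : lebesgue_measure D = rho%:E.
      by rewrite /D lebesgue_measure_itv /= lte_fin ltrDl rho0 -EFinB addrC addKr.
    rewrite integral_cst// -[X in (_ = _ * X)%E]/(lebesgue_measure D) muD -EFinM.
    by congr EFin; field; rewrite gt_eqF.
  apply: ge0_le_integral => //.
    by move=> y _; rewrite lee_fin divr_ge0 ?mulr_ge0// ltW.
  have -> : S = fun y => (\sum_(0 <= k <oo) f k y)%E by apply/funext.
  exact: ge0_emeasurable_sum.
move=> /le_trans/(_ int_S); rewrite lee_fin; lra.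
Qed.

(** The coordinates of y are chosen one at a time with [slice_point]; each step
    replaces the length of the k-th box in one direction by the indicator of that
    direction.  The remaining weight c k is 1 exactly on the boxes that meet the
    vertical line through y. *)
Lemma null_slice (n : nat) (A : set ('rV[R]_n * R)) (x0 : 'rV[R]_n) (rho theta : R) :
  lebesgue_null A -> 0 < rho -> 0 < theta ->
  exists2 y : 'rV[R]_n, (forall i, x0 0 i <= y 0 i <= x0 0 i + rho) &
  exists c al be : nat -> R, [/\ forall k, 0 <= c k, forall k, al k <= be k,
    (forall t : R, A (y, t) -> exists2 k, c k = 1 & al k <= t <= be k) &
    (\sum_(0 <= k <oo) (c k * (be k - al k))%:E <= theta%:E)%E].
Proof.
move=> nullA rho0 theta0.
pose e := theta * (rho / 2) ^+ n.
have e0 : 0 < e by rewrite mulr_gt0// exprn_gt0// divr_gt0.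
have [a [b [ab cov tot]]] := nullA e e0.
pose ind k (y : 'rV[R]_n) i : R := ((a k).1 0 i <= y 0 i <= (b k).1 0 i)%R%:R.
pose len k i : R := (b k).1 0 i - (a k).1 0 i.
pose wt k (y : 'rV[R]_n) (j : nat) (i : 'I_n) : R := if (i < j)%N then ind k y i else len k i.
have wt0 k y j i : 0 <= wt k y j i.
  by rewrite /wt; case: ifP => _; [exact: ler0n|rewrite subr_ge0 (ab k).1].
have key j : (j <= n)%N -> exists2 y : 'rV[R]_n, (forall i, x0 0 i <= y 0 i <= x0 0 i + rho) &
    (\sum_(0 <= k <oo) ((\prod_i wt k y j i) * ((b k).2 - (a k).2))%:E
      <= (e * (2 / rho) ^+ j)%:E)%E.
  elim: j => [_|j IH jn].
    exists x0; first by move=> i; rewrite lexx lerDl ltW.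
    by rewrite expr0 mulr1; exact: tot.
  have [y ycube ytot] := IH (ltnW jn); pose j' := Ordinal jn.
  pose c k := (\prod_(i < n | i != j') wt k y j i) * ((b k).2 - (a k).2).
  have c0 k : 0 <= c k.
    by rewrite mulr_ge0 ?subr_ge0 ?(ab k).2//; apply: prodr_ge0 => i _; exact: wt0.
  have cE k : (\prod_i wt k y j i) * ((b k).2 - (a k).2) = c k * ((b k).1 0 j' - (a k).1 0 j').
    rewrite (bigD1 j')//= /c; set P := \prod_(i | _) _.
    by rewrite {1}/wt /= ltnn /len; ring.
  have e1 : 0 < e * (2 / rho) ^+ j by rewrite mulr_gt0// exprn_gt0// divr_gt0.
  have tot' : (\sum_(0 <= k <oo) (c k * ((b k).1 0 j' - (a k).1 0 j'))%:E
      <= (e * (2 / rho) ^+ j)%:E)%E.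
    apply: le_trans ytot; apply: lee_nneseries => [k _ _|k _]; last by rewrite cE.
    by rewrite lee_fin mulr_ge0// subr_ge0 (ab k).1.
  have [s scube stot] := slice_point (x0 0 j') c0 (fun k => (ab k).1 j') e1 rho0 tot'.
  exists (\row_i if i == j' then s else y 0 i).
    by move=> i; rewrite mxE; case: eqP => [->|].
  have -> : e * (2 / rho) ^+ j.+1 = 2 * (e * (2 / rho) ^+ j) / rho by rewrite exprS; ring.
  apply: le_trans stot; apply: lee_nneseries => [k _ _|k _].
    rewrite lee_fin mulr_ge0 ?subr_ge0 ?(ab k).2//.
    by apply: prodr_ge0 => i _; exact: wt0.
  rewrite lee_fin (bigD1 j')//= /c {1}/wt /= ltnSn /ind mxE eqxx.
  rewrite (eq_bigr (wt k y j)); first by rewrite [leRHS]mulrC [leRHS]mulrA.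
  move=> i ij; rewrite /wt /ind mxE (negbTE ij) ltnS leq_eqVlt.
  by rewrite (_ : (i == j :> nat) = false)//; apply/negbTE; exact: ij.
have [y ycube ytot] := key n (leqnn n); exists y => //.
exists (fun k => \prod_i ind k y i), (fun k => (a k).2), (fun k => (b k).2); split.
- by move=> k; apply: prodr_ge0 => i _; exact: ler0n.
- by move=> k; exact: (ab k).2.
- move=> t /cov [k _ /= [Hx Ht]]; exists k => //.
  by rewrite big1// => i _; rewrite /ind Hx.
- have -> : theta = e * (2 / rho) ^+ n.
    rewrite /e -mulrA -exprMn; have -> : rho / 2 * (2 / rho) = 1 by field; rewrite gt_eqF.
    by rewrite expr1n mulr1.
  apply: le_trans ytot; apply: lee_nneseries => [k _ _|k _].
    by rewrite lee_fin mulr_ge0 ?subr_ge0 ?(ab k).2//; apply: prodr_ge0 => i _; exact: ler0n.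
  by rewrite lee_fin (eq_bigr (wt k y n))// => i _; rewrite /wt ltn_ord.
Qed.

(** A Lipschitz function maps the intervals to intervals of small total length,
    so that [slice_point] finds a value h that belongs to none of them. *)
Lemma avoid_value (w : R -> R) (a b G h1 h2 theta : R) (c al be : nat -> R) : a <= b -> 0 < G ->
  (forall t s, a <= t <= b -> a <= s <= b -> `|w t - w s| <= G * `|t - s|) ->
  (forall k, 0 <= c k) -> (forall k, al k <= be k) -> h1 < h2 -> 0 < theta ->
  8 * G * theta <= h2 - h1 ->
  (\sum_(0 <= k <oo) (c k * (be k - al k))%:E <= theta%:E)%E ->
  exists2 h : R, h1 <= h <= h2 &
    forall k t, c k = 1 -> a <= t <= b -> al k <= t <= be k -> w t <> h.
Proof.
move=> leab G0 wlip c0 ab h12 theta0 small tot.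
pose cl k := Num.max a (Num.min b (al k)).
have clab k : a <= cl k <= b.
  by rewrite /cl le_max lexx /= ge_max leab ge_min lexx.
pose rad k := G * (c k * (be k - al k)).
have rad0 k : 0 <= rad k by rewrite mulr_ge0 ?(ltW G0)// mulr_ge0// subr_ge0.
have tot' : (\sum_(0 <= k <oo) (1 * ((w (cl k) + rad k) - (w (cl k) - rad k)))%:E
    <= (2 * G * theta)%:E)%E.
  rewrite (eq_eseriesr (g := fun k => ((2 * G)%:E * (c k * (be k - al k))%:E)%E)); last first.
    by move=> k _; rewrite -EFinM; congr EFin; rewrite /rad; ring.
  rewrite nneseriesZl; last by move=> k _; rewrite lee_fin mulr_ge0// subr_ge0.
  by rewrite (EFinM (2 * G) theta); apply: lee_wpmul2l => //; rewrite lee_fin mulr_ge0// ltW.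
have e0 : 0 < 2 * G * theta by rewrite !mulr_gt0.
have d0 : 0 < h2 - h1 by rewrite subr_gt0.
have JJ k : w (cl k) - rad k <= w (cl k) + rad k by have := rad0 k; lra.
have [h hI hs] := slice_point h1 (fun=> ler01) JJ e0 d0 tot'.
exists h; first by have /andP[p1 p2] := hI; rewrite p1; move: p2; lra.
move=> k t ck tab tI wt.
have le1 : `|t - cl k| <= be k - al k.
  move: tI tab => /andP[t1 t2] /andP[t3 t4]; rewrite ler_norml /cl.
  by apply/andP; split; rewrite /Num.max /Num.min; case: ifP; case: ifP; lra.
have hJ : w (cl k) - rad k <= h <= w (cl k) + rad k.
  have := wlip t (cl k) tab (clab k); rewrite wt /rad ck mul1r.
  have := ler_wpM2l (ltW G0) le1; rewrite ler_norml => q1 /andP[q2 q3].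
  by apply/andP; split; lra.
pose term i : R := 1 * (w (cl i) - rad i <= h <= w (cl i) + rad i)%R%:R.
have term0 i : 0 <= term i by rewrite /term mul1r ler0n.
have := @nneseries_lim_ge R (fun i => (term i)%:E) xpredT 0 k.+1
  (fun i _ _ => (term0 i : (0 <= (term i)%:E)%E)).
move=> /le_trans/(_ hs); rewrite big_nat_recr//= {2}/term hJ mul1r => le2.
have : (1%:E <= (2 * (2 * G * theta) / (h2 - h1))%:E)%E.
  by apply: le_trans le2; rewrite leeDr//; apply: sume_ge0 => i _; rewrite lee_fin.
rewrite lee_fin ler_pdivlMr// mul1r; move: small d0 (mulr_gt0 G0 theta0); clear; lra.
Qed.

End NullSlices.

(** * Contact with a paraboloid *)

Section Contact.
Context {R : realType} {n : nat}.
Implicit Types (x y p : 'rV[R]_n) (w z : 'rV[R]_n * R) (u : 'rV[R]_n * R -> R).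

Definition space_time_lipschitz u (L G : R) := forall x y (t s : R), 0 <= t -> 0 <= s ->
  `|u (x, t) - u (y, s)| <= L * enorm (x - y) + G * `|t - s|.

Lemma enorm0 : enorm (0 : 'rV[R]_n) = 0.
Proof. by rewrite /enorm -/(sqn 0) sqn0 sqrtr0. Qed.

Lemma lipschitz_time u (L G : R) : space_time_lipschitz u L G ->
  forall x (t s : R), 0 <= t -> 0 <= s -> `|u (x, t) - u (x, s)| <= G * `|t - s|.
Proof. by move=> H x t s t0 s0; have := H x x t s t0 s0; rewrite subrr enorm0 mulr0 add0r. Qed.

(** The square of the positive part lies below its tangent parabolas of leading
    coefficient 1. *)
Lemma positive_part_sq (a s : R) :
  Num.max 0 (a + s) ^+ 2 <= Num.max 0 a ^+ 2 + 2 * Num.max 0 a * s + s ^+ 2.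
Proof.
have [h1|h1] := leP (a + s) 0; have [h2|h2] := leP a 0; rewrite ?(expr0n, mulr0, mul0r, add0r) /=.
- by rewrite sqr_ge0.
- by have := sqr_ge0 (a + s); rewrite !expr2; lra.
- have h3 : 0 <= - a * (s + (a + s)) by rewrite mulr_ge0//; lra.
  by rewrite !expr2; lra.
- by rewrite !expr2; lra.
Qed.

(** Contact from below in the past is enough.  A term N (s - t)^2 for s > t is
    subtracted from the test function; since u is Lipschitz in time, for large N
    the minimum over a two-sided box is close to (x, t), its gradient is close to p,
    and the extra term only lowers the time derivative. *)
Lemma parabolic_contact u (L G gb : R) : space_time_lipschitz u L G -> 0 <= G ->
  {within closed_half, continuous u} ->
  (forall x1 (t1 : R) p l, 0 < t1 -> touches_below u x1 t1 p l -> p <> 0 -> gb <= l) ->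
  forall x (t r M lam : R) p, 0 < t -> 0 < r -> 0 <= M -> p <> 0 ->
  (forall y (s : R), (forall i, `|y 0 i - x 0 i| <= r) -> t - r <= s <= t ->
    u (x, t) + dotv p (y - x) + lam * (s - t) - M * sqn (y - x) <= u (y, s)) ->
  gb <= lam.
Proof.
move=> ulip G0 cu supersol x t r0 M lam p t0 r00 M0 pn below0.
have [i0 pi0] : exists i, p 0 i != 0.
  by apply: contrapT => H; apply: pn; apply/rowP => i; rewrite mxE; apply/eqP/negP => /negP pi; apply: H; exists i.
pose r := Num.min r0 (t / 2).
have rr0 : r <= r0 by rewrite ge_min lexx.
have rt : r <= t / 2 by rewrite ge_min lexx orbT.
have rp : 0 < r by rewrite lt_min r00 divr_gt0.
clearbody r.
apply/ler_addgt0Pr => err err0.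
have M1 : 0 < M + 1 by rewrite ltr_wpDl.
pose d := Num.min (Num.min (r / 2) (err / 2)) (`|p 0 i0| / (4 * (M + 1))).
have pi1 : 0 < `|p 0 i0| by rewrite normr_gt0.
have d0 : 0 < d by rewrite !lt_min !divr_gt0// mulr_gt0.
have dr : d <= r / 2 by rewrite !ge_min lexx.
have de : d <= err / 2 by rewrite !ge_min lexx orbT.
have dp : 2 * (M + 1) * d < `|p 0 i0|.
  have : d <= `|p 0 i0| / (4 * (M + 1)) by rewrite !ge_min lexx !orbT.
  by rewrite ler_pdivlMr ?mulr_gt0//; move: pi1; lra.
clearbody d.
pose C := G + `|lam|.
pose N := (C / (2 * d)) ^+ 2.
have N0 : 0 <= N by exact: sqr_ge0.
pose pp (s : R) := Num.max 0 (s - t).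
pose Q w := u (x, t) + dotv p (w.1 - x) + lam * (w.2 - t) - (M + 1) * sqn (w.1 - x)
   - (w.2 - t) ^+ 2 - N * pp w.2 ^+ 2.
pose K := box x r (t - r) (t + r).
have gap w : K w -> sqn (w.1 - x) + (w.2 - t) ^+ 2 - d ^+ 2 <= u w - Q w.
  case: w => y s [/= w1 /andP[w2 w3]].
  have y1 i : `|y 0 i - x 0 i| <= r0 by apply: le_trans (w1 i) rr0.
  have [st|ts] := leP s t.
    have ppE : pp s = 0 by rewrite /pp max_l// subr_le0.
    have s1 : t - r0 <= s <= t by rewrite st andbT; lra.
    have := below0 y s y1 s1; rewrite /Q /= ppE expr0n /= mulr0 subr0.
    by have := sqr_ge0 d; lra.
  have ppE : pp s = s - t by rewrite /pp max_r// subr_ge0 ltW.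
  have s1 : t - r0 <= t <= t by rewrite lexx andbT; lra.
  have := below0 y t y1 s1; rewrite subrr mulr0 addr0 => h1.
  have := lipschitz_time ulip y (ltW (lt_trans t0 ts)) (ltW t0).
  rewrite (gtr0_norm (_ : 0 < s - t)) ?subr_gt0// ler_norml => /andP[h2 _].
  have h3 := sqr_ge0 (C / (2 * d) * (s - t) - d).
  have h4 : C / (2 * d) * (s - t) * d = C * (s - t) / 2 by field; rewrite gt_eqF.
  have h5 : 0 <= (`|lam| - lam) * (s - t).
    by rewrite mulr_ge0// subr_ge0; [exact: ler_norm|exact: ltW].
  have h6 : (C / (2 * d)) ^+ 2 * (s - t) ^+ 2 = (C / (2 * d) * (s - t)) ^+ 2 by rewrite [RHS]exprMn.
  rewrite /Q /= ppE /N h6; move: h1 h2 h3 h4 h5; rewrite /C.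
  move: (u (y, s)) (u (y, t)) (u (x, t)) => f1 f2 f3.
  move: (sqn _) (dotv _ _) => q1 q2; set X := _ / _ * _.
  by rewrite !expr2; lra.
have Ksub : K `<=` closed_half by apply: box_closed_half; lra.
have cK : compact K by exact: box_compact.
have cuK := continuous_subspaceW Ksub cu.
have K0 : K (x, t).
  by split => /=; [move=> i; rewrite subrr normr0 ltW|apply/andP; split; lra].
have cQ : {within K, continuous (fun w => u w - Q w)}.
  have cQ0 : continuous Q.
    move=> w.
    have c1 := @dotv_continuous R n p x w.
    have c2 : (v.2 - t) @[v --> w] --> w.2 - t by apply: cvgB; [exact: cvg_snd|exact: cvg_cst].
    have c3 := @sqn_continuous R n x w.
    have c4 : pp v.2 @[v --> w] --> pp w.2.
      by apply: (@continuous_max R _ (fun=> 0) (fun v : 'rV[R]_n * R => v.2 - t) w); [exact: cvg_cst|exact: c2].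
    apply: cvgB; last by apply: cvgM; [exact: cvg_cst|apply: cvgM; exact: c4].
    apply: cvgB; last by apply: cvgM; exact: c2.
    apply: cvgB; last by apply: cvgM; [exact: cvg_cst|exact: c3].
    apply: cvgD; last by apply: cvgM; [exact: cvg_cst|exact: c2].
    by apply: cvgD; [exact: cvg_cst|exact: c1].
  by move=> w; apply: cvgB; [exact: cuK|exact: (continuous_subspaceT cQ0)].
have Kne : K !=set0 by exists (x, t).
have [[x1 t1] Kz zmin] := compact_EVT_min Kne cK cQ.
rewrite inE in Kz.
have {}zmin w : K w -> u (x1, t1) - Q (x1, t1) <= u w - Q w by move=> Kw; apply: zmin; rewrite inE.
have total : sqn (x1 - x) + (t1 - t) ^+ 2 <= d ^+ 2.
  have := gap _ Kz; have := zmin _ K0; rewrite /Q /= !subrr sqn0 /pp subrr.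
  have -> : dotv p 0 = 0 by rewrite /dotv big1// => i _; rewrite mxE mulr0.
  rewrite maxxx expr0n /= !mulr0 !subr0 !addr0 subrr; lra.
have xi i : `|x1 0 i - x 0 i| <= d.
  apply: square_le_abs; [exact: ltW|]; apply: le_trans total.
  by have := coord_sq_le (x1 - x) i; rewrite !mxE; have := sqr_ge0 (t1 - t); lra.
have ti : `|t1 - t| <= d.
  by apply: square_le_abs; [exact: ltW|]; apply: le_trans total; rewrite lerDr sqn_ge0.
pose p1 := p + (- (2 * (M + 1))) *: (x1 - x).
have p1n : p1 <> 0.
  move=> /rowP/(_ i0); rewrite !mxE => E.
  have : `|p 0 i0| <= 2 * (M + 1) * d.
    have -> : p 0 i0 = 2 * (M + 1) * (x1 0 i0 - x 0 i0) by move: E; lra.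
    rewrite normrM ger0_norm; last by rewrite mulr_ge0// ltW.
    by apply: ler_wpM2l; [rewrite mulr_ge0// ltW|exact: xi].
  by move: dp; lra.
have t1pos : 0 < t1 by move: ti; rewrite ler_norml => /andP[h _]; lra.
pose l1 := lam - 2 * (t1 - t) - 2 * N * pp t1.
have touch : touches_below u x1 t1 p1 l1.
  exists (M + 1 + N + 1), (r / 2); split; first by rewrite divr_gt0.
  move=> w w1 w2.
  have Kw : K w.
    split.
      move=> i; have -> : w.1 0 i - x 0 i = (w.1 0 i - x1 0 i) + (x1 0 i - x 0 i) by ring.
      by apply: le_trans (ler_normD _ _) _; have := w1 i; have := xi i; clear - dr; lra.
    by move: w2 ti; rewrite !ler_norml => /andP[x2 x3] /andP[x4 x5]; apply/andP; split; clear - dr x2 x3 x4 x5; lra.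
  have := zmin w Kw; rewrite /Q /=.
  have -> : w.1 - x = (x1 - x) + (w.1 - x1) by rewrite [RHS]addrC addrA subrK.
  rewrite (dotvDr p (x1 - x)) (sqnD (x1 - x) (w.1 - x1)) /p1 (dotvDl p) dotvZl; set k := w.1 - x1.
  have := positive_part_sq (t1 - t) (w.2 - t1).
  have -> : t1 - t + (w.2 - t1) = w.2 - t by ring.
  rewrite -/(pp t1) -/(pp w.2) => hp.
  have {hp} := ler_wpM2l N0 hp.
  have s1 := sqn_ge0 k; have s2 : 0 <= (M + 1) * (w.2 - t1) ^+ 2 by rewrite mulr_ge0 ?sqr_ge0// ltW.
  have s3 := mulr_ge0 N0 s1.
  rewrite /l1; move: s1 s2 s3; clear.
  move: (pp t1) (pp w.2) => P1 P2.
  move: (u _) (u _) (u _) (dotv p k) (dotv p (x1 - x)) (dotv (x1 - x) k) (sqn k) (sqn (x1 - x)) => f1 f2 f3 q0 q1 q2 q3 q4.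
  move: N (w.2) => N' w2; rewrite !expr2; lra.
have := supersol x1 t1 p1 _ t1pos touch p1n.
have pp0 : 0 <= pp t1 by rewrite /pp le_max lexx.
have : 0 <= 2 * N * pp t1 by apply: mulr_ge0 pp0; exact: mulr_ge0.
by move: ti; rewrite /l1 ler_norml => /andP[ti1 ti2]; move: de; lra.
Qed.

(** At a contact from below with a paraboloid the gradients agree, and the one of
    the paraboloid vanishes at its vertex. *)
Lemma contact_gradient u x (t K r : R) : 0 < r ->
  differentiable (fun y => u (y, t)) x ->
  (forall y, (forall i, `|y 0 i - x 0 i| <= r) -> u (x, t) <= u (y, t) + K * sqn (y - x)) ->
  grad u (x, t) = 0.
Proof.
move=> r0 du touch; apply/rowP => i; rewrite !mxE.
pose f (s : R) := u (x + s *: delta_mx 0 i, t).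
have df : is_derive (0 : R) 1 f ('D_(xdir i) u (x, t)).
  have E : (fun h : R => h^-1 *: ((f \o shift 0) (h *: (1 : R)) - f 0)) =
           (fun h : R => h^-1 *: (((fun y => u (y, t)) \o shift x) (h *: delta_mx 0 i) - u (x, t))).
    apply/funext => h; rewrite /f /shift /= addr0 scale0r addr0; congr (_ *: (u (_, _) - _)).
    by rewrite [h *: 1]mulr1 addrC.
  have E' : (fun h : R => h^-1 *: ((u \o shift (x, t)) (h *: xdir i) - u (x, t))) =
           (fun h : R => h^-1 *: (((fun y => u (y, t)) \o shift x) (h *: delta_mx 0 i) - u (x, t))).
    apply/funext => h; rewrite /shift /=; congr (_ *: (u _ - _)).
    by rewrite addrC xdir_shift addrC.
  split; last by rewrite /derive E E'.
  by rewrite /derivable E; exact: (diff_derivable (v := delta_mx 0 i) du).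
have dg : is_derive (0 : R) 1 (fun s => f s + K * (s * s)) ('D_(xdir i) u (x, t)).
  apply: dereq (derD df (derZ K (derM (derid 0) (derid 0)))) _; ring.
apply: (derive_at_min r0 dg) => s; rewrite subr0 => sr.
rewrite !mulr0 addr0 /f scale0r addr0.
have := touch (x + s *: delta_mx 0 i).
have -> : x + s *: delta_mx 0 i - x = s *: delta_mx 0 i by rewrite addrC addKr.
have -> : sqn (s *: delta_mx 0 i : 'rV[R]_n) = s * s.
  by have := sqn_shift (0 : 'rV[R]_n) s i; rewrite add0r sqn0 mxE mulr0 mul0r !add0r expr2.
apply => j; rewrite !mxE eqxx /= (addrC (x 0 j)) addrK.
by case: (j == i); rewrite ?mulr1 ?mulr0 ?normr0 ltW.
Qed.

End Contact.

Section Growth.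
Context {R : realType} {n : nat}.
Implicit Types (x y p : 'rV[R]_n) (w z : 'rV[R]_n * R) (u : 'rV[R]_n * R -> R).

Lemma enorm_cube h (rho : R) : 0 <= rho -> (forall i, `|(h : 'rV[R]_n) 0 i| <= rho) ->
  enorm h <= n%:R * rho.
Proof.
move=> rho0 hle; apply: le_trans (ler_norm _) _; apply: square_le_abs; first by rewrite mulr_ge0.
rewrite enorm_sq exprMn; apply: le_trans (_ : n%:R * rho ^+ 2 <= _).
  have -> : n%:R * rho ^+ 2 = \sum_(i < n) rho ^+ 2 by rewrite sumr_const card_ord mulr_natl.
  apply: ler_sum => i _; rewrite -(real_normK (num_real (h 0 i))).
  by rewrite ler_pXn2r ?nnegrE.
rewrite ler_wpM2r ?sqr_ge0// -natrX ler_nat.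
by case: (n) => // m; rewrite -mulnn leq_pmull.
Qed.

Lemma sublevel_compact (T : topologicalType) (K : set T) (F : T -> R) (h : R) :
  compact K -> {within K, continuous F} -> compact (K `&` [set z | F z <= h]).
Proof.
move=> cK /continuous_closedP cF.
have /closed_subspaceP [V cV VE] := cF _ (@closed_le R h).
have -> : K `&` [set z | F z <= h] = K `&` V by rewrite setIC [RHS]setIC VE.
exact: compact_closedI.
Qed.

(** If the claim failed, w t = u (y, t) - lam t would decrease by a definite amount
    over [a, b] for all y near x0.  For a segment and a level h given by
    [null_slice] and [avoid_value], the first time t1 at which
    u - lam t + K |x - y|^2 reaches h in a box yields a contact point (x1, t1).  Either
    x1 is not y, and [parabolic_contact] contradicts lam < gb, or x1 = y, and
    [contact_gradient] contradicts the nonvanishing of the gradient. *)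
Lemma vertical_growth u (L G gb : R) (A : set ('rV[R]_n * R)) x0 (a b rho lam : R) :
  space_time_lipschitz u L G -> 0 <= L -> 0 <= G ->
  {within closed_half, continuous u} ->
  (forall x1 (t1 : R) p l, 0 < t1 -> touches_below u x1 t1 p l -> p <> 0 -> gb <= l) ->
  lebesgue_null A -> 0 < a -> a < b -> 0 < rho ->
  (forall y (t : R), (forall i, `|y 0 i - x0 0 i| <= rho) -> a <= t <= b -> ~ A (y, t) ->
     differentiable (fun y => u (y, t)) y /\ grad u (y, t) <> 0) ->
  lam < gb -> lam * (b - a) <= u (x0, b) - u (x0, a).
Proof.
move=> ulip L0 G0 cu supersol nullA a0 ab rho0 good lamgb.
rewrite leNgt; apply/negP => drop.
pose D := (u (x0, a) - lam * a) - (u (x0, b) - lam * b).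
have D0 : 0 < D by rewrite /D; move: drop; lra.
pose G1 := G + `|lam| + 1.
have G10 : 0 < G1 by rewrite ltr_wpDl// addr_ge0.
have ba0 : 0 < b - a by rewrite subr_gt0.
have b0 : 0 < b by exact: lt_trans ab.
pose r1 := Num.min rho (D / (8 * (L + 1) * (n%:R + 1))).
have L1 : 0 < L + 1 by rewrite ltr_wpDl.
have n1 : 0 < n%:R + 1 :> R by rewrite ltr_wpDl.
have r10 : 0 < r1 by rewrite lt_min rho0 divr_gt0// !mulr_gt0.
have r1rho : r1 <= rho by rewrite ge_min lexx.
have r1D : L * (n%:R * r1) <= D / 8.
  have : r1 <= D / (8 * (L + 1) * (n%:R + 1)) by rewrite ge_min lexx orbT.
  rewrite ler_pdivlMr ?mulr_gt0// => h.
  have h1 : 0 <= L * r1 by rewrite mulr_ge0// ltW.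
  have h2 : 0 <= n%:R * r1 by rewrite mulr_ge0// ltW.
  by move: h h1 h2 r10; clear; move: (n%:R : R) => N; lra.
clearbody r1.
pose theta := D / (32 * G1).
have theta0 : 0 < theta by rewrite divr_gt0// mulr_gt0.
have [y ycube [c [al [be [c0 albe cov tot]]]]] := null_slice x0 nullA r10 theta0.
have yx i : `|y 0 i - x0 0 i| <= r1.
  by have /andP[h1 h2] := ycube i; rewrite ler_norml; apply/andP; split; move: r10; lra.
have eyx : L * enorm (y - x0) <= D / 8.
  apply: le_trans r1D; apply: ler_wpM2l => //; apply: enorm_cube; first exact: ltW.
  by move=> i; rewrite !mxE.
pose w (t : R) := u (y, t) - lam * t.
have wlip (t s : R) : a <= t <= b -> a <= s <= b -> `|w t - w s| <= G1 * `|t - s|.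
  move=> /andP[t1 _] /andP[s1 _].
  have -> : w t - w s = (u (y, t) - u (y, s)) + - lam * (t - s) by rewrite /w; ring.
  apply: le_trans (ler_normD _ _) _; rewrite normrM normrN.
  have := lipschitz_time ulip y (le_trans (ltW a0) t1) (le_trans (ltW a0) s1).
  by rewrite /G1 !mulrDl mul1r; have := normr_ge0 (t - s); lra.
have dropy : 3 * D / 4 <= w a - w b.
  have := ulip y x0 a a (ltW a0) (ltW a0); have := ulip y x0 b b (ltW b0) (ltW b0).
  rewrite !subrr normr0 mulr0 !addr0 !ler_norml => /andP[q1 q2] /andP[q3 q4].
  by move: q1 q2 q3 q4 eyx; rewrite /w /D; lra.
have h12 : w b < w a - D / 4 by move: dropy D0; lra.
have small : 8 * G1 * theta <= w a - D / 4 - w b.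
  have -> : 8 * G1 * theta = D / 4 by rewrite /theta; field; rewrite gt_eqF.
  by move: dropy D0; lra.
have [h /andP[h1 h2] havoid] := avoid_value (ltW ab) G10 wlip c0 albe h12 theta0 small tot.
(* the paraboloid is steep enough to keep contacts away from the lateral boundary *)
pose K := 2 * L ^+ 2 / D + (G1 * (b - a) + D).
have K0 : 0 < K.
  by rewrite ltr_wpDl ?divr_ge0 ?mulr_ge0 ?sqr_ge0// ?(ltW D0)// ltr_wpDl// mulr_ge0// ltW.
pose F z := u z - lam * z.2 + K * sqn (z.1 - y).
have Flow x (t : R) : a <= t <= b ->
    w t - D / 8 + (G1 * (b - a) + D) * sqn (x - y) <= F (x, t).
  move=> /andP[t1 _]; have t0 : 0 <= t by exact: le_trans (ltW a0) t1.
  have := ulip x y t t t0 t0; rewrite subrr normr0 mulr0 addr0 ler_norml => /andP[q1 _].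
  rewrite /F /w /= /K -(enorm_sq (x - y)).
  have q2 := sqr_ge0 (2 * L * enorm (x - y) - D / 2).
  have q3 : 2 * L ^+ 2 / D * enorm (x - y) ^+ 2 + D / 8 - L * enorm (x - y) =
    (2 * L * enorm (x - y) - D / 2) ^+ 2 / (2 * D) by field; rewrite gt_eqF.
  have q4 : 0 <= (2 * L * enorm (x - y) - D / 2) ^+ 2 / (2 * D).
    by rewrite divr_ge0// mulr_ge0// ltW.
  rewrite -q3 in q4; rewrite (mulrDl (2 * L ^+ 2 / D)); move: q1 q4; clear; move: (_ / D * _) ((_ + D) * _).
  by move=> X1 X2; lra.
pose B := box y 2 a b.
have Bsub : B `<=` closed_half by apply: box_closed_half; exact: ltW.
have cuB := continuous_subspaceW Bsub cu.
have cF : {within B, continuous F}.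
  have cF0 : continuous (fun z : 'rV[R]_n * R => - (lam * z.2) + K * sqn (z.1 - y)).
    move=> z; apply: cvgD; last by apply: cvgM; [exact: cvg_cst|exact: sqn_continuous].
    by apply: cvgN; apply: cvgM; [exact: cvg_cst|exact: cvg_snd].
  have -> : F = fun z => u z + (- (lam * z.2) + K * sqn (z.1 - y)).
    by apply/funext => z; rewrite /F; ring.
  by move=> z; apply: cvgD; [exact: cuB|exact: (continuous_subspaceT cF0)].
have cS := @sublevel_compact _ B F h (@box_compact R n y 2 a b) cF.
have S0 : (B `&` [set z | F z <= h]) (y, b).
  split; first by split => /= [i|]; rewrite ?subrr ?normr0// lexx ltW.
  by rewrite /= /F /= subrr sqn0 mulr0 addr0.
have csnd : {within B `&` [set z | F z <= h], continuous (fun z : 'rV[R]_n * R => z.2)}.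
  by apply: continuous_subspaceT => z; exact: cvg_snd.
have [[x1 t1] zS zmin] := compact_EVT_min (ex_intro _ _ S0) cS csnd.
rewrite inE in zS; case: zS => -[/= x1y /andP[at1 t1b]] Fh.
have {}zmin z : B z -> F z <= h -> t1 <= z.2.
  by move=> Bz Fz; apply: (zmin z); rewrite inE.
have atb : a <= t1 <= b by rewrite at1 t1b.
have low1 := Flow x1 t1 atb.
have x1r i : `|x1 0 i - y 0 i| <= 1.
  rewrite -[leRHS]ger0_norm//; apply: square_le_abs; first exact: normr_ge0.
  rewrite normr1 expr1n; apply: le_trans (_ : sqn (x1 - y) <= 1).
    by have := coord_sq_le (x1 - y) i; rewrite !mxE.
  rewrite leNgt; apply/negP => sq1.
  have ha : w a - G1 * (b - a) <= w t1.
    have := wlip t1 a atb; rewrite lexx (ltW ab) => /(_ isT).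
    rewrite (ger0_norm (_ : 0 <= t1 - a)) ?subr_ge0// ler_norml => /andP[q _].
    have : G1 * (t1 - a) <= G1 * (b - a) by apply: ler_wpM2l; [exact: ltW|clear - t1b; lra].
    by move: q; clear; lra.
  have k0 : 0 <= (G1 * (b - a) + D) * (sqn (x1 - y) - 1).
    apply: mulr_ge0; first by rewrite addr_ge0 ?mulr_ge0// ltW.
    by rewrite subr_ge0 ltW.
  by move: low1 Fh ha h2 k0 D0; move: (sqn (x1 - y)) (F _) (w a) (w t1) => q1 q2 q3 q4; clear; lra.
have at1' : a < t1.
  rewrite lt_neqAle at1 andbT; apply/eqP => E; move: low1 Fh h2; rewrite -E.
  have : 0 <= (G1 * (b - a) + D) * sqn (x1 - y).
    by rewrite mulr_ge0 ?sqn_ge0// addr_ge0 ?mulr_ge0// ltW.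
  by move: D0; clear; lra.
have t10 : 0 < t1 by exact: lt_trans at1'.
have Fbefore x (t : R) : (forall i, `|x 0 i - y 0 i| <= 2) -> a <= t -> t < t1 -> h < F (x, t).
  move=> xy at_ tt1; rewrite ltNge; apply/negP => Fx.
  have : t1 <= t.
    by apply: (zmin (x, t)) => //; split => //=; rewrite at_ (le_trans (ltW tt1)).
  by rewrite leNgt tt1.
have Fat x (t : R) : (forall i, `|x 0 i - y 0 i| <= 2) -> a <= t <= t1 -> h <= F (x, t).
  move=> xy /andP[at_ tt1]; move: tt1; rewrite le_eqVlt => /orP[/eqP ->|tt1]; last first.
    exact/ltW/Fbefore.
  apply/ler_addgt0Pr => e e0.
  pose s := Num.max a (t1 - e / G1).
  have sa : a <= s by rewrite le_max lexx.
  have st : s < t1 by rewrite gt_max at1' /= gtrBl divr_gt0.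
  have se : G1 * (t1 - s) <= e.
    have : t1 - e / G1 <= s by rewrite le_max lexx orbT.
    by move=> q; rewrite mulrC -ler_pdivlMr//; move: q; clear; lra.
  have := Fbefore x s xy sa st; rewrite /F /=.
  have := lipschitz_time ulip x (ltW t10) (le_trans (ltW a0) sa).
  rewrite (gtr0_norm (_ : 0 < t1 - s)) ?subr_gt0// ler_norml => /andP[q _].
  have q1 : - lam * (s - t1) <= `|lam| * (t1 - s).
    have -> : - lam * (s - t1) = lam * (t1 - s) by ring.
    by apply: ler_wpM2r; [rewrite subr_ge0 ltW|exact: ler_norm].
  by move: q q1 se st; rewrite /G1; clear; lra.
have x1y' i : `|x1 0 i - y 0 i| <= 2 by apply: le_trans (x1r i) _; clear; lra.
have FE : F (x1, t1) = h by apply/le_anti; rewrite Fh Fat// lexx ltW.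
have [E|x1n] := eqVneq x1 y.
  have [Ay|nAy] := pselect (A (y, t1)).
    have [k ck tk] := cov t1 Ay; apply: (havoid k t1 ck atb tk).
    by rewrite -FE E /F /= subrr sqn0 mulr0 addr0.
  have [diff_y grad_y] := good y t1 (fun i => le_trans (yx i) r1rho) atb nAy.
  apply: grad_y; apply: (contact_gradient (K := K) (r := 2)) => // x xy.
  have := Fat x t1 xy; rewrite lexx ltW//= => /(_ isT); rewrite -FE E /F /= subrr sqn0 mulr0.
  by lra.
pose p := (- (2 * K)) *: (x1 - y).
have pn : p <> 0.
  by apply/eqP; rewrite scaler_eq0 oppr_eq0 mulf_eq0 pnatr_eq0 /= gt_eqF//= subr_eq0.
have : gb <= lam; last by rewrite leNgt lamgb.
pose r := Num.min 1 (t1 - a).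
have rp : 0 < r by rewrite lt_min ltr01 subr_gt0.
apply: (parabolic_contact (x := x1) ulip G0 cu supersol t10 rp (ltW K0) pn) => x s xx1 /andP[s1 s2].
have xy i : `|x 0 i - y 0 i| <= 2.
  have -> : x 0 i - y 0 i = (x 0 i - x1 0 i) + (x1 0 i - y 0 i) by ring.
  apply: le_trans (ler_normD _ _) _; have := x1r i.
  have : `|x 0 i - x1 0 i| <= 1 by apply: le_trans (xx1 i) _; rewrite ge_min lexx.
  by clear; lra.
have sa : a <= s by have : r <= t1 - a; [rewrite ge_min lexx orbT|clear - s1; lra].
have := Fat x s xy; rewrite sa s2 -FE => /(_ isT); rewrite /F /=.
have -> : x - y = (x1 - y) + (x - x1) by rewrite [RHS]addrC addrA subrK.
rewrite (sqnD (x1 - y) (x - x1)) /p dotvZl.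
move: (u (x, s)) (u (x1, t1)) (dotv (x1 - y) (x - x1)) (sqn (x1 - y)) (sqn (x - x1)).
by move: (K) => K' *; lra.
Qed.

End Growth.

(** * Properties of the limit and of the envelopes *)

Section Limit.
Context {R : realType} {n : nat}.
Implicit Types (x y p h : 'rV[R]_n) (X : 'M[R]_n) (w z : 'rV[R]_n * R) (u : 'rV[R]_n * R -> R).
Implicit Types (F : 'rV[R]_n -> 'M[R]_n -> R) (g : R -> R).

Lemma lipschitz_constant g : lipschitz g ->
  exists2 l : R, 0 <= l & forall a b : R, `|g a - g b| <= l * `|a - b|.
Proof.
move=> /pinfty_ex_gt0[l l0 lip]; exists l; first exact: ltW.
by move=> x y; exact: (lip (x, y)).
Qed.

Lemma lipschitz_bound_continuous g (l : R) :
  (forall a b : R, `|g a - g b| <= l * `|a - b|) -> continuous g.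
Proof.
move=> lip a; apply/cvgrPdist_le => d d0.
have l1 : 0 < `|l| + 1 by rewrite ltr_wpDl.
have q0 : 0 < d / (`|l| + 1) by rewrite divr_gt0.
apply/nbhs_ballP; exists (d / (`|l| + 1)) => //= b; rewrite /ball /= ltr_pdivlMr// => ab.
apply: le_trans (lip a b) _; apply: le_trans (ltW ab); rewrite [leRHS]mulrC ler_wpM2r//.
by apply: le_trans (ler_norm l) _; rewrite lerDl.
Qed.

Lemma positive_periodic_bounds g : periodic g 1 -> continuous g -> (forall c : R, 0 < g c) ->
  exists a b : R, 0 < a /\ forall c : R, a <= g c <= b.
Proof.
move=> gp cg g0; have [s1 smax] := periodic_max gp cg.
have [||s2 smin] := @periodic_max R (fun c => - g c).
- by move=> c; rewrite gp.
- by move=> c; apply: cvgN; exact: cg.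
exists (g s2), (g s1); split => // c; rewrite smax andbT -lerN2; exact: smin.
Qed.

Lemma le_sup_norm g (b : R) : (forall c : R, `|g c| <= b) -> forall c : R, `|g c| <= sup_norm g.
Proof.
move=> gb c; apply: ub_le_sup; last by exists c.
by exists b => _ [t _ <-]; exact: gb.
Qed.

Lemma uniform_limit_eps (K : set ('rV[R]_n * R)) (U : nat -> 'rV[R]_n * R -> R) u (d : R) :
  {uniform K, U @ \oo --> u} -> 0 < d ->
  exists N, forall k, (N <= k)%N -> forall z, K z -> `|U k z - u z| <= d.
Proof.
move=> H d0.
have /H : nbhs (u : {uniform` K -> R}) [set f | forall z, K z -> `|f z - u z| <= d].
  apply/uniform_nbhs; exists [set xy | ball xy.1 d xy.2]; split; first exact: (entourage_ball _ (PosNum d0)).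
  move=> f Hf z Kz; have := Hf z Kz; rewrite /ball /= /ball_ /= distrC; exact: ltW.
by case=> N _ HN; exists N => k Nk; exact: HN.
Qed.

Lemma heat_limit_approximation (alpha : R) g (u0 : 'rV[R]_n -> R) ueps u :
  (forall eps : R, 0 < eps -> heat_solution eps alpha g u0 (ueps eps)) ->
  locally_uniform_limit ueps u ->
  exists e : nat -> R, wave_approximation alpha g e (fun k => ueps (e k)) u.
Proof.
move=> sol [e [e0 elim conv]]; exists e; split => //.
- move=> d d0; have /cvgrPdist_le/(_ d d0) [N _ HN] := elim.
  by exists N => k Nk; have := HN k Nk; rewrite sub0r normrN gtr0_norm.
- by move=> k; have [cont _ _ _ _] := sol _ (e0 k); have [reg _] := heat_solution_regular (sol _ (e0 k)).
- by move=> k z oz; have [_ eqn] := heat_solution_regular (sol _ (e0 k)); exact: eqn.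
- by move=> K cK Ksub d d0; exact: uniform_limit_eps (conv K cK Ksub) d0.
Qed.

Lemma pointwise_limit (alpha : R) g (e : nat -> R) U u z (d : R) :
  wave_approximation alpha g e U u -> closed_half z -> 0 < d ->
  exists N, forall k, (N <= k)%N -> `|U k z - u z| <= d.
Proof.
move=> [_ _ _ _ conv] hz d0.
have [N HN] := conv [set z] (@compact_set1 _ z) (fun w (wz : w = z) => eq_ind_r closed_half hz wz) d d0.
by exists N => k Nk; exact: HN.
Qed.

Lemma limit_initial_value (alpha : R) g (u0 : 'rV[R]_n -> R) (e : nat -> R) ueps u x :
  (forall eps : R, 0 < eps -> heat_solution eps alpha g u0 (ueps eps)) ->
  wave_approximation alpha g e (fun k => ueps (e k)) u -> u (x, 0) = u0 x.
Proof.
move=> sol app; have [e0 _ _ _ _] := app.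
have h0 : closed_half (x, 0 : R) by rewrite /closed_half /=.
apply/eqP; rewrite -subr_eq0 -normr_le0; apply/ler_addgt0Pr => d d0; rewrite add0r.
have [N HN] := pointwise_limit app h0 d0; have := HN N (leqnn N).
by have [_ init _ _ _] := sol _ (e0 N); rewrite init distrC.
Qed.

(** In [heat_modulus] the parameter delta is chosen first, to make L delta / 2
    small, and then the index of the sequence. *)
Lemma limit_modulus (alpha l L G : R) g (u0 : 'rV[R]_n -> R) (e : nat -> R) ueps u :
  0 < alpha -> 0 <= l -> 0 <= L ->
  (forall a b, `|g a - g b| <= l * `|a - b|) -> periodic g 1 -> (forall a, `|g a| <= G) ->
  (forall x y, `|u0 x - u0 y| <= L * enorm (x - y)) ->
  (forall eps : R, 0 < eps -> heat_solution eps alpha g u0 (ueps eps)) ->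
  wave_approximation alpha g e (fun k => ueps (e k)) u ->
  space_time_lipschitz u L G.
Proof.
move=> al0 l0 L0 gl gp gG u0L sol app; have [e0 esmall _ _ _] := app.
suff fwd x y (t s : R) : 0 <= t -> t <= s ->
    `|u (x, t) - u (y, s)| <= L * enorm (x - y) + G * `|t - s|.
  move=> x y t s t0 s0; have [ts|st] := leP t s; first exact: fwd.
  have -> : enorm (x - y) = enorm (y - x).
    by rewrite /enorm; congr Num.sqrt; apply: eq_bigr => i _; rewrite !mxE -sqrrN opprB.
  by rewrite distrC (distrC t); apply: fwd => //; exact: ltW.
move=> t0 ts; have s0 := le_trans t0 ts.
apply/ler_addgt0Pr => err err0.
pose delta := err / (2 * (L + 1)).
have L1 : 0 < L + 1 by rewrite ltr_wpDl.
have delta0 : 0 < delta by rewrite divr_gt0// mulr_gt0.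
have Ld : L * delta / 2 <= err / 4.
  have E : err = 2 * (L + 1) * delta by rewrite /delta; field; rewrite gt_eqF.
  by have := ltW delta0; rewrite E; lra.
pose C := L * n%:R / delta * (s - t).
have C0 : 0 <= C.
  apply: mulr_ge0; last by rewrite subr_ge0.
  by apply: divr_ge0; [exact: mulr_ge0|exact: ltW].
have err8 : 0 < err / 8 by rewrite divr_gt0.
have C1 : 0 < C + 1 by rewrite ltr_wpDl.
have [e1 e10 He1] := powR_small al0 (divr_gt0 err8 C1).
have [N1 H1] := esmall _ e10; have [N2 H2] := esmall _ err8.
have [N3 H3] := pointwise_limit (z := (x, t)) app t0 err8.
have [N4 H4] := pointwise_limit (z := (y, s)) app s0 err8.
pose k := (N1 + N2 + N3 + N4)%N.
have k1 : (N1 <= k)%N by rewrite /k -!addnA leq_addr.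
have k2 : (N2 <= k)%N by rewrite /k -!addnA addnCA leq_addr.
have k3 : (N3 <= k)%N by rewrite /k (addnC _ N3) -addnA leq_addr.
have k4 : (N4 <= k)%N by rewrite /k leq_addl.
have {}H1 := He1 _ (e0 k) (H1 k k1); have {}H2 := H2 k k2.
have {}H3 := H3 k k3; have {}H4 := H4 k k4; clearbody k.
have st0 : 0 <= s - t by rewrite subr_ge0.
have := heat_modulus x (y - x) (e0 k) l0 L0 delta0 t0 st0 gl gp gG u0L (sol _ (e0 k)).
rewrite !(addrC _ (_ - _)) !subrK => H5.
have Ce : e k `^ alpha * L * n%:R / delta * (s - t) <= err / 8.
  have -> : e k `^ alpha * L * n%:R / delta * (s - t) = e k `^ alpha * C by rewrite /C; ring.
  have : e k `^ alpha * (C + 1) <= err / 8 by rewrite -ler_pdivlMr.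
  by rewrite mulrDr mulr1; have := powR_ge0 (e k) alpha; lra.
have -> : enorm (x - y) = enorm (y - x).
  by rewrite /enorm; congr Num.sqrt; apply: eq_bigr => i _; rewrite !mxE -sqrrN opprB.
rewrite (distrC t) (ger0_norm st0).
move: H5 H3 H4 H2 Ld Ce; rewrite mulrDl !ler_norml.
move: (ueps _ _) (ueps _ _) (u _) (u _) (enorm _) (_ / delta * _) => f1 f2 f3 f4 f5 f6.
move=> /andP[? ?] /andP[? ?] /andP[? ?] ? ? ?; apply/andP; split; lra.
Qed.

Lemma lipschitz_continuous_half u (L G : R) : 0 <= L -> 0 <= G ->
  space_time_lipschitz u L G ->
  (forall z w, closed_half z -> closed_half w -> `|u z - u w| <= (L * n%:R + G) * `|z - w|).
Proof.
move=> L0 G0 lip [x t] [y s] t0 s0; apply: le_trans (lip x y t s t0 s0) _.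
rewrite mulrDl; apply: lerD.
  rewrite -mulrA; apply: ler_wpM2l => //; apply: enorm_cube => // i.
  apply: (@le_trans _ _ `|x - y|); last by rewrite prod_normE /= le_max lexx.
  rewrite [leRHS]/Num.norm /= mx_normrE.
  by apply: (le_bigmax_cond _ (fun ij : 'I_1 * 'I_n => `|(x - y) ij.1 ij.2|) (j := (0, i))).
by apply: ler_wpM2l => //; rewrite prod_normE /= le_max lexx orbT.
Qed.

Lemma lipschitz_within_continuous (A : set ('rV[R]_n * R)) u (C : R) :
  (forall z w, A z -> A w -> `|u z - u w| <= C * `|z - w|) -> {within A, continuous u}.
Proof.
move=> lip; apply/subspace_continuousP => z Az; apply/cvgrPdist_le => d d0.
have l1 : 0 < `|C| + 1 by rewrite ltr_wpDl.
have q0 : 0 < d / (`|C| + 1) by rewrite divr_gt0.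
rewrite /within /=; apply/nbhs_ballP; exists (d / (`|C| + 1)) => //= w.
rewrite -ball_normE /ball_ /= ltr_pdivlMr// => zw Aw.
apply: le_trans (lip z w Az Aw) _; apply: le_trans (ltW zw); rewrite [leRHS]mulrC ler_wpM2r//.
by apply: le_trans (ler_norm C) _; rewrite lerDl.
Qed.

Lemma le_usc_envelope F p X (lam : R) :
  (forall r : R, 0 < r -> exists2 q, ball p r q & lam <= F q X) -> X^T = X ->
  (lam%:E <= usc_envelope F p X)%E.
Proof.
move=> near_p symX; apply: le_ereal_inf_tmp => _ [r /= r0 <-].
have [q pq lamq] := near_p r r0.
apply: (@le_trans _ _ (F q X)%:E); first by rewrite lee_fin.
apply: ereal_sup_ubound; exists (q, X) => //; split => //.
by split => //=; exact: ballxx.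
Qed.

Lemma lsc_envelope_le F p X (lam : R) : F p X <= lam -> X^T = X ->
  (lsc_envelope F p X <= lam%:E)%E.
Proof.
move=> FpX symX; apply: ge_ereal_sup => _ [r /= r0 <-].
apply: (@le_trans _ _ (F p X)%:E); last by rewrite lee_fin.
apply: ereal_inf_lbound; exists (p, X) => //; split => //; exact: ballxx.
Qed.

(** Every neighbourhood contains nonzero gradients; this is why the upper
    envelope of the operator is constant. *)
Lemma nonzero_near p (r : R) : (0 < n)%N -> 0 < r -> exists2 q, ball p r q & q <> 0.
Proof.
move=> n0 r0; have [p0|pn] := eqVneq p 0; last first.
  by exists p; [exact: ballxx|exact/eqP].
exists (const_mx (r / 2)).
  rewrite -ball_normE /ball_ /= p0 sub0r normrN.
  apply: le_lt_trans (_ : r / 2 < r); last by rewrite ltr_pdivrMr//; lra.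
  by apply: rV_norm_le => [|i]; rewrite ?mxE ?ger0_norm ?divr_ge0// ltW.
move=> /rowP/(_ (Ordinal n0)); rewrite !mxE => E.
by have : 0 < r / 2 by [rewrite divr_gt0]; rewrite E ltxx.
Qed.

Lemma cbar_minus0 g : cbar_minus g (enorm (0 : 'rV[R]_n)) = harmonic_avg g.
Proof. by rewrite /cbar_minus enorm0 eqxx. Qed.

Lemma cbar_minus_neq0 g p : p <> 0 -> cbar_minus g (enorm p) = unit_avg g.
Proof.
move=> pn; rewrite /cbar_minus; case: eqP => // p0; exfalso; apply: pn.
by apply: sqn_eq0; rewrite -enorm_sq p0 expr0n.
Qed.

(** The growth of u along the vertical segment that ends at the contact point
    bounds the time derivative of every test function from below. *)
Lemma supersolution_ae u (L G gb : R) (O : set ('rV[R]_n * R)) x (t : R) p X lam :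
  space_time_lipschitz u L G -> 0 <= L -> 0 <= G ->
  {within closed_half, continuous u} ->
  (forall x1 (t1 : R) p l, 0 < t1 -> touches_below u x1 t1 p l -> p <> 0 -> gb <= l) ->
  open O -> grad_neq0_ae_in (O `&` closed_half) u -> O (x, t) -> 0 < t ->
  subjet u (x, t) (p, X, lam) -> gb <= lam.
Proof.
move=> ulip L0 G0 cu supersol oO ae Oz t0 jet.
have [_ [M [r [r0 touch]]]] := subjet_touches t0 jet.
have [/= rho rho0 ballO] := (nbhs_ballP _ _).1 (open_nbhs_nbhs (conj oO Oz)).
apply/ler_addgt0Pr => err err0.
pose h := Num.min (Num.min r (t / 2)) (Num.min (rho / 2) (err / (2 * (`|M| + 1)))).
have M1 : 0 < `|M| + 1 by rewrite ltr_wpDl.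
have h0 : 0 < h by rewrite !lt_min r0 !divr_gt0// mulr_gt0.
have hr : h <= r by rewrite !ge_min lexx.
have ht : h <= t / 2 by rewrite !ge_min lexx !orbT.
have hrho : h <= rho / 2 by rewrite !ge_min lexx !orbT.
have herr : M * h <= err / 2.
  have : h <= err / (2 * (`|M| + 1)) by rewrite !ge_min lexx !orbT.
  rewrite ler_pdivlMr ?mulr_gt0// => q.
  by have := ler_wpM2r (ltW h0) (ler_norm M); move: q h0; lra.
clearbody h.
rewrite leNgt; apply/negP => ltgb.
pose lam' := gb - err / 4.
have lam'gb : lam' < gb by rewrite /lam'; lra.
have th0 : 0 < t - h by lra.
have tht : t - h < t by lra.
have rho2 : 0 < rho / 2 by rewrite divr_gt0.
have good y (s : R) : (forall i, `|y 0 i - x 0 i| <= rho / 2) -> t - h <= s <= t ->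
    ~ (O `&` closed_half `\` [set z | differentiable (fun y => u (y, z.2)) z.1 /\ grad u z <> 0]) (y, s) ->
    differentiable (fun y => u (y, s)) y /\ grad u (y, s) <> 0.
  move=> yx /andP[s1 s2] nbad; apply: contrapT => bad; apply: nbad; split => //; split.
    apply: ballO; rewrite -ball_normE /ball_ /= prod_normE /= gt_max; apply/andP; split.
      apply: le_lt_trans (_ : rho / 2 < rho); last by rewrite ltr_pdivrMr//; lra.
      by apply: rV_norm_le => [|i]; rewrite ?(ltW rho2)// !mxE distrC.
    by rewrite ltr_norml; apply/andP; split; lra.
  by rewrite /closed_half /=; lra.
have := vertical_growth ulip L0 G0 cu supersol ae th0 tht rho2 good lam'gb.
have w1 i : `|(x, t - h).1 0 i - x 0 i| <= r by rewrite /= subrr normr0 ltW.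
have w2 : `|(x, t - h).2 - t| <= r by rewrite /= addrC addKr normrN gtr0_norm.
have := touch (x, t - h) w1 w2 => /=; rewrite subrr sqn0.
have -> : dotv p 0 = 0 by rewrite /dotv big1// => i _; rewrite mxE mulr0.
move: herr ltgb h0 err0; rewrite /lam'; clear.
move: (u _) (u _) => f1 f2 q1 q2 h0 err0 q3 q4.
have q5 : M * h * h <= err / 2 * h by rewrite ler_wpM2r// ltW.
have q6 : (lam + err) * h < gb * h by rewrite ltr_pM2r.
have q7 : 0 < err * h by rewrite mulr_gt0.
by move: q3 q4 q5 q6 q7; rewrite !expr2; lra.
Qed.

End Limit.

(** * The limit problem *)

Theorem theorem5p4 (R : realType) (n : nat) (n_gt0 : (0 < n)%N)
  (g : R -> R) (g_lip : lipschitz g) (g_per : periodic g 1)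
  (g_gt0 : forall y : R, 0 < g y)
  (u0 : 'rV[R]_n -> R) (L : R)
  (u0_lip : forall x y : 'rV[R]_n, `|u0 x - u0 y| <= L * enorm (x - y))
  (alpha : R) (alpha_in : 0 < alpha < 1)
  (ueps : R -> 'rV[R]_n * R -> R)
  (ueps_sol : forall eps : R, 0 < eps -> heat_solution eps alpha g u0 (ueps eps))
  (u : 'rV[R]_n * R -> R) (u_lim : locally_uniform_limit ueps u) :
  ([lipschitz u z | z in closed_half] /\
    (forall x y (t s : R), 0 <= t -> 0 <= s ->
      `|u (x, t) - u (y, s)| <= L * enorm (x - y) + sup_norm g * `|t - s|)) /\
  cauchy_viscosity_solution (fun p _ => cbar_minus g (enorm p)) u0 u /\
  (forall Omega, open_in_closed_half Omega -> grad_neq0_ae_in Omega u ->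
    viscosity_solution_in Omega (fun _ _ => unit_avg g) u) /\
  (forall z X (lambda : R), open_half z -> superjet u z (0, X, lambda) ->
    negative_definite X -> lambda <= harmonic_avg g) /\
  (forall z X (lambda : R), open_half z -> subjet u z (0, X, lambda) ->
    (exists eta : 'rV[R]_n, exists delta : R,
      [/\ eta != 0, 0 < delta &
          delta * enorm eta ^+ 2 <= (eta *m X *m eta^T) 0 0]) ->
    unit_avg g <= lambda).
Proof.
have L0 : 0 <= L.
  have := le_trans (normr_ge0 _) (u0_lip (delta_mx 0 (Ordinal n_gt0)) 0).
  rewrite subr0 => h; have := coord_le_enorm (delta_mx 0 (Ordinal n_gt0) : 'rV[R]_n) (Ordinal n_gt0).
  by rewrite mxE !eqxx normr1 => h1; rewrite -(pmulr_lge0 _ (lt_le_trans ltr01 h1)).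
have [l l0 gl] := lipschitz_constant g_lip.
have cg := lipschitz_bound_continuous gl.
have [a [b [a0 gab]]] := positive_periodic_bounds g_per cg g_gt0.
have gG : forall c : R, `|g c| <= sup_norm g.
  by apply: (@le_sup_norm R g b) => c; rewrite gtr0_norm//; have /andP[] := gab c.
have G0 : 0 <= sup_norm g := le_trans (normr_ge0 (g 0)) (gG 0).
have al0 : 0 < alpha by have /andP[] := alpha_in.
have [e app] := heat_limit_approximation ueps_sol u_lim.
have ulip : space_time_lipschitz u L (sup_norm g).
  exact: (limit_modulus al0 l0 L0 gl g_per gG u0_lip ueps_sol app).
have init x : u (x, 0) = u0 x by exact: (limit_initial_value x ueps_sol app).
have uhalf := lipschitz_continuous_half L0 G0 ulip.
have cu := lipschitz_within_continuous uhalf.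
have below x (t : R) p lam : 0 < t -> touches_below u x t p lam ->
    harmonic_avg g <= lam /\ (p <> 0 -> unit_avg g <= lam).
  by move=> t0 [M [r [r0 H]]]; exact: (limit_supersolution alpha_in a0 gab gl cg g_per app t0 r0 H).
have above x (t : R) p lam : 0 < t -> touches_above u x t p lam -> lam <= unit_avg g.
  by move=> t0 [M [r [r0 H]]]; exact: (limit_subsolution alpha_in a0 gab gl cg g_per app t0 r0 H).
have steep x (t : R) p lam : 0 < t -> touches_below u x t p lam -> p <> 0 -> unit_avg g <= lam.
  by move=> t0 H; exact: (below x t p lam t0 H).2.
split; [split=> //|split; [split; split|split; [|split]]].
- apply: (@klipschitzW _ _ _ (L * n%:R + sup_norm g)).
    by apply: (@globally_properfilter _ _ ((0, 0), (0, 0))); rewrite /closed_half /=.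
  by move=> [z w] [/= hz hw]; exact: uhalf.
- split => // -[x t] _ t0 p X lam /(superjet_touches t0) [symX touch].
  apply: le_usc_envelope symX => r r0; have [q pq qn] := nonzero_near p n_gt0 r0.
  by exists q => //; rewrite cbar_minus_neq0//; exact: above touch.
- by move=> x; rewrite init.
- split => // -[x t] _ t0 p X lam /(subjet_touches t0) [symX touch].
  apply: lsc_envelope_le symX; have [h1 h2] := below x t p lam t0 touch.
  by have [->|/eqP pn] := eqVneq p 0; [rewrite cbar_minus0|rewrite cbar_minus_neq0//; exact: h2].
- by move=> x; rewrite init.
- move=> Omega [W oW ->] ae.
  have cO := continuous_subspaceW (@subIsetr _ W closed_half) cu.
  split; split => // -[x t] [Wz _] t0 p X lam jet.
    have [symX touch] := superjet_touches t0 jet.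
    apply: le_usc_envelope symX => r r0; exists p; first exact: ballxx.
    exact: above touch.
  have [symX _] := subjet_touches t0 jet.
  apply: lsc_envelope_le symX.
  exact: (supersolution_ae ulip L0 G0 cu steep oW ae Wz t0 jet).
- move=> [x t] X lam t0 jet negX; have [M [r [d [r0 d0 H]]]] := superjet_concave t0 jet negX.
  exact: (limit_subsolution_concave a0 gab gl cg g_per app t0 r0 d0 H).
- move=> [x t] X lam t0 jet dir.
  exact: (subjet_convex_direction t0 cu steep jet dir).
Qed.
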